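(* Let $d\ge1$, let $\varphi:[0,\infty)\to[0,\infty)$ satisfy $\Lambda=\int_0^\infty\varphi(t)\,dt<1$, and let $(\mu_i)_{i\in\mathbb Z^d}$ be a bounded family of nonnegative numbers. Let $(Z^i_t)_{i\in\mathbb Z^d,t\ge0}$ be the nearest neighbour linear Hawkes process on $\mathbb Z^d$ with parameters $\varphi$ and $(\mu_i)_{i\in\mathbb Z^d}$ (defined in the context). Then for all $i\in\mathbb Z^d$, $t^{-1}Z^i_t$ goes in probability, as $t\to\infty$, to $\sum_{j\in\mathbb Z^d}Q_\Lambda(i,j)\mu_j$.
   Context: $\mathbb Z^d$ is endowed with the set of edges $\mathcal E=\{(i,j)\in(\mathbb Z^d)^2:|i-j|=0\text{ or }1\}$, where $|\cdot|$ is the Euclidean norm (so each point has $2d+1$ neighbours, including itself); $\sum_{j\to i}$ denotes summation over $\{j:(j,i)\in\mathcal E\}$. Given i.i.d. Poisson measures $(\pi^i(ds\,dz))_{i\in\mathbb Z^d}$ on $[0,\infty)\times[0,\infty)$ with intensity measure $ds\,dz$ (with respect to a filtration $(\mathcal F_t)_{t\ge0}$), the nearest neighbour linear Hawkes process with parameters $\varphi$ and $(\mu_i)$ is the pathwise unique family $(Z^i_t)_{i\in\mathbb Z^d,t\ge0}$ of càdlàg adapted processes such that $\sum_{i\in\mathbb Z^d}2^{-|i|}\mathbb E[Z^i_t]<\infty$ for all $t\ge0$ and a.s., for all $i\in\mathbb Z^d$, $t\ge0$, $$Z^i_t=\int_0^t\int_0^\infty\mathbf 1_{\{z\le\mu_i+(2d+1)^{-1}\sum_{j\to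 i}\int_0^{s-}\varphi(s-u)\,dZ^j_u\}}\,\pi^i(ds\,dz).$$ The stochastic matrix $A$ is defined by $A(i,j)=(2d+1)^{-1}\mathbf 1_{\{(i,j)\in\mathcal E\}}$, $i,j\in\mathbb Z^d$, and $Q_\Lambda(i,j)=\sum_{n\ge0}\Lambda^nA^n(i,j)$ (with $A^0=I$ the identity matrix, the $n=0$ term being $I(i,j)$). *)

(* Defs.v *)
From HB Require Import structures.
From mathcomp Require Import all_boot all_order all_algebra.
From mathcomp Require Import all_classical all_reals all_analysis measurable_realfun.

Set Implicit Arguments.
Unset Strict Implicit.
Unset Printing Implicit Defensive.
Import Order.TTheory GRing.Theory Num.Theory.
Import numFieldNormedType.Exports.

Local Open Scope classical_set_scope.
Local Open Scope ring_scope.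
Local Open Scope ereal_scope.

Notation Zlattice d := 'rV[int]_d.

Definition enorm (R : realType) d (i : Zlattice d) : R :=
  Num.sqrt (\sum_(k < d) ((i 0 k)%:~R ^+ 2))%R.

Definition edges (R : realType) d : set (Zlattice d * Zlattice d) :=
  [set p | enorm R (p.1 - p.2)%R = 0%R \/ enorm R (p.1 - p.2)%R = 1%R].
Arguments edges R d : clear implicits.

Definition Amat (R : realType) d (i j : Zlattice d) : \bar R :=
  ((2 * d + 1)%:R^-1 * \1_(edges R d) (i, j))%:E.

Definition Imat (R : realType) d (i j : Zlattice d) : \bar R :=
  ((i == j)%:R)%:E.

(* [\esum] is meaningful here because all the entries are nonnegative. *)
Fixpoint Apow (R : realType) d (n : nat) (i j : Zlattice d) : \bar R :=
  if n is m.+1 then \esum_(k in setT) (Amat R i k * Apow R m k j)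
  else Imat R i j.

Definition Qmat (R : realType) d (Lam : R) (i j : Zlattice d) : \bar R :=
  \sum_(0 <= n <oo) ((Lam ^+ n)%:E * Apow R n i j).

(* The Borel plane. [measurableTypeR R] is [R] with its Borel sigma-algebra, in
   the guise over which [lebesgue_measure] is defined. *)
Notation plane R := (measurableTypeR R * measurableTypeR R)%type.

Section stochastic.
Context (disp : measure_display) (Omega : measurableType disp) (R : realType).
Variable P : probability Omega R.

Definition independent2 (G H : set_system Omega) : Prop :=
  forall A B, G A -> H B -> P (A `&` B) = P A * P B.

Definition mutually_independent (I : eqType) (G : I -> set_system Omega) : Prop :=
  forall (s : seq I) (E : I -> set Omega), uniq s ->
    (forall i, i \in s -> G i (E i)) ->
    P (\bigcap_(i in [set` s]) E i) = \prod_(i <- s) P (E i).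

(* Time is the half-line [0, +oo[; values at negative times are irrelevant,
   here and for all processes below. *)
Record filtration (F : R -> set_system Omega) : Prop := Filtration {
  filtration_sigma : forall t : R, (0 <= t)%R -> sigma_algebra setT (F t) ;
  filtration_sub : forall t : R, (0 <= t)%R -> F t `<=` measurable ;
  filtration_mono : forall s t : R, (0 <= s)%R -> (s <= t)%R -> F s `<=` F t }.

Definition adapted (F : R -> set_system Omega) (X : R -> Omega -> R) : Prop :=
  forall t : R, (0 <= t)%R -> forall B : set R, measurable B -> F t (X t @^-1` B).

Definition cadlag (x : R -> R) : Prop :=
  (forall t : R, (0 <= t)%R -> x s @[s --> t^'+] --> x t) /\
  (forall t : R, (0 < t)%R -> cvg (x s @[s --> t^'-])).

Section random_measures.
Context (disp' : measure_display) (E : measurableType disp').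

(* The sigma-algebra generated by the variables [N k (B)], for all indices [k]
   and all measurable [B] included in [D]. *)
Definition sigma_random_measures (K : Type)
    (N : K -> R.-ker Omega ~> E) (D : set E) : set_system Omega :=
  <<s [set A | exists k (B : set E) (C : set (\bar R)),
         [/\ measurable B, B `<=` D, measurable C &
             A = [set w | C (N k w B)]] ] >>.

(* Only sets of finite intensity are mentioned: when [lam] is sigma-finite,
   [N w B = +oo] almost surely as soon as [lam B = +oo].
   The second argument of [poisson_prob] is a dummy. [poisson_prob] is used
   rather than [poisson_pmf] as the former is the Dirac mass at 0 for rate 0,
   whereas the latter is constantly 1. *)
Record poisson_measure (lam : {measure set E -> \bar R})
    (N : R.-ker Omega ~> E) : Prop := PoissonMeasure {
  poisson_measure_law : forall B : set E, measurable B -> lam B < +oo ->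
    forall k : nat,
      P [set w | N w B = k%:R%:E] = poisson_prob (fine (lam B)) 0%N [set k] ;
  poisson_measure_indep : forall B : nat -> set E,
    (forall n, measurable (B n)) -> trivIset setT B ->
    mutually_independent
      (fun n => preimage_set_system setT (fun w => N w (B n)) measurable) }.

End random_measures.

Definition quadrant : set (plane R) := (`[0%R, +oo[ `*` `[0%R, +oo[)%classic.

Lemma measurable_quadrant : measurable quadrant.
Proof. exact: measurableX. Qed.

Definition intensity_measure : {measure set (plane R) -> \bar R} :=
  mrestr (lebesgue_measure \x lebesgue_measure) measurable_quadrant.

Record iid_poisson_measures (V : eqType) (F : R -> set_system Omega)
    (pi : V -> R.-ker Omega ~> plane R) : Prop := IidPoissonMeasures {
  iid_poisson : forall i, poisson_measure intensity_measure (pi i) ;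
  iid_indep : mutually_independent
    (fun i => sigma_random_measures (fun _ : unit => pi i) setT) ;
  iid_adapted : forall t : R, (0 <= t)%R ->
    sigma_random_measures pi (`[0%R, t] `*` `[0%R, +oo[) `<=` F t ;
  iid_future : forall t : R, (0 <= t)%R ->
    independent2 (F t)
      (sigma_random_measures pi (`]t, +oo[ `*` `[0%R, +oo[)) }.

(* [f j] is a nondecreasing right-continuous function on the whole line
   providing the measure [dZ^j]; on ]0, s[ that measure only depends on the
   values of [f j] on [0, s[. An atom of [dZ^j] at time 0 is ignored, since the
   equation forces [Z^j_0 = 0] almost surely. *)
Definition hawkes_intensity d (phi : R -> R) (mu : Zlattice d -> R)
    (f : Zlattice d -> cumulative R R) (i : Zlattice d) (s : R) : \bar R :=
  (mu i)%:E + ((2 * d + 1)%:R^-1)%:E *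
    \esum_(j in [set j | edges R d (j, i)])
      \int[lebesgue_stieltjes_measure (f j)]_(u in `]0%R, s[) (phi (s - u)%R)%:E.

(* The integrals against [dZ^j] make sense only for nondecreasing paths, whence
   the requirement that the paths coincide on [0, +oo[ with some [f j]. *)
Definition hawkes_equation d (phi : R -> R) (mu : Zlattice d -> R)
    (pi : Zlattice d -> {measure set (plane R) -> \bar R})
    (z : Zlattice d -> R -> R) : Prop :=
  exists f : Zlattice d -> cumulative R R,
    (forall j (t : R), (0 <= t)%R -> f j t = z j t) /\
    (forall i (t : R), (0 <= t)%R ->
      (z i t)%:E = \int[pi i]_(p in `[0%R, t] `*` `[0%R, +oo[)
        (\1_[set q : R * R | (q.2%:E <= hawkes_intensity phi mu f i q.1)%E] p)%:E).

Record nn_linear_hawkes d (F : R -> set_system Omega)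
    (pi : Zlattice d -> R.-ker Omega ~> plane R)
    (phi : R -> R) (mu : Zlattice d -> R)
    (Z : Zlattice d -> R -> Omega -> R) : Prop := NnLinearHawkes {
  hawkes_cadlag : forall i w, cadlag (fun t => Z i t w) ;
  hawkes_adapted : forall i, adapted F (Z i) ;
  hawkes_moment : forall t : R, (0 <= t)%R ->
    \esum_(i in setT) ((2 `^ (- enorm R i))%:E * 'E_P[Z i t]) < +oo ;
  hawkes_eq : {ae P, forall w,
    hawkes_equation phi mu (fun i => pi i w) (fun i t => Z i t w)} }.

(* The limit is allowed to be an extended real for convenience; an infinite
   limit never satisfies this property. *)
Definition cvg_in_probability (X : R -> Omega -> R) (l : \bar R) : Prop :=
  forall eps : R, (0 < eps)%R ->
    P [set w | eps%:E < `|(X t w)%:E - l|] @[t --> +oo%R] --> 0.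

End stochastic.

(* Main.v *)
(* The process Z^i counts the points of pi^i in the predictable region under its
   intensity. A Poisson measure N satisfies E N(B) = E|B| and E (N(B) - |B|)^2 = E|B|
   for predictable regions B of bounded size, so that Z^i_t is at L^1-distance at most
   eps * E Z^i_t + 1 / (4 * eps) from its compensator
   C^i_t = mu_i t + sum_j A(i,j) int_0^t phi(r) Z^j_(t - r) dr, for all eps > 0.
   Taking expectations gives a renewal inequality, whence E Z^i_t <= M t / (1 - Lam)
   where M bounds mu. Now q = Q_Lam mu solves q = mu + Lam A q, so that the linear
   growth q_i t satisfies the equation of the compensator up to a sublinear error.
   Therefore, if E|Z^i_t - q_i t| <= k t + D for all i and t, then the same holds with
   k replaced by Lam k + eps and another D. Iterating, E|Z^i_t - q_i t| = o(t), and
   Markov's inequality concludes. *)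

Require Import Defs.
From mathcomp Require Import all_boot all_order all_algebra.
From mathcomp Require Import all_classical all_reals all_analysis measurable_realfun.
From HB Require Import structures.
From mathcomp Require Import zify ring lra.
Import Order.TTheory GRing.Theory Num.Theory.
Import numFieldNormedType.Exports.
Local Open Scope classical_set_scope.
Local Open Scope ring_scope.
Local Open Scope ereal_scope.

Set Implicit Arguments.
Unset Strict Implicit.
Unset Printing Implicit Defensive.

(** * Independence and Poisson moments *)

Import HBNNSimple.

(** The moment condition provides first moments only, with weights that allow growth in [i], whereas
    the isometry is quadratic. The isometry is therefore proved for marks below a bounded height,
    where all moments are finite. AM-GM makes the resulting L1 bound linear in the expected
    compensator, so that it passes to unbounded heights by Fatou's lemma without any second moment
    of the process. The identities for predictable sets are checked on generating rectangles and
    extended by uniqueness of finite measures; this is why they are written without subtraction,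
    with nonnegative terms on both sides. A second obstacle is that the equation holds only almost
    surely, for paths chosen outcome by outcome. On a null set these are replaced by zero; the new
    paths are adapted to the completed filtration only, which is still independent of the future of
    the Poisson measures. Finally the compensator may be infinite a priori, so that it is compared
    with [q i * t] through pairs of one-sided inequalities in the extended reals. *)

Section kernels.
Context d d' (X : measurableType d) (Y : measurableType d') (R : realType).
Variable k : X -> {measure set Y -> \bar R}.
Hypothesis mk : forall U, measurable U -> measurable_fun [set: X] (k ^~ U).
Hypothesis kfin : forall x, k x [set: Y] < +oo.

(** The masses are finite at each point, with no bound uniform in [x]: the Stieltjes measures of
    random paths satisfy no more than that. *)
Lemma measurable_fun_xsection_ptfin_kernel (A : set (X * Y)) :
  measurable A -> measurable_fun [set: X] (fun x => k x (xsection A x)).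
Proof.
move=> mA.
pose k' : R.-ker X ~> Y := HB.pack k (isKernel.Build _ _ X Y R k mk).
have kub x : exists M, forall U, measurable U ->
    mrestr (k' x) (@measurableT _ Y) U < M%:E.
  exists (fine (k x setT) + 1)%R => U mU; rewrite /mrestr setIT.
  rewrite (@le_lt_trans _ _ (k x setT))//.
    by rewrite le_measure// inE//; exact: measurableT.
  have kx : k x setT \is a fin_num by rewrite ge0_fin_numE.
  by rewrite -[ltLHS](fineK kx) lte_fin ltrDl.
have [_] := @measurable_prod_subset_xsection_kernel _ _ _ _ _ k' _ (@measurableT _ Y) kub _ mA.
by apply: eq_measurable_fun => x _; rewrite /mrestr /= setIT.
Qed.

Lemma measurable_fun_integral_ptfin_kernel (f : X * Y -> \bar R) :
  (forall z, 0 <= f z) -> measurable_fun setT f ->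
  measurable_fun setT (fun x => \int[k x]_y f (x, y)).
Proof.
move=> f0 mf; pose f_ := nnsfun_approx measurableT mf.
apply: (measurable_fun_xsection_integral f k f_).
- by move=> a b ab; exact/nd_nnsfun_approx.
- by move=> z; exact/cvg_nnsfun_approx.
- move=> n r; apply: measurable_fun_xsection_ptfin_kernel.
  exact: measurable_funPTI.
Qed.

(** Turns an expectation depending on a random set into a measure of that set, so that identities
    need only be checked on a pi-system. In the isometry the weight [g] carries the mass of the
    second, frozen set. *)
Lemma exists_weighted_kernel_measure (mu : {measure set X -> \bar R})
    (g : X -> R) :
  (forall x, 0 <= g x)%R -> measurable_fun setT g ->
  exists m : {measure set (X * Y) -> \bar R}, forall A,
    m A = \int[mu]_x ((g x)%:E * k x (xsection A x)).
Proof.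
move=> g0 mg.
pose m0 (A : set (X * Y)) := \int[mu]_x ((g x)%:E * k x (xsection A x)).
have g0' x : 0 <= (g x)%:E by rewrite lee_fin.
have m0_0 : m0 set0 = 0.
  by apply: integral0_eq => x _; rewrite xsection0 measure0 mule0.
have m0_ge0 A : 0 <= m0 A by apply: integral_ge0 => x _; exact: mule_ge0.
have m0_add : semi_sigma_additive m0.
  move=> F mF tF mUF.
  have mk_F i : measurable_fun setT (fun x => (g x)%:E * k x (xsection (F i) x)).
    apply: emeasurable_funM; first exact/measurable_EFinP.
    exact: measurable_fun_xsection_ptfin_kernel.
  apply: cvg_toP.
    apply: ereal_nondecreasing_is_cvgn => a b ab.
    by apply: lee_sum_nneg_natr => // n _ _; exact: m0_ge0.
  rewrite /m0 -integral_nneseries//; last by move=> n x _; exact: mule_ge0.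
  apply: eq_integral => x _; rewrite xsection_bigcup measure_semi_bigcup //.
  - by rewrite nneseriesZl.
  - by move=> i; exact: measurable_xsection.
  - exact: trivIset_xsection.
  - by apply: bigcup_measurable => i _; exact: measurable_xsection.
pose m := HB.pack_for {measure set (X * Y) -> \bar R} m0
  (isMeasure.Build _ _ _ m0 m0_0 m0_ge0 m0_add).
by exists m.
Qed.

End kernels.

Section independence.
Context d (T : measurableType d) (R : realType) (P : probability T R).

(** The joint law is the product of the two laws, by uniqueness of the product measure; Tonelli's
    theorem then splits the integral. *)
Lemma ge0_integral_mul_indep (X Y : T -> \bar R) :
  (forall w, 0 <= X w) -> (forall w, 0 <= Y w) ->
  measurable_fun setT X -> measurable_fun setT Y ->
  (forall C D, measurable C -> measurable D ->
    P (X @^-1` C `&` Y @^-1` D) = P (X @^-1` C) * P (Y @^-1` D)) ->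
  \int[P]_w (X w * Y w) = \int[P]_w X w * \int[P]_w Y w.
Proof.
move=> X0 Y0 mX mY indep.
pose X' : {mfun T >-> \bar R} := HB.pack X (isMeasurableFun.Build _ _ _ _ X mX).
pose Y' : {mfun T >-> \bar R} := HB.pack Y (isMeasurableFun.Build _ _ _ _ Y mY).
have mXY : measurable_fun setT (fun w => (X w, Y w)).
  exact: measurable_fun_pair.
pose XY : {mfun T >-> (\bar R * \bar R)%type} :=
  HB.pack (fun w => (X w, Y w)) (isMeasurableFun.Build _ _ _ _ _ mXY).
(* Tonelli's theorem is applied on all pairs of extended reals, hence the truncation at 0, which
   changes nothing on the values of [X] and [Y]. *)
pose f (z : \bar R * \bar R) := maxe z.1 0 * maxe z.2 0.
have mmax : measurable_fun setT (fun x : \bar R => maxe x 0).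
  exact: measurable_maxe.
have mf : measurable_fun setT f.
  by apply: emeasurable_funM; apply: (measurableT_comp mmax);
    [exact: measurable_fst|exact: measurable_snd].
have max0 (x : \bar R) : 0 <= maxe x 0 by rewrite le_max lexx orbT.
have f0 z : 0 <= f z by apply: mule_ge0.
have -> : \int[P]_w (X w * Y w) = \int[P]_w (f \o XY) w.
  by apply: eq_integral => w _; rewrite /f /= !max_l.
rewrite -ge0_integral_distribution//.
rewrite (@eq_measure_integral _ _ _ _ (distribution P X' \x distribution P Y')).
  rewrite fubini_tonelli1//.
  have -> : \int[P]_w X w = \int[distribution P X']_x maxe x 0.
    rewrite ge0_integral_distribution//.
    by apply: eq_integral => w _; rewrite /= max_l.
  have -> : \int[P]_w Y w = \int[distribution P Y']_x maxe x 0.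
    rewrite ge0_integral_distribution//.
    by apply: eq_integral => w _; rewrite /= max_l.
  rewrite -ge0_integralZr//; last exact: integral_ge0.
  by apply: eq_integral => x _; rewrite /fubini_F /f /= ge0_integralZl//.
move=> A mA _; apply/esym/product_measure_unique => // C D mC mD.
Qed.

(** Since the masses [p n] sum to 1, the event that [X] takes no natural value, for instance that it
    is infinite, is negligible. *)
Lemma ge0_integral_law_nat (X : T -> \bar R) (g : \bar R -> \bar R)
    (p : nat -> \bar R) :
  measurable_fun setT X -> measurable_fun setT g -> (forall x, 0 <= g x) ->
  (forall n, P [set w | X w = n%:R%:E] = p n) -> \sum_(n <oo) p n = 1 ->
  \int[P]_w g (X w) = \sum_(n <oo) g n%:R%:E * p n.
Proof.
move=> mX mg g0 Xp p1.
pose F (n : nat) := [set w | X w = n%:R%:E].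
have mF n : measurable (F n).
  rewrite -[X in measurable X]setTI.
  by have /(_ [set n%:R%:E]) := mX measurableT; apply; exact: emeasurable_set1.
have tF : trivIset setT F.
  move=> i j _ _ [w []]; rewrite /F /= => -> [] /eqP.
  by rewrite eqr_nat => /eqP.
have mU : measurable (\bigcup_n F n) by exact: bigcup_measurable.
have mgX : measurable_fun setT (g \o X) by exact: measurableT_comp.
have PU : P (~` \bigcup_n F n) = 0.
  rewrite probability_setC// measure_semi_bigcup// (_ : \sum_(_ <oo) _ = 1) ?subee//.
  by rewrite -p1; apply: eq_eseriesr => i _; exact: Xp.
rewrite -(setUv (\bigcup_n F n)) ge0_integral_setU//; last 3 first.
- exact: measurableC.
- by rewrite setUv.
- exact/disj_setPCl.
rewrite [X in _ + X](_ : _ = 0) ?adde0; last first.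
  apply: null_set_integral => //; first exact: measurableC.
  exact: measurable_funTS.
rewrite ge0_integral_bigcup//; last exact: measurable_funTS.
apply: eq_eseriesr => n _.
rewrite (eq_integral (cst (g n%:R%:E))); last first.
  by move=> w; rewrite inE => ->.
by rewrite integral_cst// -Xp.
Qed.

End independence.

Section poisson_moments.
Context d (T : measurableType d) (R : realType) (P : probability T R).
Variables (X : T -> \bar R) (l : R).
Hypotheses (mX : measurable_fun setT X) (l0 : (0 <= l)%R).
Hypothesis Xlaw : forall n : nat,
  P [set w | X w = n%:R%:E] = poisson_prob l 0%N [set n].

Let p (n : nat) := poisson_prob l 0%N [set n] : \bar R.

Let p0 n : 0 <= p n. Proof. exact: measure_ge0. Qed.

Lemma poisson_prob_sum1 : \sum_(n <oo) p n = 1.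
Proof.
rewrite -(@probability_setT _ _ _ (poisson_prob l 0%N)).
have -> : [set: nat] = \bigcup_n [set n].
  by apply/seteqP; split => // n _; exists n.
rewrite measure_semi_bigcup//=.
by move=> i j _ _ [x [-> ->]].
Qed.

Lemma poisson_prob_recurrence n : n.+1%:R%:E * p n.+1 = l%:E * p n.
Proof.
rewrite /p /poisson_prob; case: ifPn => [l_gt0|]; last first.
  rewrite -leNgt => l_le0; have -> : l = 0%R by apply/eqP; rewrite eq_le l0 l_le0.
  by rewrite mul0e diracE /= memNset ?mule0.
rewrite !esum_set1 ?lee_fin ?poisson_pmf_ge0//.
rewrite -!EFinM; congr (_%:E); rewrite /poisson_pmf l_gt0 exprS factS natrM invfM.
have n0 : n.+1%:R != 0%R :> R by rewrite pnatr_eq0.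
have fn0 : n`!%:R != 0%R :> R by rewrite pnatr_eq0 -lt0n fact_gt0.
by field; rewrite fn0 /= addrC natr1.
Qed.

(** The Stein-Chen identity: the mean of [X * h (X - 1)] is [l] times the mean of [h X]. Taking
    [h = 1] gives the mean and [h n = n + 1] the second moment. The value of [n.-1] at 0 is
    immaterial, being multiplied by 0. *)
Lemma poisson_series_shift (h : nat -> \bar R) : (forall n, 0 <= h n) ->
  \sum_(n <oo) n%:R%:E * h n.-1 * p n = l%:E * \sum_(n <oo) h n * p n.
Proof.
move=> h0.
rewrite nneseries_recl//; last by move=> n _; rewrite !mule_ge0.
rewrite !mul0e add0e -nneseriesZl//; last by move=> n _; exact: mule_ge0.
rewrite (_ : 1%N = (0 + 1)%N)// -nneseries_addn//; last by move=> n; rewrite !mule_ge0.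
apply: eq_eseriesr => n _; rewrite !addn1 /= muleAC poisson_prob_recurrence.
by rewrite muleAC muleA.
Qed.

Hypothesis X0 : forall w, 0 <= X w.

Lemma poisson_expectation : \int[P]_w X w = l%:E.
Proof.
rewrite (eq_integral (fun w => `|X w|)); last by move=> w _; rewrite gee0_abs.
rewrite (ge0_integral_law_nat mX _ _ Xlaw poisson_prob_sum1)//.
have := @poisson_series_shift (cst 1) (fun=> lee01).
rewrite (eq_eseriesr (g := fun n => `|n%:R%:E| * p n)); last first.
  by move=> n _; rewrite mule1 gee0_abs.
by move=> ->; under eq_eseriesr do rewrite mul1e; rewrite poisson_prob_sum1 mule1.
Qed.

Lemma poisson_second_moment : \int[P]_w (X w * X w) = (l ^+ 2 + l)%:E.
Proof.
rewrite (eq_integral (fun w => `|X w| * `|X w|)); last first.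
  by move=> w _; rewrite gee0_abs.
rewrite (ge0_integral_law_nat (g := fun x => `|x| * `|x|) mX _ _ Xlaw
  poisson_prob_sum1)//; last exact: emeasurable_funM.
have := @poisson_series_shift (fun n => n.+1%:R%:E) (fun n => ler0n R n.+1).
rewrite (eq_eseriesr (g := fun n => `|n%:R%:E| * `|n%:R%:E| * p n)); last first.
  by case=> [|n] _ /=; [rewrite normr0 !mul0e|rewrite ger0_norm].
move=> ->.
rewrite (eq_eseriesr (g := fun n => n%:R%:E * 1 * p n + 1 * p n)); last first.
  by move=> n _; rewrite -ge0_muleDl// mule1 -EFinD natr1.
rewrite nneseriesD//; last 2 first.
- by move=> n _ _; rewrite !mule_ge0.
- by move=> n _ _; rewrite !mule_ge0.
rewrite (@poisson_series_shift (cst 1))//.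
under eq_eseriesr do rewrite mul1e.
by rewrite poisson_prob_sum1 mule1 -EFinD -EFinM mulrDr mulr1 expr2.
Qed.

End poisson_moments.

Section translation.
Context (R : realType).

Lemma lebesgue_measure_translation (a : R) (A : set R) : measurable A ->
  @lebesgue_measure R ((fun x => x + a)%R @^-1` A) = lebesgue_measure A.
Proof.
move=> mA.
have mf : measurable_fun setT (fun x : measurableTypeR R => x + a : measurableTypeR R)%R.
  exact: measurable_funD.
pose f : {mfun measurableTypeR R >-> measurableTypeR R} :=
  HB.pack (fun x : R => x + a)%R (isMeasurableFun.Build _ _ _ _ _ mf).
apply/esym; rewrite -[RHS]/(pushforward lebesgue_measure f A).
apply: lebesgue_measure_unique => // X /ocitvP[->|[[x y] /= xy ->]]; first by rewrite !measure0.
rewrite /pushforward (_ : f @^-1` _ = `](x - a)%R, (y - a)%R]%classic).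
  by rewrite !lebesgue_measure_itv /= !lte_fin ltrD2r xy -EFinB; congr EFin; ring.
by apply/seteqP; split => z /=; rewrite !in_itv /= ltrBlDr lerBrDr.
Qed.

Lemma ge0_integral_lebesgue_translation (a : R) (g : R -> \bar R) :
  measurable_fun setT g -> (forall x, 0 <= g x) ->
  \int[lebesgue_measure]_x g (x + a)%R = \int[lebesgue_measure]_x g x.
Proof.
move=> mg g0.
have mf : measurable_fun setT (fun x : measurableTypeR R => x + a : measurableTypeR R)%R.
  exact: measurable_funD.
pose f : {mfun measurableTypeR R >-> measurableTypeR R} :=
  HB.pack (fun x : R => x + a)%R (isMeasurableFun.Build _ _ _ _ _ mf).
have := @ge0_integral_pushforward _ _ _ _ R f mf lebesgue_measure setT g
  measurableT mg (fun y _ => g0 y).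
rewrite preimage_setT => <-.
apply: eq_measure_integral => A mA _; exact: lebesgue_measure_translation.
Qed.

End translation.

(** * Poisson measures on predictable sets *)

Section predictable.
Context (disp : measure_display) (Omega : measurableType disp) (R : realType).

(** The rectangles open strictly after the time [s] at which the event [A] is known. They all miss
    the times up to 0, so [setT] is added for the pi-system to exhaust the space, as uniqueness of
    measures requires. *)
Definition predictable_rect (F : R -> set_system Omega) :
    set_system (Omega * plane R) :=
  [set B | B = setT \/ exists A s c, [/\ (0 <= s)%R, F s A &
    B = A `*` (`]s, +oo[ `*` `]-oo, c])] ].

Variables (P : probability Omega R) (F : R -> set_system Omega).
Hypothesis F_filtration : filtration F.
Variable pi : R.-ker Omega ~> plane R.
Hypothesis pi_poisson : poisson_measure P (@intensity_measure R) pi.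
Hypothesis pi_adapted : forall t : R, (0 <= t)%R ->
  sigma_random_measures (fun _ : unit => pi) (`[0%R, t] `*` `[0%R, +oo[) `<=` F t.
Hypothesis pi_future : forall t : R, (0 <= t)%R ->
  independent2 P (F t)
    (sigma_random_measures (fun _ : unit => pi) (`]t, +oo[ `*` `[0%R, +oo[)).

Lemma filtration_setI s A B : (0 <= s)%R -> F s A -> F s B -> F s (A `&` B).
Proof.
move=> s0 FA FB; have [F0 FC FU] := filtration_sigma F_filtration s0.
have FC' X : F s X -> F s (~` X) by move=> ?; rewrite -setTD; exact: FC.
rewrite -[A `&` B]setCK setCI; apply: (FC').
rewrite (_ : _ `|` _ = \bigcup_n (if n is 0%N then ~` A else ~` B)).
  by apply: FU => -[|n]; exact: FC'.
apply/seteqP; split => w; first by case=> ?; [exists 0%N|exists 1%N].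
by move=> [[|n] _ ?]; [left|right].
Qed.

Lemma predictable_rect_setI : setI_closed (predictable_rect F).
Proof.
move=> B C [->|[A [s [c [s0 FA ->]]]]] [->|[A' [s' [c' [s0' FA' ->]]]]].
- by rewrite setIT; left.
- by rewrite setTI; right; exists A', s', c'.
- by rewrite setIT; right; exists A, s, c.
right; exists (A `&` A'), (Num.max s s'), (Num.min c c').
have m0 : (0 <= Num.max s s')%R by rewrite le_max s0.
split => //.
  apply: filtration_setI => //.
  - by apply: (filtration_mono F_filtration s0 _ FA); rewrite le_max lexx.
  - by apply: (filtration_mono F_filtration s0' _ FA'); rewrite le_max lexx orbT.
apply/seteqP; split => -[w [u z]] /=; rewrite !in_itv /= !andbT gt_max le_min.
  by move=> [[? [? ?]] [? [? ?]]]; split => //; split; apply/andP.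
by move=> [[? ?] [/andP[? ?] /andP[? ?]]].
Qed.

Lemma predictable_rect_measurable : predictable_rect F `<=` measurable.
Proof.
move=> _ [->//|[A [s [c [s0 FA ->]]]]].
apply: measurableX; first exact: (filtration_sub F_filtration s0).
by apply: measurableX; exact: measurable_itv.
Qed.

Let random_measure_gen (D : set (plane R)) : set_system Omega :=
  [set A | exists (k : unit) (B : set (plane R)) (C : set (\bar R)),
         [/\ measurable B, B `<=` D, measurable C &
             A = [set w | C (pi w B)]] ].

Lemma intensity_sub (E : set (plane R)) : E `<=` @quadrant R ->
  @intensity_measure R E = (lebesgue_measure \x lebesgue_measure)%E E.
Proof. by move=> EQ; rewrite /intensity_measure /= /mrestr setIidl. Qed.

Lemma sigma_random_measure_meas (D E : set (plane R)) :
  measurable E -> E `<=` D ->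
  measurable_fun [set: g_sigma_algebraType (random_measure_gen D)] (fun w => pi w E).
Proof.
move=> mE ED _ C mC; rewrite setTI; apply: sub_sigma_algebra.
by exists tt, E, C.
Qed.

Lemma past_future (s : R) (X Y : Omega -> \bar R) : (0 <= s)%R ->
  (forall w, 0 <= X w) -> (forall w, 0 <= Y w) ->
  (forall C, measurable C -> F s (X @^-1` C)) ->
  measurable_fun [set: g_sigma_algebraType (random_measure_gen (`]s, +oo[ `*` `[0%R, +oo[))] Y ->
  \int[P]_w (X w * Y w) = \int[P]_w X w * \int[P]_w Y w.
Proof.
move=> s0 X0 Y0 mX mY.
have mXP : measurable_fun setT X.
  move=> _ C mC; rewrite setTI; exact: (filtration_sub F_filtration s0 (mX _ mC)).
have sub : sigma_random_measures (fun _ : unit => pi) (`]s, +oo[ `*` `[0%R, +oo[)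
    `<=` measurable.
  apply: smallest_sub; first exact: sigma_algebra_measurable.
  move=> _ [_ [B [C [mB _ mC ->]]]].
  by have := measurable_kernel pi B mB measurableT C mC; rewrite setTI.
apply: ge0_integral_mul_indep => //.
  move=> _ C mC; apply: sub; exact: mY.
move=> C D mC mD; apply: (pi_future s0); first exact: mX.
by have := mY measurableT D mD; rewrite setTI.
Qed.

Variables T K : R.

(** Left-open in time, so that inside the window [setT] coincides with a rectangle starting at time
    0. *)
Definition window : set (plane R) := `]0%R, T] `*` `[0%R, K].

Lemma measurable_window : measurable window.
Proof. exact: measurableX. Qed.

Definition window_lebesgue : {measure set (plane R) -> \bar R} :=
  mrestr (lebesgue_measure \x lebesgue_measure)%E measurable_window.

(** The mass of the window is finite almost surely only; the zero measure replaces it on the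
    exceptional event, so that the kernel is finite at every outcome. *)
Definition window_random_measure (w : Omega) : {measure set (plane R) -> \bar R} :=
  if pi w window < +oo
  then (mrestr (pi w) measurable_window : {measure set (plane R) -> \bar R})
  else mzero.

Local Notation L := window_lebesgue.
Local Notation N := window_random_measure.

Lemma sub_window_quadrant : window `<=` @quadrant R.
Proof.
move=> [u z] [] /=; rewrite !in_itv /= => /andP[/ltW u0 _] /andP[z0 _].
by split => /=; rewrite in_itv /= andbT.
Qed.

Lemma window_lebesgue_lty E : measurable E -> L E < +oo.
Proof.
move=> mE; rewrite (@le_lt_trans _ _ (L setT))//.
  by rewrite le_measure ?inE//; exact: measurableT.
rewrite /L /= /mrestr setTI [ltLHS]product_measure1E//; try exact: measurable_itv.
have lfin (i : interval R) (a b : R) : i = `[a, b] \/ i = `]a, b] ->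
    @lebesgue_measure R [set` i] \is a fin_num.
  by move=> [] ->; rewrite lebesgue_measure_itv /=; case: ifP.
rewrite lte_mul_pinfty//; first by apply: lfin; right.
by rewrite -ge0_fin_numE//; apply: lfin; left.
Qed.

Lemma window_lebesgue_fin E : measurable E -> (fine (L E))%:E = L E.
Proof. by move=> mE; rewrite fineK// ge0_fin_numE// window_lebesgue_lty. Qed.

Lemma window_intensity E : intensity_measure R (E `&` window) = L E.
Proof.
rewrite intensity_sub//.
exact: subset_trans (@subIsetr _ _ _) sub_window_quadrant.
Qed.

Lemma measurable_pi E : measurable E -> measurable_fun setT (fun w => pi w E).
Proof. exact: measurable_kernel. Qed.

Lemma pi_window_law E : measurable E -> forall n : nat,
  P [set w | pi w (E `&` window) = n%:R%:E] =
  poisson_prob (fine (L E)) 0%N [set n].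
Proof.
move=> mE n.
have mEw : measurable (E `&` window) by apply: measurableI => //; exact: measurable_window.
have := poisson_measure_law pi_poisson mEw.
by rewrite window_intensity; apply; exact: window_lebesgue_lty.
Qed.

Lemma pi_window_mean E : measurable E -> \int[P]_w pi w (E `&` window) = L E.
Proof.
move=> mE; rewrite -[RHS]window_lebesgue_fin//.
apply: poisson_expectation => //.
- by apply: measurable_pi; apply: measurableI => //; exact: measurable_window.
- exact: pi_window_law.
Qed.

Lemma pi_window_second_moment E : measurable E ->
  \int[P]_w (pi w (E `&` window) * pi w (E `&` window)) = L E * L E + L E.
Proof.
move=> mE; rewrite -[in RHS]window_lebesgue_fin//.
rewrite (@poisson_second_moment _ _ _ _ _ (fine (L E)))//.
- by apply: measurable_pi; apply: measurableI => //; exact: measurable_window.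
- exact: pi_window_law.
Qed.

Lemma pi_disjoint_product E E' : measurable E -> measurable E' ->
  E `&` E' = set0 ->
  \int[P]_w (pi w (E `&` window) * pi w (E' `&` window)) = L E * L E'.
Proof.
move=> mE mE' EE'.
rewrite -(pi_window_mean mE) -(pi_window_mean mE').
have mEw X : measurable X -> measurable (X `&` window).
  by move=> mX; apply: measurableI => //; exact: measurable_window.
apply: ge0_integral_mul_indep => //.
- by apply: measurable_pi; exact: mEw.
- by apply: measurable_pi; exact: mEw.
move=> C D mC mD.
(* Independence is stated for sequences of disjoint sets: the pair is completed by empty sets. *)
pose B n := if n is 0%N then E `&` window else if n is 1%N then E' `&` window else set0.
have mB n : measurable (B n) by case: n => [|[|n]]; [exact: mEw|exact: mEw|exact: measurable0].
have tB : trivIset setT B.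
  apply/trivIsetP => -[|[|i]] [|[|j]] _ _ //= _; rewrite ?set0I ?setI0//.
    by rewrite setIACA EE' set0I.
  by rewrite setIACA setIC [E' `&` E]setIC EE' setI0.
have := poisson_measure_indep pi_poisson mB tB.
pose A n := if n is 0%N then (fun w => pi w (E `&` window)) @^-1` C
  else (fun w => pi w (E' `&` window)) @^-1` D.
move=> /(_ [:: 0%N; 1%N] A erefl).
rewrite !big_cons big_nil mule1 /A /= => <-.
  congr (P _); apply/seteqP; split => w /=.
    by move=> [Cw Dw] i /=; rewrite !inE => /orP[|] /eqP ->.
  by move=> H; split; [exact: (H 0%N)|exact: (H 1%N)].
move=> i; rewrite !inE => /orP[|] /eqP ->; rewrite /preimage_set_system /=.
  by exists C => //; rewrite setTI.
by exists D => //; rewrite setTI.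
Qed.

(** Independence concerns disjoint sets, so both sets are cut along their intersection [I]. The
    second moment of the mass of [I] is responsible for the extra term; the other products
    factor. *)
Lemma pi_product E E' : measurable E -> measurable E' ->
  \int[P]_w (pi w (E `&` window) * pi w (E' `&` window)) =
  L (E `&` E') + L E * L E'.
Proof.
move=> mE mE'.
have mEw X : measurable X -> measurable (X `&` window).
  by move=> mX; apply: measurableI => //; exact: measurable_window.
have mp X : measurable X -> measurable_fun setT (fun w => pi w (X `&` window)).
  by move=> mX; by apply: measurable_pi; exact: mEw.
pose I := E `&` E'; pose D := E `\` E'; pose D' := E' `\` E.
have mI : measurable I by exact: measurableI.
have mD : measurable D by exact: measurableD.
have mD' : measurable D' by exact: measurableD.
have split_ (m : {measure set (plane R) -> \bar R}) X Y : measurable X -> measurable Y ->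
    m (X `&` window) = m ((X `&` Y) `&` window) + m ((X `\` Y) `&` window).
  move=> mX mY; rewrite -measureU//.
  - by rewrite -setIUl setUIDK.
  - by apply: mEw; exact: measurableI.
  - by apply: mEw; exact: measurableD.
  - by rewrite setIACA setIDA setIC -!setIA setDE; apply/seteqP; split => z //= [] /[swap]; tauto.
have LE : L E = L I + L D by exact: split_.
have LE' : L E' = L I + L D' by rewrite /I setIC; exact: split_.
have [i iE] : exists i, L I = i%:E by exists (fine (L I)); rewrite window_lebesgue_fin.
have [a aE] : exists i, L D = i%:E by exists (fine (L D)); rewrite window_lebesgue_fin.
have [b bE] : exists i, L D' = i%:E by exists (fine (L D')); rewrite window_lebesgue_fin.
rewrite (eq_integral (fun w =>
    (pi w (I `&` window) * pi w (I `&` window) + pi w (I `&` window) * pi w (D' `&` window)) +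
    (pi w (D `&` window) * pi w (I `&` window) + pi w (D `&` window) * pi w (D' `&` window)))); last first.
  move=> w _; rewrite (split_ (pi w) E E')// (split_ (pi w) E' E)// [E' `&` E]setIC.
  by rewrite ge0_muleDl// !ge0_muleDr//.
have mpp X Y : measurable X -> measurable Y -> measurable_fun setT
    (fun w => pi w (X `&` window) * pi w (Y `&` window)).
  by move=> mX mY; apply: emeasurable_funM; exact: mp.
rewrite ge0_integralD//; [|by move=> w _; rewrite adde_ge0 ?mule_ge0|
  by apply: emeasurable_funD; exact: mpp|by move=> w _; rewrite adde_ge0 ?mule_ge0|
  by apply: emeasurable_funD; exact: mpp].
rewrite !ge0_integralD//; try (exact: mpp); try (by move=> w _; rewrite mule_ge0).
rewrite pi_window_second_moment// !pi_disjoint_product//.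
- by rewrite LE LE' iE aE bE -?EFinD -?EFinM -?EFinD; congr EFin; ring.
- by rewrite /D /D'; apply/seteqP; split => z //= [[]]; tauto.
- by rewrite /D /I; apply/seteqP; split => z //= [[]]; tauto.
- by rewrite /D' /I; apply/seteqP; split => z //= [[]]; tauto.
Qed.

Lemma pi_window_ae : {ae P, forall w, pi w window < +oo}.
Proof.
have mw := measurable_window.
have : P.-integrable setT (fun w => pi w window).
  apply/integrableP; split; first exact: measurable_pi.
  under eq_integral do rewrite gee0_abs//.
  have := pi_window_mean (@measurableT _ (plane R)); rewrite setTI => ->.
  by apply: window_lebesgue_lty; exact: measurableT.
move=> /(integrable_ae measurableT); apply: filterS => w /(_ I).
by rewrite ge0_fin_numE.
Qed.

Lemma window_random_measure_ae E :
  {ae P, forall w, N w E = pi w (E `&` window)}.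
Proof. by apply: filterS pi_window_ae => w h; rewrite /N h. Qed.

Lemma window_random_measure_lty w : N w setT < +oo.
Proof.
rewrite /N; case: ifPn => h; first by rewrite /= /mrestr setTI.
by rewrite /= /mzero ltry.
Qed.

Lemma measurable_window_random_measure E : measurable E ->
  measurable_fun setT (fun w => N w E).
Proof.
move=> mE; have mw := measurable_window.
pose A := [set w | pi w window < +oo].
have mA : measurable A.
  rewrite -[A]setTI; have := emeasurable_fun_infty_o measurableT (measurable_pi mw).
  by apply.
rewrite (_ : (fun w => _) = (fun w => pi w (E `&` window) * (\1_A w)%:E)).
  apply: emeasurable_funM; first exact/measurable_pi/measurableI.
  by apply/measurable_EFinP; exact: measurable_indic.
apply/funext => w; rewrite /N indicE.
have [h|h] := boolP (pi w window < +oo).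
  by rewrite mem_set//= mule1.
by rewrite memNset//= ?mule0//; exact/negP.
Qed.

Lemma window_random_measure_mean A E : measurable A -> measurable E ->
  \int[P]_w ((\1_A w)%:E * N w E) =
  \int[P]_w ((\1_A w)%:E * pi w (E `&` window)).
Proof.
move=> mA mE; have mw := measurable_window.
have m1 : measurable_fun setT (fun w => (\1_A w)%:E : \bar R).
  by apply/measurable_EFinP; exact: measurable_indic.
apply: ge0_ae_eq_integral => //.
- by apply: emeasurable_funM => //; exact: measurable_window_random_measure.
- by apply: emeasurable_funM => //; exact/measurable_pi/measurableI.
- by apply: filterS (window_random_measure_ae E) => w -> _.
Qed.

Lemma window_random_measure_product A E1 E2 :
  measurable A -> measurable E1 -> measurable E2 ->
  \int[P]_w ((\1_A w)%:E * (N w E1 * N w E2)) =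
  \int[P]_w ((\1_A w)%:E * (pi w (E1 `&` window) * pi w (E2 `&` window))).
Proof.
move=> mA mE1 mE2; have mw := measurable_window.
have m1 : measurable_fun setT (fun w => (\1_A w)%:E : \bar R).
  by apply/measurable_EFinP; exact: measurable_indic.
apply: ge0_ae_eq_integral => //.
- apply: emeasurable_funM => //.
  by apply: emeasurable_funM; exact: measurable_window_random_measure.
- apply: emeasurable_funM => //.
  by apply: emeasurable_funM; exact/measurable_pi/measurableI.
- apply: filterS2 (window_random_measure_ae E1) (window_random_measure_ae E2).
  by move=> w -> ->.
Qed.

(** As [E1] lies before [s], its random mass is [F s]-measurable by adaptedness, and it can be
    treated like the event [A]. *)
Lemma past_integer_future (s : R) (A : set Omega) (E1 : set (plane R)) (Y : Omega -> \bar R) :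
  (0 <= s)%R -> F s A -> measurable E1 -> E1 `<=` (`]-oo, s] `*` setT) ->
  (forall w, 0 <= Y w) ->
  measurable_fun [set: g_sigma_algebraType (random_measure_gen (`]s, +oo[ `*` `[0%R, +oo[))] Y ->
  \int[P]_w ((\1_A w)%:E * pi w (E1 `&` window) * Y w) =
  \int[P]_w ((\1_A w)%:E * pi w (E1 `&` window)) * \int[P]_w Y w.
Proof.
move=> s0 FA mE1 E1s Y0 mY; have mw := measurable_window.
apply: (past_future s0)  => // C mC.
(* [F s] is turned into a measurable type to use the stability of measurable functions under
   products. *)
pose GF := g_sigma_algebraType (F s).
have FGF : <<s F s >> = F s := sigma_algebra_id (filtration_sigma F_filtration s0).
suff : measurable_fun [set: GF] (fun w => (\1_A w)%:E * pi w (E1 `&` window)).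
  by move=> /(_ measurableT C mC); rewrite setTI /measurable /= FGF.
apply: emeasurable_funM.
  apply/measurable_EFinP; apply: measurable_indic.
  by rewrite /measurable /= FGF.
move=> _ D mD; rewrite setTI /measurable /= FGF.
apply: (pi_adapted s0); apply: sub_sigma_algebra.
exists tt, (E1 `&` window), D; split => //; first exact: measurableI.
move=> [u z] [/E1s[/= us _] [/= + +]]; rewrite /= !in_itv /= in us *.
by move=> /andP[/ltW -> _] /andP[-> _]; rewrite us.
Qed.

Lemma past_event_future (s : R) (A : set Omega) (Y : Omega -> \bar R) :
  (0 <= s)%R -> F s A -> (forall w, 0 <= Y w) ->
  measurable_fun [set: g_sigma_algebraType (random_measure_gen (`]s, +oo[ `*` `[0%R, +oo[))] Y ->
  \int[P]_w ((\1_A w)%:E * Y w) = P A * \int[P]_w Y w.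
Proof.
move=> s0 FA Y0 mY.
have mA := filtration_sub F_filtration s0 FA.
rewrite (past_future s0)//; first by rewrite integral_indic// setIT.
move=> C mC.
have FGF : <<s F s >> = F s := sigma_algebra_id (filtration_sigma F_filtration s0).
suff : measurable_fun [set: g_sigma_algebraType (F s)] (fun w => (\1_A w)%:E : \bar R).
  by move=> /(_ measurableT C mC); rewrite setTI /measurable /= FGF.
by apply/measurable_EFinP; apply: measurable_indic; rewrite /measurable /= FGF.
Qed.

Lemma measurable_future_pi (s c : R) :
  measurable_fun [set: g_sigma_algebraType (random_measure_gen (`]s, +oo[ `*` `[0%R, +oo[))]
    (fun w => pi w ((`]s, +oo[ `*` `]-oo, c]) `&` window)).
Proof.
apply: sigma_random_measure_meas.
  by apply: measurableI; [exact: measurableX|exact: measurable_window].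
move=> [u z] [[/= us _] [/= _ zK]]; split => //=; move: zK.
by rewrite !in_itv /= andbT => /andP[].
Qed.

Definition rect (s c : R) : set (plane R) := `]s, +oo[ `*` `]-oo, c].

Lemma measurable_rect s c : measurable (rect s c).
Proof. exact: measurableX. Qed.

Lemma window_rect_mean s c A : (0 <= s)%R -> F s A ->
  \int[P]_w ((\1_A w)%:E * N w (rect s c)) = P A * L (rect s c).
Proof.
move=> s0 FA; have mA := filtration_sub F_filtration s0 FA.
have mr := measurable_rect s c.
rewrite window_random_measure_mean// (past_event_future s0)//.
  by rewrite pi_window_mean.
exact: measurable_future_pi.
Qed.

(* On the rectangle after time [s'], the random measure is independent of
   everything that precedes; only the strip between [s] and [s'] correlates with
   the past event. *)
Lemma window_rect_product s c s' c' A A' : (0 <= s)%R -> (s <= s')%R ->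
  F s A -> F s' A' ->
  \int[P]_w ((\1_(A `&` A') w)%:E * (N w (rect s c) * N w (rect s' c')))
    + P (A `&` A') * (L (rect s c) * L (rect s' c')) =
  P (A `&` A') * L (rect s c `&` rect s' c')
    + \int[P]_w ((\1_(A `&` A') w)%:E * N w (rect s c)) * L (rect s' c')
    + L (rect s c) * \int[P]_w ((\1_(A `&` A') w)%:E * N w (rect s' c')).
Proof.
move=> s0 ss' FA FA'; have s0' := le_trans s0 ss'.
set H := A `&` A'.
have FH : F s' H.
  by apply: filtration_setI => //; exact: (filtration_mono F_filtration s0 ss' FA).
have mH := filtration_sub F_filtration s0' FH.
have mrect := measurable_rect.
have mw := measurable_window.
pose E1 : set (plane R) := `]s, s'] `*` `]-oo, c].
have mE1 : measurable E1 by exact: measurableX.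
have E1p : E1 `<=` (`]-oo, s'] `*` setT).
  by move=> [u z] [/= + _]; rewrite in_itv /= => /andP[_ us]; split => //=; rewrite in_itv.
have E12 : rect s c = E1 `|` rect s' c.
  apply/seteqP; split => -[u z] /=.
    rewrite /rect /E1 /= !in_itv /= !andbT => -[su zc]; have [us'|us'] := leP u s'.
      by left; rewrite su.
    by right.
  by rewrite /E1 /rect /= !in_itv /= !andbT => -[[/andP[? _] ?]|[? ?]]; split => //; lra.
have E120 : E1 `&` rect s' c = set0.
  apply/seteqP; split => -[u z] //=; rewrite /E1 /rect /= !in_itv /= !andbT.
  by move=> [[/andP[_ us] _] [su _]]; move: (le_lt_trans us su); rewrite ltxx.
have ES (m : {measure set (plane R) -> \bar R}) : m (rect s c) = m E1 + m (rect s' c).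
  by rewrite E12 measureU.
have EI : rect s c `&` rect s' c' = rect s' c `&` rect s' c'.
  rewrite E12 setIUl (_ : E1 `&` _ = set0) ?set0U//.
  apply/seteqP; split => -[u z] //=; rewrite /E1 /rect /= !in_itv /= !andbT.
  by move=> [[/andP[_ us] _] [su _]]; move: (le_lt_trans us su); rewrite ltxx.
rewrite EI !ES.
have [p pE] : exists p, P H = p%:E by exists (fine (P H)); rewrite fineK ?fin_num_measure.
have Lf E : measurable E -> exists p, L E = p%:E.
  by move=> mE; exists (fine (L E)); rewrite window_lebesgue_fin.
have [a1 a1E] := Lf _ mE1; have [a2 a2E] := Lf _ (measurable_rect s' c).
have [b bE] := Lf _ (measurable_rect s' c').
have [i iE] : exists i, L (rect s' c `&` rect s' c') = i%:E.
  by apply: Lf; exact: measurableI.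
have m1 : measurable_fun setT (fun w => (\1_H w)%:E : \bar R).
  by apply/measurable_EFinP; exact: measurable_indic.
have mN E : measurable E -> measurable_fun setT (fun w => N w E).
  exact: measurable_window_random_measure.
have int1 : \int[P]_w ((\1_H w)%:E * N w (rect s c)) =
    \int[P]_w ((\1_H w)%:E * N w E1) + p%:E * a2%:E.
  rewrite -pE -a2E -window_rect_mean// -ge0_integralD//;
    try by apply: emeasurable_funM => //; exact: mN.
  by apply: eq_integral => w _; rewrite ES ge0_muleDr.
have int2 : \int[P]_w ((\1_H w)%:E * (N w (rect s c) * N w (rect s' c'))) =
    \int[P]_w ((\1_H w)%:E * N w E1) * b%:E + p%:E * (i%:E + a2%:E * b%:E).
  rewrite (eq_integral (fun w => (\1_H w)%:E * (N w E1 * N w (rect s' c')) +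
      (\1_H w)%:E * (N w (rect s' c) * N w (rect s' c')))); last first.
    by move=> w _; rewrite ES -ge0_muleDr ?mule_ge0// ge0_muleDl.
  rewrite ge0_integralD//;
    try by do 2 (apply: emeasurable_funM => //); exact: mN.
  rewrite window_random_measure_product// window_random_measure_product//.
  congr (_ + _).
    under eq_integral do rewrite muleA.
    rewrite (past_integer_future (s := s'))//; last exact: measurable_future_pi.
    by rewrite pi_window_mean// bE window_random_measure_mean.
  rewrite (past_event_future s0')//; last first.
    by apply: emeasurable_funM; exact: measurable_future_pi.
  by rewrite pi_product// pE iE a2E bE.
(* This mean cannot be computed, because [A'] may depend on the points in [E1]. It appears on both
   sides with the same factor [b], so that its finiteness is enough. *)
have [q qE] : exists q, \int[P]_w ((\1_H w)%:E * N w E1) = q%:E.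
  have le1 : \int[P]_w ((\1_H w)%:E * N w E1) <= L E1.
    rewrite window_random_measure_mean// -pi_window_mean//.
    apply: ge0_le_integral => //.
    - by apply: emeasurable_funM => //; exact/measurable_pi/measurableI.
    - exact/measurable_pi/measurableI.
    - move=> w _; rewrite -[leRHS]mul1e lee_wpmul2r// lee_fin indicE.
      by case: (_ \in _).
  exists (fine (\int[P]_w ((\1_H w)%:E * N w E1))); rewrite fineK//.
  rewrite ge0_fin_numE; first by rewrite (le_lt_trans le1)// a1E ltry.
  by apply: integral_ge0 => w _; rewrite mule_ge0// lee_fin.
rewrite int2 int1 window_rect_mean// qE pE iE a1E a2E bE -?EFinM -?EFinD -?EFinM -?EFinD.
by congr EFin; ring.
Qed.

End predictable.

(** * Mean and isometry on predictable sets within a window *)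

Section isometry.
Context (disp : measure_display) (Omega : measurableType disp) (R : realType).
Variables (P : probability Omega R) (F : R -> set_system Omega).
Hypothesis F_filtration : filtration F.
Variable pi : R.-ker Omega ~> plane R.
Hypothesis pi_poisson : poisson_measure P (@intensity_measure R) pi.
Hypothesis pi_adapted : forall t : R, (0 <= t)%R ->
  sigma_random_measures (fun _ : unit => pi) (`[0%R, t] `*` `[0%R, +oo[) `<=` F t.
Hypothesis pi_future : forall t : R, (0 <= t)%R ->
  independent2 P (F t)
    (sigma_random_measures (fun _ : unit => pi) (`]t, +oo[ `*` `[0%R, +oo[)).
Variables (T K : R).

Local Notation W := (window T K).
Local Notation L := (window_lebesgue T K).
Local Notation N := (window_random_measure pi T K).
Local Notation predictable := <<s predictable_rect F >>.

Lemma predictable_measurable : predictable `<=` measurable.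
Proof.
apply: smallest_sub; first exact: sigma_algebra_measurable.
exact: predictable_rect_measurable.
Qed.

Lemma window_lebesgueI E : L (E `&` W) = L E.
Proof. by rewrite /L /= /mrestr -setIA setIid. Qed.

Lemma window_random_measureI w E : N w (E `&` W) = N w E.
Proof. by rewrite /N; case: ifPn => // _; rewrite /= /mrestr -setIA setIid. Qed.

Lemma predictable_rect_window B : predictable_rect F B ->
  exists A s c, [/\ (0 <= s)%R, F s A &
    forall w, xsection B w `&` W = (if w \in A then rect s c else set0) `&` W].
Proof.
move=> [->|[A [s [c [s0 FA ->]]]]]; last first.
  exists A, s, c; split => // w; congr (_ `&` _).
  by case: ifPn => wA; [rewrite in_xsectionX|rewrite notin_xsectionX].
(* The marks of the window do not exceed [K] and its times are positive. *)
exists setT, 0%R, K; split => //.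
  have [F0 FC _] := filtration_sigma F_filtration (lexx 0%R).
  by rewrite -(setD0 setT); exact: FC.
move=> w; rewrite in_setT; apply/seteqP; split => -[u z] [] // _.
  move=> [/=]; rewrite !in_itv /= => /andP[u0 uT] /andP[z0 zK].
  by split; split => /=; rewrite !in_itv /= ?u0 ?uT ?z0 ?zK.
by split => //; rewrite /xsection /= inE.
Qed.

Lemma rect_sections B : predictable_rect F B ->
  exists A s c, [/\ (0 <= s)%R, F s A,
    forall w, N w (xsection B w) = (\1_A w)%:E * N w (rect s c),
    forall w, L (xsection B w) = (\1_A w)%:E * L (rect s c) &
    forall w E, L (xsection B w `&` E) = (\1_A w)%:E * L (rect s c `&` E)].
Proof.
move=> /predictable_rect_window[A [s [c [s0 FA BE]]]]; exists A, s, c.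
split => // [w|w|w E].
- rewrite -window_random_measureI BE indicE; case: ifPn => wA.
    by rewrite mul1e window_random_measureI.
  by rewrite set0I measure0 mul0e.
- rewrite -window_lebesgueI BE indicE; case: ifPn => wA.
    by rewrite mul1e window_lebesgueI.
  by rewrite set0I measure0 mul0e.
- rewrite -window_lebesgueI setIAC BE indicE; case: ifPn => wA.
    by rewrite mul1e setIAC window_lebesgueI.
  by rewrite set0I set0I measure0 mul0e.
Qed.

Let mN E : measurable E -> measurable_fun setT (fun w => N w E).
Proof. exact: measurable_window_random_measure. Qed.

Let mL E : measurable E -> measurable_fun setT (fun w : Omega => L E).
Proof. by move=> _; exact: measurable_cst. Qed.

Let Lfin (w : Omega) : L setT < +oo.
Proof. by apply: window_lebesgue_lty; exact: measurableT. Qed.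

Let Nfin w : N w setT < +oo. Proof. exact: window_random_measure_lty. Qed.

Lemma integral_cst_probability (x : \bar R) : \int[P]_w x = x.
Proof.
by rewrite integral_cst// -[RHS]mule1; congr (_ * _); exact: probability_setT.
Qed.

Lemma integral_le_cst (f : Omega -> \bar R) (x : \bar R) :
  measurable_fun setT f -> (forall w, 0 <= f w) -> (forall w, f w <= x) ->
  \int[P]_w f w <= x.
Proof.
move=> mf f0 fx; rewrite -[leRHS]integral_cst_probability.
by apply: ge0_le_integral => // w _; exact: le_trans (fx w).
Qed.

Lemma window_random_measure_fin w E : measurable E -> (fine (N w E))%:E = N w E.
Proof.
move=> mE; rewrite fineK// ge0_fin_numE// (le_lt_trans _ (Nfin w))//.
by apply: le_measure; rewrite ?inE//; exact: measurableT.
Qed.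

Let mNs B : measurable B -> measurable_fun setT (fun w => N w (xsection B w)).
Proof. exact: (measurable_fun_xsection_ptfin_kernel mN Nfin). Qed.

Let mLs B : measurable B -> measurable_fun setT (fun w : Omega => L (xsection B w)).
Proof. exact: (measurable_fun_xsection_ptfin_kernel mL Lfin). Qed.

Let indic_fin (A : set Omega) : measurable A ->
  measurable_fun setT (fun w => (\1_A w)%:E : \bar R).
Proof. by move=> mA; apply/measurable_EFinP; exact: measurable_indic. Qed.

(** Both sides are finite measures in [B], and they agree on the pi-system of generators. *)
Lemma predictable_mean B : predictable B ->
  \int[P]_w N w (xsection B w) = \int[P]_w L (xsection B w).
Proof.
move=> pB.
have [m1 m1E] := exists_weighted_kernel_measure mN Nfin P
  (fun=> ler01) (measurable_cst (1 : R)%R).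
have [m2 m2E] := exists_weighted_kernel_measure mL Lfin P
  (fun=> ler01) (measurable_cst (1 : R)%R).
have m1E' A : m1 A = \int[P]_w N w (xsection A w).
  by rewrite m1E; under eq_integral do rewrite mul1e.
have m2E' A : m2 A = \int[P]_w L (xsection A w).
  by rewrite m2E; under eq_integral do rewrite mul1e.
have m12 A : predictable_rect F A -> m1 A = m2 A.
  rewrite m1E' m2E' => /rect_sections[H [s [c [s0 FH HN HL _]]]].
  under eq_integral do rewrite HN.
  under [in RHS]eq_integral do rewrite HL.
  have mH := filtration_sub F_filtration s0 FH.
  rewrite (window_rect_mean F_filtration pi_poisson pi_future)//.
  rewrite ge0_integralZr//; last exact: indic_fin.
  by rewrite integral_indic// setIT.
rewrite -m1E' -m2E'; apply: (g_sigma_algebra_measure_unique (predictable_rect F)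
  _ (fun=> setT)) => //.
- exact: predictable_rect_measurable.
- by move=> _; left.
- by rewrite bigcup_const//; exists 0%N.
- exact: predictable_rect_setI.
- move=> _; rewrite m12; last by left.
  rewrite m2E' (_ : (fun w => _) = cst (L setT)); last first.
    by apply/funext => w; congr (L _); apply/seteqP; split => z // _; rewrite /xsection /= inE.
  rewrite integral_cst// (_ : _ * _ = L setT); first exact: (Lfin point).
  by rewrite -[RHS]mule1; congr (_ * _); exact: probability_setT.
Qed.

(** Provides the finite total mass needed to apply uniqueness of measures to the isometry. *)
Lemma window_random_measure_second_moment :
  \int[P]_w (N w setT * N w setT) < +oo.
Proof.
have mT := @measurableT _ (plane R).
have := window_random_measure_product pi_poisson T K (@measurableT _ Omega) mT mT.
under eq_integral do rewrite indicT mul1e.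
under [in RHS]eq_integral do rewrite indicT mul1e.
move=> ->; rewrite (pi_product pi_poisson)//.
have LT := Lfin point.
by rewrite setIT lte_add_pinfty// lte_mul_pinfty// ge0_fin_numE.
Qed.

(** The expanded form of: the compensated masses of [B] and [C] have a product of mean [L (B & C)].
    The negative terms are moved across, so that for fixed [C] each side is a measure in [B]. *)
Definition isometry_at (B C : set (Omega * plane R)) :=
  \int[P]_w (N w (xsection B w) * N w (xsection C w))
    + \int[P]_w (L (xsection B w) * L (xsection C w)) =
  \int[P]_w L (xsection B w `&` xsection C w)
    + \int[P]_w (N w (xsection B w) * L (xsection C w))
    + \int[P]_w (L (xsection B w) * N w (xsection C w)).

Lemma isometry_atC B C : isometry_at B C -> isometry_at C B.
Proof.
rewrite /isometry_at => h.
have com (f g : Omega -> \bar R) : \int[P]_w (f w * g w) = \int[P]_w (g w * f w).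
  by apply: eq_integral => w _; rewrite muleC.
rewrite com [X in _ + X = _]com h.
rewrite [X in _ = X + _ + _](eq_integral (fun w => L (xsection B w `&` xsection C w))).
  rewrite [X in _ = _ + X + _]com [X in _ = _ + _ + X]com.
  by rewrite -[RHS]addeA -[LHS]addeA [X in _ + X = _]addeC.
by move=> w _; rewrite setIC.
Qed.

Lemma isometry_rect B C : predictable_rect F B -> predictable_rect F C ->
  isometry_at B C.
Proof.
move=> /rect_sections[A [s [c [s0 FA BN BL BI]]]].
move=> /rect_sections[A' [s' [c' [s0' FA' CN CL CI]]]].
wlog ss' : B C A s c s0 FA BN BL BI A' s' c' s0' FA' CN CL CI / (s <= s')%R.
  move=> hw; have [ss'|/ltW ss'] := leP s s'; first exact: (hw B C A s c _ _ _ _ _ A' s' c').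
  by apply: isometry_atC; exact: (hw C B A' s' c' _ _ _ _ _ A s c).
have mA := filtration_sub F_filtration s0 FA.
have mA' := filtration_sub F_filtration s0' FA'.
have mH : measurable (A `&` A') by exact: measurableI.
have := window_rect_product F_filtration pi_poisson pi_adapted pi_future T K c c' s0 ss' FA FA'.
have HI w : (\1_A w)%:E * (\1_A' w)%:E = (\1_(A `&` A') w)%:E :> \bar R.
  by rewrite -EFinM indicI.
rewrite /isometry_at => h.
rewrite [X in X + _ = _](_ : _ = \int[P]_w ((\1_(A `&` A') w)%:E *
    (N w (rect s c) * N w (rect s' c')))); last first.
  by apply: eq_integral => w _; rewrite BN CN muleACA HI.
rewrite [X in _ + X = _](_ : _ = P (A `&` A') * (L (rect s c) * L (rect s' c'))); last first.
  under eq_integral do rewrite BL CL muleACA HI.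
  rewrite ge0_integralZr//; [|exact: indic_fin].
  by rewrite integral_indic// setIT.
rewrite h; f_equal; first f_equal.
- under [RHS]eq_integral do rewrite BI setIC CI setIC muleA HI.
  rewrite ge0_integralZr//; last exact: indic_fin.
  by rewrite integral_indic// setIT.
- under [RHS]eq_integral do rewrite BN CL muleACA HI muleA.
  rewrite ge0_integralZr//.
  by apply: emeasurable_funM; [exact: indic_fin|apply: mN; exact: measurable_rect].
- under [RHS]eq_integral do rewrite BL CN muleACA HI muleCA.
  rewrite ge0_integralZl//.
  by apply: emeasurable_funM; [exact: indic_fin|apply: mN; exact: measurable_rect].
Qed.

(** The argument [step_] extends the identity from generators to predictable sets in the first
    variable, by uniqueness of finite measures. It is used twice: the symmetry of the identity
    exchanges the variables. *)
Lemma predictable_isometry B C : predictable B -> predictable C ->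
  isometry_at B C.
Proof.
have step_ : forall B' C', predictable B' ->
    (forall A, predictable_rect F A -> isometry_at A C') -> measurable C' ->
    isometry_at B' C'; last first.
  move=> pB pC; apply: (step_ _ _ pB); last exact: predictable_measurable.
  move=> A rA; apply: isometry_atC; apply: (step_ _ _ pC).
    by move=> D rD; exact: isometry_rect.
  exact: (predictable_rect_measurable F_filtration rA).
move=> B' C' pB' rect_iso mC.
pose gN w := fine (N w (xsection C' w)).
pose gL w := fine (L (xsection C' w)).
have gN0 w : (0 <= gN w)%R by exact: fine_ge0.
have gL0 w : (0 <= gL w)%R by exact: fine_ge0.
have mgN : measurable_fun setT gN.
  by apply: measurableT_comp => //; exact: mNs.
have mgL : measurable_fun setT gL.
  by apply: measurableT_comp => //; exact: mLs.
have gNE w : (gN w)%:E = N w (xsection C' w).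
  by rewrite /gN window_random_measure_fin//; exact: measurable_xsection.
have gLE w : (gL w)%:E = L (xsection C' w).
  by rewrite /gL window_lebesgue_fin//; exact: measurable_xsection.
have [mNN NN] := exists_weighted_kernel_measure mN Nfin P gN0 mgN.
have [mLL LL] := exists_weighted_kernel_measure mL Lfin P gL0 mgL.
have [mNL NL] := exists_weighted_kernel_measure mN Nfin P gL0 mgL.
have [mLN LN] := exists_weighted_kernel_measure mL Lfin P gN0 mgN.
have [mI0 I0] := exists_weighted_kernel_measure mL Lfin P
  (fun=> ler01) (measurable_cst (1 : R)%R).
pose mI := mrestr mI0 mC.
pose m1 := measure_add mNN mLL.
pose m2 := measure_add (measure_add mI mNL) mLN.
have m1E A : m1 A = \int[P]_w (N w (xsection A w) * N w (xsection C' w))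
    + \int[P]_w (L (xsection A w) * L (xsection C' w)).
  rewrite /m1 measure_addE NN LL; under eq_integral do rewrite gNE muleC.
  by under [X in _ + X = _]eq_integral do rewrite gLE muleC.
have m2E A : m2 A = \int[P]_w L (xsection A w `&` xsection C' w)
    + \int[P]_w (N w (xsection A w) * L (xsection C' w))
    + \int[P]_w (L (xsection A w) * N w (xsection C' w)).
  have -> : m2 A = mI A + mNL A + mLN A.
    by rewrite /m2 measure_addE; f_equal; exact: measure_addE.
  rewrite NL LN /mI /= /mrestr I0.
  under eq_integral do rewrite mul1e xsectionI.
  under [X in _ + X + _ = _]eq_integral do rewrite gLE muleC.
  by under [X in _ + _ + X = _]eq_integral do rewrite gNE muleC.
have m12 A : predictable_rect F A -> m1 A = m2 A.
  by move=> rA; rewrite m1E m2E; exact: rect_iso.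
suff : m1 B' = m2 B' by rewrite m1E m2E.
have m1T : m1 setT < +oo.
  rewrite m1E.
  have sT (m : {measure set (plane R) -> \bar R}) w :
      m (xsection (setT : set (Omega * plane R)) w) = m setT.
    by congr (m _); apply/seteqP; split => z // _; rewrite /xsection /= inE.
  have sub (m : {measure set (plane R) -> \bar R}) w :
      m (xsection C' w) <= m setT.
    by apply: le_measure; rewrite ?inE//; exact: measurable_xsection.
  apply: lte_add_pinfty.
    apply: le_lt_trans window_random_measure_second_moment.
    apply: ge0_le_integral => //.
    - by apply: emeasurable_funM; exact: mNs.
    - by apply: emeasurable_funM; apply: mN; exact: measurableT.
    - by move=> w _; rewrite sT; apply: lee_wpmul2l => //; exact: sub.
  apply: (@le_lt_trans _ _ (L setT * L setT)).
    apply: integral_le_cst => [|w|w].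
    - by apply: emeasurable_funM; exact: mLs.
    - exact: mule_ge0.
    - by rewrite sT; apply: lee_wpmul2l => //; exact: sub.
  have LT := Lfin point.
  by apply: lte_mul_pinfty => //; rewrite ge0_fin_numE.
apply: (g_sigma_algebra_measure_unique (predictable_rect F) _ (fun=> setT)) => //.
- exact: predictable_rect_measurable.
- by move=> _; left.
- by rewrite bigcup_const//; exists 0%N.
- exact: predictable_rect_setI.
Qed.

(* AM-GM: [|x| <= eps * x^2 + 1 / (4 * eps)] *)
Lemma predictable_L1_bound B (eps : R) : predictable B -> (0 < eps)%R ->
  \int[P]_w `|N w (xsection B w) - L (xsection B w)| <=
  eps%:E * \int[P]_w L (xsection B w) + ((4 * eps)^-1)%:E.
Proof.
move=> pB e0; have mB := predictable_measurable pB.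
pose n w := N w (xsection B w); pose l w := L (xsection B w).
have mn : measurable_fun setT n by exact: mNs.
have ml : measurable_fun setT l by exact: mLs.
have n0 w : 0 <= n w by [].
have l0 w : 0 <= l w by [].
have mnl : measurable_fun setT (fun w => n w * l w) by exact: emeasurable_funM.
have nfin w : n w = (fine (n w))%:E.
  by rewrite window_random_measure_fin//; exact: measurable_xsection.
have lfin w : l w = (fine (l w))%:E.
  by rewrite window_lebesgue_fin//; exact: measurable_xsection.
have := predictable_isometry pB pB; rewrite /isometry_at.
under [X in _ = X + _ + _ -> _]eq_integral do rewrite setIid.
under [X in _ = _ + X -> _]eq_integral do rewrite muleC.
rewrite -/(n _).
set nn := \int[P]_w (N w _ * N w _); set ll := \int[P]_w (L _ * L _).
set nl := \int[P]_w (N w _ * L _); set l1 := \int[P]_w L _.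
move=> iso.
(* The mixed term is cancelled at the end, which requires its finiteness. *)
have nl_fin : nl \is a fin_num.
  rewrite ge0_fin_numE ?integral_ge0//.
  apply: (@le_lt_trans _ _ (\int[P]_w (L setT * N w (xsection B w)))).
    apply: ge0_le_integral => //.
    - by apply: measurable_funeM; exact: mn.
    - move=> w _; rewrite muleC; apply: lee_wpmul2r => //.
      by apply: le_measure; rewrite ?inE//; exact: measurable_xsection.
  rewrite ge0_integralZl// predictable_mean//.
  have LT := Lfin point.
  apply: lte_mul_pinfty => //; first by rewrite ge0_fin_numE.
  apply: le_lt_trans LT; apply: integral_le_cst => // w.
  by apply: le_measure; rewrite ?inE//; exact: measurable_xsection.
(* With the mixed product on the left, all integrands are nonnegative. By the isometry the quadratic
   terms on the right integrate to [eps] times [l1 + nl + nl], and the two copies of [nl] match the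
   left-hand side. *)
have : \int[P]_w (`|n w - l w| + (2 * eps)%:E * (n w * l w)) <=
       \int[P]_w (eps%:E * (n w * n w) + eps%:E * (l w * l w) + ((4 * eps)^-1)%:E).
  apply: ge0_le_integral => //.
  - by move=> w _; rewrite adde_ge0// !mule_ge0// lee_fin mulr_ge0// ltW.
  - apply: emeasurable_funD; last exact: measurable_funeM.
    by apply: measurableT_comp => //; exact: emeasurable_funB.
  - by apply: emeasurable_funD => //; apply: emeasurable_funD; apply: measurable_funeM;
      exact: emeasurable_funM.
  - move=> w _; rewrite nfin lfin -EFinB -!EFinM -!EFinD lee_fin.
    move: (fine (n w)) (fine (l w)) => x y.
    have e4 : (4 * eps != 0)%R by rewrite mulf_neq0// gt_eqF.
    (* The remainder in AM-GM is the explicit square. *)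
    have -> : (eps * (x * x) + eps * (y * y) + (4 * eps)^-1 =
      2 * eps * (x * y) + `|x - y| + (4 * eps)^-1 * (2 * eps * `|x - y| - 1) ^+ 2)%R.
      have xy2 : ((x - y) ^+ 2 = `|x - y| ^+ 2)%R by rewrite real_normK ?num_real.
      have -> : (eps * (x * x) + eps * (y * y) =
          eps * (x - y) ^+ 2 + 2 * eps * (x * y))%R by ring.
      by rewrite xy2; field; rewrite gt_eqF.
    rewrite [leLHS]addrC lerDl mulr_ge0 ?sqr_ge0// invr_ge0 mulr_ge0// ltW//.
have mabs : measurable_fun setT (fun w => `|n w - l w|).
  by apply: measurableT_comp => //; exact: emeasurable_funB.
have e0' : 0 <= eps%:E by rewrite lee_fin ltW.
have e20 : 0 <= (2 * eps)%:E by rewrite lee_fin mulr_ge0// ltW.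
have mnn : measurable_fun setT (fun w => n w * n w) by exact: emeasurable_funM.
have mll : measurable_fun setT (fun w => l w * l w) by exact: emeasurable_funM.
have nn0 : 0 <= nn by apply: integral_ge0 => w _; exact: mule_ge0.
have ll0 : 0 <= ll by apply: integral_ge0 => w _; exact: mule_ge0.
have -> : \int[P]_w (`|n w - l w| + (2 * eps)%:E * (n w * l w)) =
    \int[P]_w `|n w - l w| + (2 * eps)%:E * nl.
  rewrite ge0_integralD//.
  - by rewrite ge0_integralZl//; move=> w _; exact: mule_ge0.
  - by move=> w _; rewrite !mule_ge0.
  - exact: measurable_funeM.
have -> : \int[P]_w (eps%:E * (n w * n w) + eps%:E * (l w * l w) + ((4 * eps)^-1)%:E) =
    eps%:E * (nn + ll) + ((4 * eps)^-1)%:E.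
  have m1 : measurable_fun setT (fun w => eps%:E * (n w * n w)) by exact: measurable_funeM.
  have m2 : measurable_fun setT (fun w => eps%:E * (l w * l w)) by exact: measurable_funeM.
  have p1 w : 0 <= eps%:E * (n w * n w) by rewrite !mule_ge0.
  have p2 w : 0 <= eps%:E * (l w * l w) by rewrite !mule_ge0.
  have p3 : 0 <= ((4 * eps)^-1)%:E by rewrite lee_fin invr_ge0 mulr_ge0// ltW.
  rewrite (ge0_integralD _ measurableT (fun w _ => adde_ge0 (p1 w) (p2 w))
    (emeasurable_funD m1 m2))//.
  rewrite (ge0_integralD _ measurableT (fun w _ => p1 w))//.
  rewrite !ge0_integralZl//; try by move=> w _; exact: mule_ge0.
  by rewrite integral_cst_probability (@ge0_muleDr _ eps%:E nn ll).
rewrite iso => h.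
have [a aE] : exists a, nl = a%:E by exists (fine nl); rewrite fineK.
have l10 : 0 <= l1 by exact: integral_ge0.
have nl0 : 0 <= nl by apply: integral_ge0 => w _; exact: mule_ge0.
rewrite -(@leeD2rE _ ((2 * eps)%:E * nl)); last by rewrite fin_numM.
apply: (le_trans h); rewrite -[l1 + nl + nl]addeA.
have nl20 : 0 <= nl + nl by exact: adde_ge0.
rewrite (@ge0_muleDr _ eps%:E l1 (nl + nl) l10 nl20).
rewrite -addeA -[leRHS]addeA leeD2l// addeC leeD2l//.
by rewrite aE -EFinD -!EFinM lee_fin; lra.
Qed.

End isometry.

Lemma fatou_ae d (T : measurableType d) (R : realType)
    (mu : {measure set T -> \bar R}) (f : nat -> T -> \bar R) (g : T -> \bar R)
    (c : \bar R) :
  (forall n, measurable_fun setT (f n)) -> (forall n x, 0 <= f n x) ->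
  measurable_fun setT g -> (forall x, 0 <= g x) ->
  {ae mu, forall x, f ^~ x @ \oo --> g x} ->
  (forall n, \int[mu]_x f n x <= c) -> \int[mu]_x g x <= c.
Proof.
move=> mf f0 mg g0 fg fc.
have einf_le (u : nat -> \bar R) (a : \bar R) : (forall n, u n <= a) -> limn_einf u <= a.
  move=> ua; rewrite limn_einf_lim; apply: lime_le; first exact: is_cvg_einfs.
  by apply: nearW => n; apply: le_trans (ua n); apply: ereal_inf_lbound; exists n => /=.
have einf_ge0 (u : nat -> \bar R) : (forall n, 0 <= u n) -> 0 <= limn_einf u.
  move=> u0; rewrite limn_einf_lim; apply: lime_ge; first exact: is_cvg_einfs.
  by apply: nearW => n; apply: le_ereal_inf_tmp => _ [m _ <-].
have -> : \int[mu]_x g x = \int[mu]_x limn_einf (f ^~ x).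
  apply: ge0_ae_eq_integral => //.
  - rewrite (_ : (fun x => _) = (fun x => limn (einfs (f ^~ x)))); last first.
      by apply/funext => x; rewrite limn_einf_lim.
    apply: (emeasurable_fun_cvg (fun n x => einfs (f ^~ x) n)).
      by move=> n; exact: measurable_fun_einfs.
    by move=> x _; exact: is_cvg_einfs.
  - by move=> x _; exact: einf_ge0.
  - apply: filterS fg => x fgx _; rewrite is_cvg_limn_einfE; last by apply/cvg_ex; exists (g x).
    by apply/esym/cvg_lim.
by apply: le_trans (fatou mu measurableT mf _) _ => //; exact: einf_le.
Qed.

(** * Passage from bounded windows to a strip of unbounded height *)

Section strip.
Context (disp : measure_display) (Omega : measurableType disp) (R : realType).
Variables (P : probability Omega R) (F : R -> set_system Omega).
Hypothesis F_filtration : filtration F.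
Variable pi : R.-ker Omega ~> plane R.
Hypothesis pi_poisson : poisson_measure P (@intensity_measure R) pi.
Hypothesis pi_adapted : forall t : R, (0 <= t)%R ->
  sigma_random_measures (fun _ : unit => pi) (`[0%R, t] `*` `[0%R, +oo[) `<=` F t.
Hypothesis pi_future : forall t : R, (0 <= t)%R ->
  independent2 P (F t)
    (sigma_random_measures (fun _ : unit => pi) (`]t, +oo[ `*` `[0%R, +oo[)).
Variables (T : R).

Definition strip : set (plane R) := `]0%R, T] `*` `[0%R, +oo[.

Lemma bigcup_window : \bigcup_n window T n%:R = strip.
Proof.
apply/seteqP; split => -[u z].
  move=> [n _] [/= uT]; rewrite !in_itv /= in uT * => /andP[z0 _].
  by split => /=; rewrite in_itv /= ?z0.
move=> [/= uT]; rewrite in_itv /= andbT => z0.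
exists (Num.bound z) => //; split => //=; rewrite in_itv /= z0 ltW//.
by have := archi_boundP z0.
Qed.

Lemma nd_window : nondecreasing_seq (fun n => window T n%:R).
Proof.
move=> m n mn; apply/subsetPset => -[u z] [/= uT zm]; split => //=; move: zm.
rewrite /= !in_itv /= => /andP[-> /le_trans]; apply.
by rewrite ler_nat.
Qed.

Lemma window_cvg (m : {measure set (plane R) -> \bar R}) E : measurable E ->
  m (E `&` window T n%:R) @[n --> \oo] --> m (E `&` strip).
Proof.
move=> mE; rewrite -bigcup_window setI_bigcupr.
have mW n : measurable (E `&` window T n%:R).
  by apply: measurableI => //; exact: measurable_window.
apply: nondecreasing_cvg_mu => //; first exact: bigcupT_measurable.
by move=> i j ij; apply/subsetPset; apply: setIS; apply/subsetPset/nd_window.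
Qed.

Lemma measurable_strip : measurable strip.
Proof. exact: measurableX. Qed.

Lemma window_le (m : {measure set (plane R) -> \bar R}) (n : nat) E : measurable E ->
  m (E `&` window T n%:R) <= m (E `&` strip).
Proof.
move=> mE; apply: le_measure; rewrite ?inE.
- by apply: measurableI => //; exact: measurable_window.
- by apply: measurableI => //; exact: measurable_strip.
- by apply: setIS; rewrite -bigcup_window => x Wx; exists n.
Qed.

(** The Hawkes equation integrates over a closed time interval while the strip is left-open; the
    vertical line of time 0 accounts for the difference. *)
Lemma pi_time0_ae : {ae P, forall w, pi w ([set 0%R] `*` `[0%R, +oo[) = 0}.
Proof.
pose Z : set (plane R) := [set 0%R] `*` `[0%R, +oo[.
have mZ : measurable Z by apply: measurableX => //; exact: measurable_set1.
have IZ : intensity_measure R Z = 0.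
  rewrite intensity_sub; last first.
    by move=> [u z] [/= -> z0]; split => //=; rewrite in_itv /= lexx.
  have m0 : measurable ([set 0%R] : set (measurableTypeR R)) by exact: measurable_set1.
  rewrite [LHS]product_measure1E//.
  rewrite -[RHS](mul0e (@lebesgue_measure R `[0%R, +oo[)); congr (_ * _).
  exact: lebesgue_measure_set1.
have mpZ : measurable_fun setT (fun w => pi w Z) by exact: measurable_kernel.
have : \int[P]_w pi w Z = 0%:E.
  apply: poisson_expectation => // n.
  by have := poisson_measure_law pi_poisson mZ; rewrite IZ; apply.
move=> /eqP; rewrite (eq_integral (fun w => `|pi w Z|)); last by move=> w _; rewrite gee0_abs.
move=> /eqP /(ae_eq_integral_abs P measurableT mpZ).
by apply: filterS => w; apply.
Qed.

Variables (B : set (Omega * plane R)) (X : Omega -> R) (l : Omega -> \bar R).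
Hypothesis pB : <<s predictable_rect F >> B.
Hypothesis mX : measurable_fun setT X.
Hypothesis ml : measurable_fun setT l.
Hypothesis lE : forall w, l w = (lebesgue_measure \x lebesgue_measure)%E (xsection B w `&` strip).
Hypothesis XE : {ae P, forall w, (X w)%:E = pi w (xsection B w `&` strip)}.

Let L n := window_lebesgue T (n%:R : R).
Let N n := window_random_measure pi T (n%:R : R).

Let mB : measurable B.
Proof. exact: (predictable_measurable F_filtration). Qed.

Let mBw w : measurable (xsection B w). Proof. exact: measurable_xsection. Qed.

Let mL n : measurable_fun setT (fun w : Omega => L n (xsection B w)).
Proof.
apply: (measurable_fun_xsection_ptfin_kernel (k := fun _ : Omega => L n)) => //.
by move=> _; apply: window_lebesgue_lty; exact: measurableT.
Qed.

Let mN n : measurable_fun setT (fun w : Omega => N n w (xsection B w)).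
Proof.
apply: (measurable_fun_xsection_ptfin_kernel (k := fun w : Omega => N n w)) => //.
  by move=> U mU; exact: measurable_window_random_measure.
by move=> w; exact: window_random_measure_lty.
Qed.

Let L_cvg w : L n (xsection B w) @[n --> \oo] --> l w.
Proof. by rewrite lE; exact: window_cvg. Qed.

Let L_le w n : L n (xsection B w) <= l w.
Proof.
by rewrite lE; exact: (window_le _ n).
Qed.

Let N_eq : {ae P, forall w, forall n, N n w (xsection B w) =
  pi w (xsection B w `&` window T n%:R)}.
Proof.
apply/ae_foralln => n; apply: filterS (pi_window_ae pi_poisson T n%:R) => w h.
by rewrite /N /window_random_measure h.
Qed.

Let N_cvg : {ae P, forall w, N n w (xsection B w) @[n --> \oo] --> (X w)%:E}.
Proof.
apply: filterS2 N_eq XE => w NE ->; under eq_fun do rewrite NE.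
exact: window_cvg.
Qed.

Let l_ge0 w : 0 <= l w. Proof. by rewrite lE. Qed.

Let X_ge0 : {ae P, forall w, 0 <= (X w)%:E}.
Proof. by apply: filterS XE => w ->. Qed.

Let NL_mean n : \int[P]_w N n w (xsection B w) = \int[P]_w L n (xsection B w).
Proof. exact: (predictable_mean F_filtration pi_poisson pi_future). Qed.

(** The truncated means coincide at each height, so Fatou's lemma gives both inequalities: once
    along [N n], which tends to [X], with [L n] below [l], and once along [L n], with [N n] below
    [X]. *)
Lemma strip_mean : \int[P]_w `|X w|%:E = \int[P]_w l w.
Proof.
have mXa : measurable_fun setT (fun w => `|X w|%:E).
  by apply/measurable_EFinP; exact: measurableT_comp.
apply/eqP; rewrite eq_le; apply/andP; split.
  apply: (@fatou_ae _ _ _ _ (fun n w => N n w (xsection B w))) => //.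
  - apply: filterS2 N_cvg X_ge0 => w; rewrite lee_fin => + X0.
    by rewrite ger0_norm.
  - move=> n; rewrite NL_mean; apply: ge0_le_integral => // w _; exact: L_le.
apply: (@fatou_ae _ _ _ _ (fun n w => L n (xsection B w))) => //.
- exact: nearW.
- move=> n; rewrite -NL_mean; apply: ae_ge0_le_integral => //.
  apply: filterS2 N_eq XE => w NE Xw _.
  rewrite NE -abse_EFin Xw gee0_abs//; exact: window_le.
Qed.

(** The bound at height [n] is linear in the mean of [L n], itself below that of [l]. It is thus
    uniform in [n] and passes to the limit. Almost sure finiteness of [l] makes the differences
    converge. *)
Lemma strip_L1_bound (eps : R) : (0 < eps)%R -> \int[P]_w l w < +oo ->
  \int[P]_w `|(X w)%:E - l w| <= eps%:E * \int[P]_w l w + ((4 * eps)^-1)%:E.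
Proof.
move=> e0 loo.
have lfin : {ae P, forall w, l w \is a fin_num}.
  have : P.-integrable setT l.
    by apply/integrableP; split => //; under eq_integral do rewrite gee0_abs//.
  by move=> /(integrable_ae measurableT); apply: filterS => w; apply.
apply: (@fatou_ae _ _ _ _ (fun n w => `|N n w (xsection B w) - L n (xsection B w)|)) => //.
- by move=> n; apply: measurableT_comp => //; exact: emeasurable_funB.
- by apply: measurableT_comp => //; apply: emeasurable_funB => //; exact/measurable_EFinP.
- apply: filterS2 N_cvg lfin => w Nw lw.
  apply: cvg_abse; apply: cvgeB => //.
- move=> n; apply: (le_trans (predictable_L1_bound F_filtration pi_poisson
    pi_adapted pi_future T n%:R pB e0)).
  apply: leeD2r; apply: lee_wpmul2l; first by rewrite lee_fin ltW.
  by apply: ge0_le_integral => // [|w _]; [exact: mL|exact: L_le].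
Qed.

End strip.

(** * Predictability of the intensity *)

Lemma ge0_integral_mrestr d (T : measurableType d) (R : realType)
    (mu : {measure set T -> \bar R}) (D : set T) (mD : measurable D) (g : T -> \bar R) :
  measurable_fun setT g -> (forall x, 0 <= g x) ->
  \int[mrestr mu mD]_x g x = \int[mu]_(x in D) g x.
Proof.
move=> mg g0.
have D0 : mrestr mu mD (~` D) = 0 by rewrite /mrestr setICl measure0.
rewrite (ge0_negligible_integral _ _ _ _ D0)//; last exact: measurableC.
rewrite setTD setCK; apply: eq_measure_integral => A mA AD.
by rewrite /= /mrestr setIidl.
Qed.

Section lebesgue_stieltjes.
Context (R : realType).
Implicit Type f : cumulative R R.

Lemma lebesgue_stieltjes_oc f (a b : R) : (a <= b)%R ->
  lebesgue_stieltjes_measure f `]a, b] = (f b - f a)%:E.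
Proof.
move=> ab; rewrite /lebesgue_stieltjes_measure /= /measure_extension/=.
rewrite measurable_mu_extE//; last exact: is_ocitv.
exact: (wlength_itv_bnd f false false ab).
Qed.

Lemma lebesgue_stieltjes_oo_lty f (a b : R) :
  lebesgue_stieltjes_measure f `]a, b[ < +oo.
Proof.
have [ab|ba] := leP a b; last by rewrite set_itv_ge ?measure0// -leNgt bnd_simp ltW.
apply: (@le_lt_trans _ _ (lebesgue_stieltjes_measure f `]a, b])).
  by apply: le_measure; rewrite ?inE; [exact: measurable_itv|exact: measurable_itv|
    exact: subset_itv_oo_oc].
by rewrite lebesgue_stieltjes_oc// ltry.
Qed.

(** By continuity of the measure from below, along intervals ending at [s - 1/(n+1)]. The rational
    time [q] reduces a statement about the left limit at [s] to countably many conditions on the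
    strict past. *)
Lemma lebesgue_stieltjes_oo_gt f (a s c : R) : (a < s)%R ->
  c%:E < lebesgue_stieltjes_measure f `]a, s[ ->
  exists q : rat, [/\ (a < ratr q)%R, (ratr q < s)%R & (c < f (ratr q) - f a)%R].
Proof.
move=> a_s cm.
pose E (n : nat) : set (measurableTypeR R) := `]a, (s - n.+1%:R^-1)%R]%classic.
have mE n : measurable (E n) by exact: measurable_itv.
have EU : \bigcup_n E n = `]a, s[%classic.
  apply/seteqP; split => x.
    move=> [n _]; rewrite /E /= !in_itv /= => /andP[-> /le_lt_trans]; apply.
    by rewrite ltrBlDr ltrDl invr_gt0.
  rewrite /= in_itv /= => /andP[ax xs].
  have sx0 : (0 < s - x)%R by rewrite subr_gt0.
  have [n nP] := ltr_add_invr sx0.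
  by exists n => //; rewrite /E /= in_itv /= ax; move: nP; rewrite add0r => /ltW nP; rewrite lerBrDl -lerBrDr.
have ndE : nondecreasing_seq E.
  move=> m n mn; apply/subsetPset => x; rewrite /E /= !in_itv /= => /andP[-> /le_trans].
  by apply; rewrite lerB// lef_pV2 ?posrE// ler_nat.
have mEU : measurable (\bigcup_n E n) by exact: bigcupT_measurable.
have := nondecreasing_cvg_mu (mu := lebesgue_stieltjes_measure f) mE mEU ndE.
rewrite EU => cvgE.
have [n cn] : exists n, c%:E < lebesgue_stieltjes_measure f (E n).
  apply: contrapT => /forallNP h; move: cm; apply/negP; rewrite -leNgt.
  rewrite -(cvg_lim _ cvgE)//; apply: lime_le; first by apply/cvg_ex; eexists; exact: cvgE.
  apply: nearW => n; rewrite leNgt; apply/negP; exact: h.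
have maxs : (Num.max a (s - n.+1%:R^-1) < s)%R.
  by rewrite gt_max a_s ltrBlDr ltrDl invr_gt0 /=.
have [q] := rat_in_itvoo maxs.
rewrite in_itv /= gt_max => /andP[/andP[aq nq] qs].
exists q; split => //; rewrite -lte_fin -lebesgue_stieltjes_oc ?ltW//.
apply: (lt_le_trans cn); apply: le_measure; rewrite ?inE.
- exact: mE.
- exact: measurable_itv.
- by move=> x; rewrite /E /= !in_itv /= => /andP[-> /le_trans]; apply; exact: ltW.
Qed.

End lebesgue_stieltjes.

Section predictable_process.
Context (disp : measure_display) (Omega : measurableType disp) (R : realType).
Variable F : R -> set_system Omega.
Hypothesis F_filtration : filtration F.

Definition predictable_gen : set_system (Omega * R) :=
  [set B | exists A s, [/\ (0 <= s)%R, F s A & B = A `*` `]s, +oo[] ].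

Local Notation Pred := (g_sigma_algebraType predictable_gen).

Local Notation PredR := (g_sigma_algebraType (predictable_rect F)).

Let Fs_setT s : (0 <= s)%R -> F s setT.
Proof.
move=> s0; have [F0 FC _] := filtration_sigma F_filtration s0.
by rewrite -(setD0 setT); exact: FC.
Qed.

Let measurable_rect A s c : (0 <= s)%R -> F s A ->
  measurable (A `*` (`]s, +oo[ `*` `]-oo, c]) : set PredR).
Proof. by move=> s0 FA; apply: sub_sigma_algebra; right; exists A, s, c. Qed.

Let bigcup_rect A s : A `*` (`]s, +oo[ `*` [set: R]) =
  \bigcup_n (A `*` (`]s, +oo[ `*` `]-oo, n%:R]) : set PredR).
Proof.
apply/seteqP; split => -[w [u z]] /=; last by move=> [n _ [/= ? []]].
move=> [Aw [su _]]; exists (Num.truncn z).+1 => //; split => //; split => //=.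
by rewrite in_itv /= ltW// truncnS_gt.
Qed.

Let measurable_pred_proj :
  measurable_fun [set: PredR] (fun x : PredR => (x.1, x.2.1) : g_sigma_algebraType predictable_gen).
Proof.
apply: (@measurability _ _ PredR (g_sigma_algebraType predictable_gen) _ _ predictable_gen) => //.
move=> _ [_ [A [s [s0 FA ->]]] <-]; rewrite setTI.
rewrite (_ : _ @^-1` _ = A `*` (`]s, +oo[ `*` [set: R])).
  by rewrite bigcup_rect; apply: bigcupT_measurable => n; exact: measurable_rect.
by apply/seteqP; split => -[w [u z]] //= [? []].
Qed.

(** A mark exceeds the intensity exactly when a rational lies strictly between them, so the
    complement is a countable union of sets in which time and mark conditions are separated. *)
Lemma predictable_undergraph (lam : Omega * R -> \bar R) :
  measurable_fun [set: g_sigma_algebraType predictable_gen] lam ->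
  (forall z, 0 <= lam z) ->
  <<s predictable_rect F >>
    [set x : Omega * plane R | (0 < x.2.1)%R /\ x.2.2%:E <= lam (x.1, x.2.1)].
Proof.
move=> mlam lam0.
pose U : set PredR := [set x | (0 < x.2.1)%R].
have UE : U = setT `*` (`]0%R, +oo[ `*` [set: R]).
  apply/seteqP; split => -[w [u z]]; rewrite /U /=.
    by move=> u0; split => //; split => //=; rewrite in_itv /= u0.
  by move=> [_ [/=]]; rewrite in_itv /= andbT.
have mU : measurable U.
  rewrite UE bigcup_rect; apply: bigcupT_measurable => n.
  by apply: measurable_rect => //; exact: Fs_setT.
pose Lq (q : rat) : set PredR := [set x | lam (x.1, x.2.1) < (ratr q)%:E].
have mLq q : measurable (Lq q).
  have := measurableT_comp mlam measurable_pred_proj.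
  move=> /(_ measurableT `]-oo, (ratr q)%:E[%classic (emeasurable_itv _)).
  rewrite setTI (_ : _ @^-1` _ = Lq q)//.
pose Zq (q : rat) : set PredR := [set x | (0 < x.2.1)%R /\ (x.2.2 <= ratr q)%R].
have mZq q : measurable (Zq q).
  rewrite (_ : Zq q = setT `*` (`]0%R, +oo[ `*` `]-oo, ratr q])).
    by apply: measurable_rect => //; exact: Fs_setT.
  apply/seteqP; split => -[w [u z]]; rewrite /Zq /= !in_itv /= andbT; first by move=> [].
  by move=> [_ []].
suff -> : [set x : Omega * plane R | (0 < x.2.1)%R /\ x.2.2%:E <= lam (x.1, x.2.1)] =
    U `\` \bigcup_q (Lq q `&` (U `\` Zq q)).
  have : measurable (U `\` \bigcup_q (Lq q `&` (U `\` Zq q))).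
    apply: measurableD => //; apply: bigcupT_measurable_rat => q.
    by apply: measurableI => //; exact: measurableD.
  exact.
apply/seteqP; split => -[w [u z]] /=.
  move=> [u0 zl]; split => //= -[q _ [Lqx [_ nZ]]]; apply: nZ; split => //=.
  by rewrite -lee_fin ltW// (le_lt_trans zl).
move=> [u0 nU]; split => //; rewrite leNgt; apply/negP => lz.
have lfin : lam (w, u) \is a fin_num.
  by rewrite ge0_fin_numE//; apply: lt_trans lz (ltry _).
move: lz; rewrite -(fineK lfin) lte_fin => /rat_in_itvoo [q].
rewrite in_itv /= => /andP[lq qz]; apply: nU; exists q => //; split.
  by rewrite /Lq /= -(fineK lfin) lte_fin.
by split => //= -[_]; rewrite leNgt qz.
Qed.

Variable f : Omega -> cumulative R R.
Hypothesis f_adapted : adapted F (fun s w => f w s).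

Lemma measurable_predictable_gen A s : (0 <= s)%R -> F s A ->
  measurable (A `*` `]s, +oo[ : set Pred).
Proof. by move=> s0 FA; apply: sub_sigma_algebra; exists A, s. Qed.

(** The mass exceeds [c >= 0] at time [s] if and only if the increment of the path up to some
    rational [q < s] does; this increment is known at time [q], which gives a generator opening
    after [q]. *)
Lemma measurable_stieltjes_oo a : (0 <= a)%R ->
  measurable_fun [set: Pred] (fun z => lebesgue_stieltjes_measure (f z.1) `]a, z.2[).
Proof.
move=> a0; apply: (measurability _ (ErealGenOInfty.measurableE R)).
move=> _ [_ [c ->] <-]; rewrite setTI.
have [c0|c0] := ltP c 0%R.
  rewrite (_ : _ @^-1` _ = setT); first exact: measurableT.
  apply/seteqP; split => // z _; rewrite /= in_itv /= andbT.
  by apply: lt_le_trans (measure_ge0 _ _); rewrite lte_fin.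
rewrite (_ : _ @^-1` _ = \bigcup_(q in [set: rat]) (if (a < ratr q)%R then
    [set w | (c < f w (ratr q) - f w a)%R] `*` `]ratr q, +oo[ else set0)).
  apply: bigcupT_measurable_rat => q; case: ifPn => aq; last exact: measurable0.
  have q0 : (0 <= ratr q :> R)%R by rewrite (le_trans a0)// ltW.
  apply: measurable_predictable_gen => //.
  have fE : <<s F (ratr q) >> = F (ratr q).
    exact/sigma_algebra_id/(filtration_sigma F_filtration).
  have mf b : (0 <= b)%R -> (b <= ratr q)%R ->
      measurable_fun [set: g_sigma_algebraType (F (ratr q))] (fun w => f w b).
    move=> b0 bq _ C mC; rewrite setTI /measurable /= fE.
    by apply: (filtration_mono F_filtration b0 bq); exact: (f_adapted b0).
  have := @measurable_funB _ (g_sigma_algebraType (F (ratr q))) R setT _ _ (mf _ q0 (lexx _)) (mf a a0 (ltW aq)).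
  move=> /(_ measurableT `]c, +oo[%classic (measurable_itv _)).
  rewrite setTI /measurable /= fE (_ : _ @^-1` _ = [set w | (c < f w (ratr q) - f w a)%R])//.
  by apply/seteqP; split => w /=; rewrite in_itv /= andbT.
apply/seteqP; split => -[w s] /=; rewrite in_itv /= andbT.
  move=> cm; have [as_|sa] := ltP a s; last first.
    by move: cm; rewrite set_itv_ge ?bnd_simp -?leNgt// measure0 lte_fin ltNge c0.
  have [q [aq qs cq]] := lebesgue_stieltjes_oo_gt as_ cm.
  by exists q => //; rewrite aq; split => //=; rewrite in_itv /= qs.
move=> [q _]; case: ifPn => // aq [/= cq]; rewrite in_itv /= andbT => qs.
rewrite -lte_fin -lebesgue_stieltjes_oc ?ltW// in cq.
apply: (lt_le_trans cq); apply: le_measure; rewrite ?inE; [exact: measurable_itv|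
  exact: measurable_itv|].
move=> x; rewrite /= !in_itv /= => /andP[-> /le_lt_trans]; exact.
Qed.

Definition stieltjes_past (z : Omega * R) : {measure set (measurableTypeR R) -> \bar R} :=
  mrestr (lebesgue_stieltjes_measure (f z.1)) (measurable_itv `]0%R, z.2[).

Lemma stieltjes_past_lty z : stieltjes_past z setT < +oo.
Proof. by rewrite /stieltjes_past /= /mrestr setTI lebesgue_stieltjes_oo_lty. Qed.

Lemma measurable_stieltjes_past U : measurable U ->
  measurable_fun [set: Pred] (fun z => stieltjes_past z U).
Proof.
move=> mU.
have GU : <<s @RGenOInfty.G R >> U.
  rewrite -[<<s _ >>]/((@RGenOInfty.G R).-sigma.-measurable).
  by rewrite -RGenOInfty.measurableE.
have mpast V : measurable V -> stieltjes_past^~ V = fun z => stieltjes_past z V by [].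
have main V : stieltjes_past ^~ `]V, +oo[%classic =
    (fun z => lebesgue_stieltjes_measure (f z.1) `]Num.max V 0%R, z.2[).
  apply/funext => z; rewrite /stieltjes_past /= /mrestr; congr (lebesgue_stieltjes_measure _ _).
  by apply/seteqP; split => x /=; rewrite !in_itv /= andbT gt_max; [move=> [-> /andP[-> ->]]|
    move=> /andP[/andP[-> ->] ->]].
apply: (@dynkin_induction _ (measurableTypeR R) (@RGenOInfty.G R)
    (fun U => measurable_fun [set: Pred] (fun z => stieltjes_past z U))) => //.
- exact: RGenOInfty.measurableE.
- move=> _ _ [x ->] [y ->]; exists (Num.max x y).
  by apply/seteqP; split => z /=; rewrite !in_itv /= !andbT gt_max => /andP.
- rewrite (_ : (fun z => _) = (fun z => lebesgue_stieltjes_measure (f z.1) `]0%R, z.2[)).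
    exact: measurable_stieltjes_oo.
  by apply/funext => z; rewrite /stieltjes_past /= /mrestr setTI.
- move=> _ [x ->]; rewrite main; apply: measurable_stieltjes_oo.
  by rewrite le_max lexx orbT.
- move=> V mV mfV.
  rewrite (_ : (fun z => _) = (fun z => stieltjes_past z setT - stieltjes_past z V)).
    apply: emeasurable_funB => //.
    rewrite (_ : (fun z => _) = (fun z => lebesgue_stieltjes_measure (f z.1) `]0%R, z.2[)).
      exact: measurable_stieltjes_oo.
    by apply/funext => z; rewrite /stieltjes_past /= /mrestr setTI.
  apply/funext => z; rewrite -(setvU V) measureU//; [|exact: measurableC|exact: setICl].
  rewrite addeK// ge0_fin_numE//; apply: le_lt_trans (stieltjes_past_lty z).
  by apply: le_measure; rewrite ?inE//; exact: measurableT.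
- move=> G mG tG mfG.
  rewrite (_ : (fun z => _) = (fun z => \sum_(n <oo) stieltjes_past z (G n))).
    by apply: ge0_emeasurable_sum.
  apply/funext => z; rewrite measure_semi_bigcup//; exact: bigcup_measurable.
Qed.

Variable phi : R -> R.
Hypothesis phi_meas : measurable_fun (`[0%R, +oo[%classic : set R) phi.
Hypothesis phi_ge0 : forall t : R, (0 <= t)%R -> (0 <= phi t)%R.

Let phi' := phi \_ `[0%R, +oo[.

Lemma patch_phi_ge0 t : (0 <= phi' t)%R.
Proof.
rewrite /phi' patchE; case: ifPn => // /set_mem /=.
by rewrite in_itv /= andbT; exact: phi_ge0.
Qed.

Lemma patch_phiE t : (0 <= t)%R -> phi' t = phi t.
Proof. by move=> t0; rewrite /phi' patchT// inE /= in_itv /= t0. Qed.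

Lemma measurable_patch_phi : measurable_fun setT phi'.
Proof. by apply/(measurable_restrictT _ _).1. Qed.

(** The generators do not separate the times up to 0, so that only the positive part of time is
    predictable. *)
Lemma measurable_predictable_pos :
  measurable_fun [set: Pred] (fun z : Pred => Num.max z.2 0%R : R).
Proof.
apply: (measurability _ (RGenOInfty.measurableE R)).
move=> _ [_ [c ->] <-]; rewrite setTI.
have [c0|c0] := ltP c 0%R.
  rewrite (_ : _ @^-1` _ = setT); first exact: measurableT.
  apply/seteqP; split => // z _; rewrite /= in_itv /= andbT.
  by rewrite lt_max c0 orbT.
have FT : F c setT.
  have [F0 FC _] := filtration_sigma F_filtration c0.
  by rewrite -(setD0 setT); exact: FC.
rewrite (_ : _ @^-1` _ = setT `*` `]c, +oo[); first exact: measurable_predictable_gen.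
apply/seteqP; split => -[w s] /=; rewrite !in_itv /= !andbT lt_max; last by move=> [_ ->].
by move=> /orP[//|]; rewrite ltNge c0.
Qed.

Lemma measurable_convolution_past :
  measurable_fun [set: Pred] (fun z : Pred =>
    \int[lebesgue_stieltjes_measure (f z.1)]_(u in `]0%R, z.2[) (phi (z.2 - u)%R)%:E).
Proof.
pose g (x : Pred * measurableTypeR R) : \bar R := (phi' (Num.max x.1.2 0 - x.2)%R)%:E.
have mg : measurable_fun setT g.
  apply/measurable_EFinP; apply: (measurableT_comp measurable_patch_phi).
  apply: measurable_funB; last exact: measurable_snd.
  exact: (measurableT_comp measurable_predictable_pos measurable_fst).
have g0 x : 0 <= g x by rewrite lee_fin patch_phi_ge0.
have := measurable_fun_integral_ptfin_kernel measurable_stieltjes_past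
  stieltjes_past_lty g0 mg.
apply: eq_measurable_fun => z _; rewrite ge0_integral_mrestr//; last first.
  exact: (measurableT_comp mg).
apply: eq_integral => u; rewrite inE /= in_itv /= => /andP[u0 uz].
by rewrite /g /= max_l ?patch_phiE// ?subr_ge0 ?ltW// (lt_trans u0).
Qed.

End predictable_process.

(** * The integrated intensity as a convolution in time *)

Section compensator.
Context (R : realType) (f : cumulative R R) (phi : R -> R) (t : R).
Hypothesis phi_meas : measurable_fun (`[0%R, +oo[%classic : set R) phi.
Hypothesis phi_ge0 : forall t : R, (0 <= t)%R -> (0 <= phi t)%R.

Let phi' := phi \_ `[0%R, +oo[.
Let phi'0 r : (0 <= phi' r)%R. Proof. exact: patch_phi_ge0. Qed.
Let phi'E r : (0 <= r)%R -> phi' r = phi r. Proof. exact: patch_phiE. Qed.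
Let mphi' : measurable_fun setT phi'. Proof. exact: measurable_patch_phi. Qed.

(** The first coordinate is the current time, the second the time of an earlier jump. *)
Let D : set (plane R) := [set x | [/\ (0 < x.2)%R, (x.2 < x.1)%R & (x.1 <= t)%R] ].

Let mD : measurable D.
Proof.
rewrite (_ : D = (snd @^-1` `]0%R, +oo[) `&` (fst @^-1` `]-oo, t]) `&`
    ((fun x : plane R => x.1 - x.2)%R @^-1` `]0%R, +oo[)); last first.
  apply/seteqP; split => x; rewrite /D /= !in_itv /= !andbT subr_gt0.
    by move=> [? ? ?].
  by move=> [[? ?] ?].
apply: measurableI; first apply: measurableI.
- by rewrite -[X in measurable X]setTI; exact: (measurable_snd measurableT).
- by rewrite -[X in measurable X]setTI; exact: (measurable_fst measurableT).
- rewrite -[X in measurable X]setTI.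
  have := @measurable_funB _ (plane R) R setT fst snd measurable_fst measurable_snd.
  by move=> /(_ measurableT `]0%R, +oo[%classic (measurable_itv _)).
Qed.

Let h (x : plane R) : \bar R := (phi' (x.1 - x.2) * \1_D x)%:E.

Let h0 x : 0 <= h x. Proof. by rewrite lee_fin mulr_ge0. Qed.

Let mh : measurable_fun setT h.
Proof.
apply/measurable_EFinP; apply: measurable_funM; last exact: measurable_indic.
by apply: (measurableT_comp mphi'); apply: measurable_funB;
  [exact: measurable_fst|exact: measurable_snd].
Qed.

(** Tonelli's theorem, the substitution [s = r + u] for fixed [u], and Tonelli's theorem again. The
    Stieltjes measure disappears in favour of values of the path at deterministic times, whose
    expectations are under control. *)
Lemma integral_convolution_past :
  \int[lebesgue_measure]_(s in `]0%R, t])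
    \int[lebesgue_stieltjes_measure f]_(u in `]0%R, s[) (phi (s - u)%R)%:E =
  \int[lebesgue_measure]_(r in `]0%R, t]) (phi r * (f (t - r) - f 0))%:E.
Proof.
transitivity (\int[lebesgue_measure]_s \int[lebesgue_stieltjes_measure f]_u h (s, u)).
  rewrite integral_mkcond; apply: eq_integral => s _; rewrite patchE.
  case: ifPn => [|/negP sN]; last first.
    rewrite integral0_eq// => u _; rewrite /h indicE memNset ?mulr0//= => -[/= u0 us st].
    by apply: sN; rewrite inE /= in_itv /= st (lt_trans u0).
  rewrite inE /= in_itv /= => /andP[s0 st].
  rewrite integral_mkcond; apply: eq_integral => u _; rewrite patchE /h indicE /=.
  have -> : ((s, u) \in D) = (u \in `]0%R, s[%classic).
    apply/idP/idP; rewrite !inE /= in_itv /=; first by move=> [/= -> ->].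
    by move=> /andP[].
  case: ifPn => [|_]; last by rewrite mulr0.
  by rewrite inE /= in_itv /= => /andP[_ us]; rewrite mulr1 phi'E// subr_ge0 ltW.
rewrite (fubini_tonelli h mh h0).
transitivity (\int[lebesgue_stieltjes_measure f]_u \int[lebesgue_measure]_r h ((r + u)%R, u)).
  apply: eq_integral => u _; apply/esym.
  apply: (ge0_integral_lebesgue_translation u (g := fun s => h (s, u))) => //.
  exact: (measurableT_comp mh (measurable_pair2 u)).
pose k (x : plane R) := h ((x.1 + x.2)%R, x.2).
have mk : measurable_fun setT k.
  apply: (measurableT_comp mh); apply: measurable_fun_pair; last exact: measurable_snd.
  by apply: measurable_funD; [exact: measurable_fst|exact: measurable_snd].
rewrite -(fubini_tonelli k mk (fun=> h0 _)).
rewrite [RHS]integral_mkcond; apply: eq_integral => r _; rewrite patchE /k /=.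
have hE u : h ((r + u)%R, u) = (phi' r)%:E * (\1_[set u | (0 < u)%R /\ (0 < r)%R /\ (r + u <= t)%R] u)%:E.
  rewrite /h /= addrK EFinM; congr (_ * _%:E); rewrite !indicE.
  congr ((nat_of_bool _)%:R).
  apply/idP/idP; rewrite !inE /D /=; first by move=> [? + ?]; rewrite ltrDr.
  by move=> [? [? ?]]; split => //; rewrite ltrDr.
under eq_integral do rewrite hE.
case: ifPn => [|/negP rN]; last first.
  rewrite integral0_eq// => u _; rewrite indicE memNset ?mule0//= => -[u0 [r0 rt]].
  apply: rN; rewrite inE /= in_itv /= r0 /=; apply: le_trans rt.
  by rewrite lerDl ltW.
rewrite inE /= in_itv /= => /andP[r0 rt].
have -> : [set u | (0 < u)%R /\ (0 < r)%R /\ (r + u <= t)%R] = `]0%R, (t - r)%R]%classic.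
  apply/seteqP; split => u /=; rewrite in_itv /= lerBrDl.
    by move=> [-> [_ ->]].
  by move=> /andP[].
rewrite ge0_integralZl//; last 2 first.
- by apply/measurable_EFinP; apply: measurable_indic; exact: measurable_itv.
- by rewrite lee_fin.
rewrite integral_indic ?setIT//; try exact: measurable_itv.
rewrite EFinM phi'E; last exact: ltW.
by congr (_ * _); apply: lebesgue_stieltjes_oc; rewrite subr_ge0.
Qed.

End compensator.

Section joint_measurability.
Context (disp : measure_display) (Omega : measurableType disp) (R : realType).
Variable f : Omega -> cumulative R R.
Hypothesis mf : forall t, (0 <= t)%R -> measurable_fun setT (fun w => f w t).

(** By right continuity and monotonicity, the path is below [c] at a time if and only if it is below
    [c] at some later rational time; that time can be taken positive, where [mf] applies. *)
Lemma measurable_cumulative_pos :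
  measurable_fun setT (fun x : Omega * measurableTypeR R => f x.1 (Num.max x.2 0%R)).
Proof.
apply: (measurability _ (RGenInftyO.measurableE R)).
move=> _ [_ [c ->] <-]; rewrite setTI.
rewrite (_ : _ @^-1` _ = \bigcup_(q in [set: rat]) (if (0 < ratr q :> R)%R then
   [set w | (f w (ratr q) < c)%R] `*` `]-oo, ratr q[ else set0)).
  apply: bigcupT_measurable_rat => q; case: ifPn => q0; last exact: measurable0.
  apply: measurableX; last exact: measurable_itv.
  have := mf (ltW q0) measurableT (measurable_itv `]-oo, c[).
  by rewrite setTI; congr measurable; apply/seteqP; split => w /=; rewrite in_itv.
apply/seteqP; split => -[w s] /=; rewrite in_itv /=.
  rewrite -subr_gt0 => /divr_gt0 /(_ (ltr0n R 2)) => fc.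
  have [e fe] := nondecreasing_right_continuousP (Num.max s 0%R) (f w) fc.
  have : (Num.max s 0 < Num.max s 0 + e%:num)%R by rewrite ltrDl.
  move=> /rat_in_itvoo[q]; rewrite in_itv /= gt_max => /andP[/andP[sq q0] qe].
  exists q => //; rewrite q0; split => /=; last by rewrite in_itv.
  have fqe := cumulative_is_nondecreasing (f w) _ _ (ltW qe).
  by have := le_trans fqe fe; rewrite /=; lra.
move=> [q _]; case: ifPn => // q0 [/= fq]; rewrite in_itv /= => sq.
apply: le_lt_trans fq; apply: cumulative_is_nondecreasing.
by rewrite ge_max !ltW.
Qed.

End joint_measurability.

(** * The lattice and the resolvent *)

Section esum_extra.
Context (R : realType).

Lemma esumZl (T : choiceType) (c : R) (a : T -> \bar R) :
  (0 <= c)%R -> (forall i, 0 <= a i) ->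
  \esum_(i in setT) (c%:E * a i) = c%:E * \esum_(i in setT) a i.
Proof.
have half_ (b : R) (g : T -> \bar R) : (0 <= b)%R -> (forall i, 0 <= g i) ->
    \esum_(i in setT) (b%:E * g i) <= b%:E * \esum_(i in setT) g i.
  move=> b0 g0; apply: ge_ereal_sup => _ [X [fX _] <-].
  rewrite -ge0_mule_fsumr//; apply: lee_wpmul2l; first by rewrite lee_fin.
  by apply: ereal_sup_ubound; exists X.
move=> c0 a0; apply/eqP; rewrite eq_le half_//=.
have [->|cn0] := eqVneq c 0%R; first by rewrite mul0e esum_ge0// => i _; rewrite mul0e.
have c_gt0 : (0 < c)%R by rewrite lt_neqAle eq_sym cn0.
have aE : a = (fun i => (c^-1)%:E * (c%:E * a i)).
  by apply/funext => i; rewrite muleA -EFinM mulVf// mul1e.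
rewrite [in leLHS]aE.
have := @half_ c^-1%R (fun i => c%:E * a i).
rewrite invr_ge0 => /(_ c0 (fun i => mule_ge0 _ (a0 i))).
move=> h; rewrite -(@lee_pmul2l _ (c^-1)%:E) ?lte_fin ?invr_gt0//.
by rewrite muleA -EFinM mulVf// mul1e h// lee_fin.
Qed.

Lemma esum_swap (T U : choiceType) (a : T -> U -> \bar R) :
  (forall i j, 0 <= a i j) ->
  \esum_(i in setT) \esum_(j in setT) a i j = \esum_(j in setT) \esum_(i in setT) a i j.
Proof.
move=> a0; rewrite esum_esum// [RHS]esum_esum//.
rewrite (@reindex_esum _ _ _ ([set: U] `*`` fun=> [set: T]) _ (fun x => (x.2, x.1)))//.
split => //; first by move=> [x y] [x' y'] _ _ /= [-> ->].
by move=> [x y] _; exists (y, x).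
Qed.

End esum_extra.

Section lattice.
Context (R : realType) (d : nat).
Implicit Types i j : Zlattice d.

Let step (kb : 'I_d * bool) : Zlattice d :=
  (if kb.2 then delta_mx 0 kb.1 else - delta_mx 0 kb.1)%R.

Let candidates i : seq (Zlattice d) := i :: [seq i + step kb | kb <- enum {: 'I_d * bool}]%R.

Let normsq (v : Zlattice d) : int := (\sum_(k < d) (v 0 k) ^+ 2)%R.

Let enormE (v : Zlattice d) : enorm R v = Num.sqrt (normsq v)%:~R.
Proof.
rewrite /enorm /normsq rmorph_sum /=; congr Num.sqrt.
by apply: eq_bigr => k _; rewrite rmorphXn.
Qed.

Let normsq_ge0 v : (0 <= normsq v)%R.
Proof. by apply: sumr_ge0 => k _; exact: sqr_ge0. Qed.

Lemma enormN (v : Zlattice d) : enorm R (- v)%R = enorm R v.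
Proof.
by rewrite /enorm; congr Num.sqrt; apply: eq_bigr => k _; rewrite !mxE rmorphN sqrrN.
Qed.

Lemma edges_sym i j : edges R d (i, j) <-> edges R d (j, i).
Proof. by rewrite /edges /= -opprB enormN. Qed.

Let normsq0 v : normsq v = 0%R -> v = 0%R.
Proof.
move=> /eqP; rewrite psumr_eq0 => [|k _]; last exact: sqr_ge0.
move=> /allP v0; apply/rowP => k; rewrite !mxE.
by have := v0 k (mem_index_enum _); rewrite /= sqrf_eq0 => /eqP.
Qed.

Let normsq1 v : normsq v = 1%R -> exists kb, v = step kb.
Proof.
move=> v1.
have [k vk] : exists k, (v 0 k != 0)%R.
  apply: contrapT => /forallNP h; move: v1; rewrite /normsq big1// => k _.
  by have /negP := h k; rewrite negbK => /eqP ->; rewrite expr0n.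
move: (v1); rewrite /normsq (bigD1 k)//= => sum1.
have rest_ge0 : (0 <= \sum_(i < d | i != k) v 0 i ^+ 2)%R.
  by apply: sumr_ge0 => l _; exact: sqr_ge0.
have vk1 : (1 <= v 0 k ^+ 2)%R.
  by rewrite -[X in (X <= _)%R]add0r lezD1 lt_neqAle sqr_ge0 eq_sym sqrf_eq0 vk.
have [vk_eq rest0] : (v 0 k ^+ 2 = 1)%R /\ (\sum_(i < d | i != k) v 0 i ^+ 2 = 0)%R.
  move: vk1 rest_ge0 sum1.
  by move: (v 0 k ^+ 2)%R (\sum_(i < d | i != k) v 0 i ^+ 2)%R => x y; lia.
have others l : l != k -> (v 0 l = 0)%R.
  move=> lk; move/eqP : rest0; rewrite psumr_eq0 => [|m _]; last exact: sqr_ge0.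
  move=> /allP /(_ l (mem_index_enum _)) /implyP /(_ lk).
  by rewrite sqrf_eq0 => /eqP.
have /orP[/eqP vkE|/eqP vkE] : (v 0 k == 1)%R || (v 0 k == -1)%R.
  by rewrite -sqrf_eq1 vk_eq.
- exists (k, true); apply/rowP => l; rewrite /step /= !mxE eqxx /=.
  by have [->|lk] := eqVneq l k; rewrite ?vkE ?eqxx// others.
- exists (k, false); apply/rowP => l; rewrite /step /= !mxE eqxx /=.
  by have [->|lk] := eqVneq l k; rewrite ?vkE ?eqxx// others.
Qed.

Let edges_step i j : edges R d (j, i) -> j = i \/ exists kb, j = (i + step kb)%R.
Proof.
rewrite /edges /= enormE => -[/eqP|/(congr1 (fun x => x ^+ 2)%R)].
  rewrite sqrtr_eq0 => h; left; apply/eqP; rewrite -subr_eq0; apply/eqP.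
  apply: normsq0; apply/eqP; rewrite eq_le normsq_ge0 andbT.
  by rewrite -(ler_int R).
rewrite sqr_sqrtr ?ler0z ?normsq_ge0// expr1n => h; right.
have [kb jE] : exists kb, (j - i)%R = step kb.
  by apply: normsq1; apply/eqP; rewrite -(eqr_int R) h.
by exists kb; rewrite -jE addrC subrK.
Qed.

(** The list filters [i] and its translates by signed unit vectors, which contain every neighbour:
    an integer vector of squared norm 0 or 1 is zero or such a unit vector. Infinite sums over edges
    thus become finite ones. *)
Definition neighbours i : seq (Zlattice d) :=
  [seq j <- undup (candidates i) | `[< edges R d (j, i) >] ].

Lemma mem_neighbours i j : (j \in neighbours i) = `[< edges R d (j, i) >].
Proof.
rewrite mem_filter andb_idr// => /asboolP/edges_step[->|[kb ->]].
  by rewrite mem_undup inE eqxx.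
rewrite mem_undup inE; apply/orP; right; apply/mapP; exists kb => //.
by rewrite mem_enum.
Qed.

Lemma neighbours_uniq i : uniq (neighbours i).
Proof. by rewrite filter_uniq ?undup_uniq. Qed.

Lemma size_neighbours i : (size (neighbours i) <= 2 * d + 1)%N.
Proof.
rewrite size_filter; apply: (leq_trans (count_size _ _)).
apply: (leq_trans (size_undup _)).
by rewrite /= size_map -cardE card_prod card_ord card_bool mulnC addn1.
Qed.

(** Moving by a signed unit vector changes the squared norm by [2 * s * i_k + 1], and [|i_k|] is at
    most the norm. This makes the weight [2 ^ |i|] at most double from a site to its neighbours. *)
Lemma enorm_neighbour i j : edges R d (j, i) -> (enorm R j <= enorm R i + 1)%R.
Proof.
move=> /edges_step[->|[[k b] ->]]; first by rewrite lerDl.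
pose s : R := if b then 1%R else (-1)%R.
have ss : (s * s = 1)%R by rewrite /s; case: (b); rewrite ?mulr1// mulrNN mulr1.
have sumE : (\sum_(l < d) ((i + step (k, b))%R 0 l)%:~R ^+ 2 =
    \sum_(l < d) (i 0 l)%:~R ^+ 2 + 2 * s * (i 0 k)%:~R + 1 :> R)%R.
  rewrite (bigD1 k)//= [in RHS](bigD1 k)//=.
  rewrite (eq_bigr (fun l => (i 0 l)%:~R ^+ 2)%R); last first.
    move=> l lk; congr (_ ^+ 2)%R; rewrite /step /=.
    by case: (b); rewrite !mxE (negbTE lk) andbF ?oppr0 addr0.
  have -> : (((i + step (k, b))%R 0 k)%:~R = (i 0 k)%:~R + s :> R)%R.
    by rewrite /step /s /=; case: (b); rewrite !mxE !eqxx /= rmorphD/= ?rmorphN.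
  by rewrite sqrrD [(s ^+ 2)%R]expr2 ss; ring.
have ik : (`|(i 0 k)%:~R| <= enorm R i)%R.
  rewrite -sqrtr_sqr /enorm ler_sqrt; last by apply: sumr_ge0 => l _; exact: sqr_ge0.
  by rewrite (bigD1 k)//= lerDl; apply: sumr_ge0 => l _; exact: sqr_ge0.
have e0 : (0 <= enorm R i)%R by exact: sqrtr_ge0.
have eE : (enorm R i ^+ 2 = \sum_(l < d) (i 0 l)%:~R ^+ 2)%R.
  by rewrite sqr_sqrtr//; apply: sumr_ge0 => l _; exact: sqr_ge0.
rewrite -[leRHS]ger0_norm ?addr_ge0// -sqrtr_sqr [leLHS]/enorm ler_sqrt ?sqr_ge0//.
rewrite sumE -eE sqrrD expr1n mulr1 lerD2r lerD2l.
have sik : (s * (i 0 k)%:~R <= `|(i 0 k)%:~R|)%R.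
  by rewrite /s; case: (b); rewrite ?mul1r ?mulN1r ?ler_norm// -normrN ler_norm.
by rewrite -mulrA; have := le_trans sik ik; lra.
Qed.

Lemma esum_neighbours (a : Zlattice d -> \bar R) i : (forall j, 0 <= a j) ->
  \esum_(j in [set j | edges R d (j, i)]) a j = \sum_(j <- neighbours i) a j.
Proof.
move=> a0; have -> : [set j | edges R d (j, i)] = [set` neighbours i].
  by apply/seteqP; split => j /=; rewrite mem_neighbours; [move/asboolP|move/asboolP].
rewrite esum_fset//; last exact: finite_seq.
by rewrite (fsbig_seq _ _ (neighbours_uniq i)).
Qed.

Lemma esum_Amat (a : Zlattice d -> \bar R) i : (forall j, 0 <= a j) ->
  \esum_(j in setT) (Amat R i j * a j) =
  ((2 * d + 1)%:R^-1)%:E * \sum_(j <- neighbours i) a j.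
Proof.
move=> a0; rewrite -esum_neighbours//.
have -> : (fun j => Amat R i j * a j) = (fun j => ((2 * d + 1)%:R^-1)%:E *
    (if j \in [set j | edges R d (j, i)] then a j else 0)).
  apply/funext => j; rewrite /Amat EFinM -muleA indicE; congr (_ * _).
  have -> : ((i, j) \in edges R d) = (j \in [set j | edges R d (j, i)]).
    by apply/idP/idP; rewrite !inE /= => /edges_sym.
  by case: ifPn; rewrite ?mul1e ?mul0e.
rewrite esumZl ?invr_ge0//; last by move=> j; case: ifPn.
by congr (_ * _); rewrite [RHS]esum_mkcond.
Qed.

(** As [c] is nonnegative, an upper bound on the number of neighbours suffices. *)
Lemma neighbours_average_le (a : Zlattice d -> R) i (c : R) : (0 <= c)%R ->
  (forall j, edges R d (j, i) -> a j <= c)%R ->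
  ((2 * d + 1)%:R^-1 * \sum_(j <- neighbours i) a j <= c)%R.
Proof.
move=> c0 ac; rewrite ler_pdivrMl ?ltr0n ?addn1//.
apply: (@le_trans _ _ (\sum_(j <- neighbours i) c)%R).
  rewrite big_seq [leRHS]big_seq; apply: ler_sum => j.
  by rewrite mem_neighbours => /asboolP; exact: ac.
rewrite big_const_seq count_predT iter_addr_0 -[leLHS]mulr_natl ler_wpM2r//.
by rewrite ler_nat; have := size_neighbours i; rewrite [in X in X -> _]addn1.
Qed.

(** * The resolvent as a Neumann series *)

Section resolvent.
Variables (Lam M : R) (mu : Zlattice d -> R).
Hypotheses (Lam0 : (0 <= Lam)%R) (Lam1 : (Lam < 1)%R).
Hypotheses (mu0 : forall i, (0 <= mu i)%R) (muM : forall i, (mu i <= M)%R).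

(** The vector [A ^ n] applied to [mu]; averaging keeps it below [M]. *)
Let v n i := \esum_(j in setT) (Apow R n i j * (mu j)%:E).

Let Amat_ge0 i j : 0 <= Amat R i j.
Proof. by rewrite lee_fin mulr_ge0// invr_ge0. Qed.

Let Apow_ge0 n i j : 0 <= Apow R n i j.
Proof.
elim: n i => [|n IHn] i /=; first by rewrite lee_fin.
by apply: esum_ge0 => k _; rewrite mule_ge0.
Qed.

Let mu_ge0E i : 0 <= (mu i)%:E. Proof. by rewrite lee_fin. Qed.

Let v_ge0 n i : 0 <= v n i.
Proof. by apply: esum_ge0 => j _; exact: mule_ge0. Qed.

Let v0 i : v 0%N i = (mu i)%:E.
Proof.
rewrite /v /= (esumID [set i]); last by move=> j _; rewrite mule_ge0// lee_fin.
rewrite setTI esum_set1 ?mule_ge0 ?lee_fin// /Imat eqxx mul1e.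
rewrite esum1 ?adde0// => j [_ /= ji]; rewrite /Imat.
by case: eqP ji => [->|_ _]; rewrite ?mul0e.
Qed.

Let esumZr (a : Zlattice d -> \bar R) (c : R) : (0 <= c)%R -> (forall j, 0 <= a j) ->
  (\esum_(j in setT) a j) * c%:E = \esum_(j in setT) (a j * c%:E).
Proof.
by move=> c0 a0; rewrite muleC -esumZl//; apply: eq_esum => j _; rewrite muleC.
Qed.

Let vS n i : v n.+1 i = \esum_(k in setT) (Amat R i k * v n k).
Proof.
rewrite /v /=.
transitivity (\esum_(j in setT) \esum_(k in setT) (Amat R i k * Apow R n k j * (mu j)%:E)).
  by apply: eq_esum => j _; rewrite esumZr// => k; exact: mule_ge0.
rewrite esum_swap//; last by move=> j k; rewrite !mule_ge0.
apply: eq_esum => k _; rewrite /Amat -esumZl ?mulr_ge0 ?invr_ge0//.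
- by apply: eq_esum => j _; rewrite muleA.
- by move=> j; exact: mule_ge0.
Qed.

Let M0 : (0 <= M)%R. Proof. exact: le_trans (muM 0%R). Qed.

Let v_le n i : v n i <= M%:E.
Proof.
elim: n i => [|n IHn] i; first by rewrite v0 lee_fin.
rewrite vS esum_Amat//.
have vfin k : v n k = (fine (v n k))%:E.
  by rewrite fineK// ge0_fin_numE// (le_lt_trans (IHn k))// ltry.
under eq_bigr do rewrite vfin.
rewrite sumEFin -EFinM lee_fin; apply: neighbours_average_le => // j _.
by rewrite -lee_fin -vfin.
Qed.

Let q i := \sum_(n <oo) ((Lam ^+ n)%:E * v n i).

Let term_ge0 n i : 0 <= (Lam ^+ n)%:E * v n i.
Proof. by rewrite mule_ge0// lee_fin exprn_ge0. Qed.

Let qE i : \esum_(j in setT) (Qmat Lam i j * (mu j)%:E) = q i.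
Proof.
have tg n j : 0 <= (Lam ^+ n)%:E * Apow R n i j.
  by rewrite mule_ge0// lee_fin exprn_ge0.
transitivity (\esum_(j in setT) \esum_(n in setT) ((Lam ^+ n)%:E * Apow R n i j * (mu j)%:E)).
  apply: eq_esum => j _; rewrite /Qmat nneseries_esumT// muleC -esumZl//.
  by apply: eq_esum => n _; rewrite muleC.
rewrite esum_swap; last by move=> j n; rewrite mule_ge0.
rewrite /q nneseries_esumT//; apply: eq_esum => n _.
rewrite /v -esumZl ?exprn_ge0//; last by move=> j; exact: mule_ge0.
by apply: eq_esum => j _; rewrite muleA.
Qed.

Let q_le i : q i <= (M / (1 - Lam))%:E.
Proof.
apply: lime_le; first exact: is_cvg_nneseries.
apply: nearW => n; apply: (@le_trans _ _ (\sum_(0 <= k < n) (Lam ^+ k * M)%:E)).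
  apply: lee_sum => k _; rewrite EFinM; apply: lee_wpmul2l; last exact: v_le.
  by rewrite lee_fin exprn_ge0.
have L1 : (1 - Lam != 0)%R by rewrite subr_eq0 gt_eqF.
have -> : \sum_(0 <= k < n) (Lam ^+ k * M)%:E =
    (M / (1 - Lam) - Lam ^+ n * (M / (1 - Lam)))%:E.
  elim: n => [|n IHn]; first by rewrite big_geq// expr0 mul1r subrr.
  by rewrite big_nat_recr//= IHn -EFinD; congr EFin; rewrite exprS; field.
by rewrite lee_fin gerBl mulr_ge0 ?exprn_ge0// divr_ge0// subr_ge0 ltW.
Qed.

Let q_rec i : q i = (mu i)%:E + Lam%:E * (((2 * d + 1)%:R^-1)%:E * \sum_(j <- neighbours i) q j).
Proof.
have q0 j : 0 <= q j by apply: nneseries_ge0 => n _.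
rewrite -esum_Amat//.
rewrite {1}/q nneseries_recl// expr0 mul1e v0; congr (_ + _).
rewrite -(@nneseries_addn _ (fun n => (Lam ^+ n)%:E * v n i) 1)//.
transitivity (\sum_(n <oo) Lam%:E * \esum_(k in setT) (Amat R i k * ((Lam ^+ n)%:E * v n k))).
  apply: eq_eseriesr => n _; rewrite addn1 exprS EFinM -muleA vS; congr (_ * _).
  rewrite -esumZl ?exprn_ge0//; last by move=> k; exact: mule_ge0.
  by apply: eq_esum => k _; rewrite muleCA.
rewrite nneseriesZl//; last by move=> n _; apply: esum_ge0 => k _; exact: mule_ge0.
congr (_ * _); rewrite nneseries_esumT; last first.
  by move=> n; apply: esum_ge0 => k _; exact: mule_ge0.
rewrite esum_swap; last by move=> n k; exact: mule_ge0.
apply: eq_esum => k _; rewrite /q nneseries_esumT// /Amat -esumZl//.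
Qed.

(** The series is handled in the extended reals, where sums of nonnegative terms can be exchanged
    freely: splitting off its first term gives the fixed point equation. Comparison with a geometric
    series then makes [q] real-valued. *)
Lemma resolvent_fixpoint : exists q : Zlattice d -> R,
  [/\ forall i, \esum_(j in setT) (Qmat Lam i j * (mu j)%:E) = (q i)%:E,
      forall i, (0 <= q i)%R, forall i, (q i <= M / (1 - Lam))%R &
      forall i, (q i = mu i + Lam * ((2 * d + 1)%:R^-1 * \sum_(j <- neighbours i) q j))%R].
Proof.
have q0 j : 0 <= q j by apply: nneseries_ge0 => n _.
have qfin j : q j = (fine (q j))%:E.
  by rewrite fineK// ge0_fin_numE// (le_lt_trans (q_le j))// ltry.
exists (fun i => fine (q i)); split => i.
- by rewrite qE -qfin.
- exact: fine_ge0.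
- by rewrite -lee_fin -qfin; exact: q_le.
- apply: EFin_inj; rewrite -qfin q_rec.
  under eq_bigr do rewrite qfin.
  by rewrite sumEFin -!EFinM -EFinD.
Qed.

End resolvent.

End lattice.

(** * Convolution with the kernel *)

Section kernel_integrals.
Context (R : realType) (phi : R -> R) (Lam : R).
Hypothesis phi_meas : measurable_fun (`[0%R, +oo[%classic : set R) phi.
Hypothesis phi_ge0 : forall t : R, (0 <= t)%R -> (0 <= phi t)%R.
Hypothesis LamE : \int[lebesgue_measure]_(t in `[0%R, +oo[) (phi t)%:E = Lam%:E.

Local Notation leb := (@lebesgue_measure R).

Let pos : set R := `]0%R, +oo[%classic.

Let mpos : measurable pos. Proof. exact: measurable_itv. Qed.

Let mphi (D : set R) : D `<=` `[0%R, +oo[ -> measurable_fun D phi.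
Proof. by move=> DS; apply: measurable_funS phi_meas. Qed.

Let pos_sub : pos `<=` `[0%R, +oo[.
Proof. by move=> r; rewrite /pos /= !in_itv /= !andbT => /ltW. Qed.

Let itv_sub t : `]0%R, t]%classic `<=` pos.
Proof. by move=> r; rewrite /pos /= !in_itv /= andbT => /andP[]. Qed.

Let mexp (a b : R) : measurable_fun setT (fun r : R => expR (a * r + b)).
Proof.
apply: (measurableT_comp (@measurable_expR R)).
by apply: measurable_funD => //; exact: measurable_funM.
Qed.

Let mexpN (a : R) : measurable_fun setT (fun r : R => expR (- (a * r))).
Proof.
rewrite (_ : (fun r => _) = (fun r : R => expR (- a * r + 0)%R)) //.
by apply/funext => r; rewrite addr0 mulNr.
Qed.

Let phi_pos r : pos r -> (0 <= phi r)%R.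
Proof. by move=> /pos_sub; rewrite /= in_itv /= andbT; exact: phi_ge0. Qed.

Lemma kernel_integral_pos : \int[leb]_(r in `]0%R, +oo[) (phi r)%:E = Lam%:E.
Proof.
rewrite integral_itv_obnd_cbnd//; apply/measurable_EFinP; exact: mphi.
Qed.

Lemma kernel_integral_ge0 : (0 <= Lam)%R.
Proof.
rewrite -lee_fin -kernel_integral_pos; apply: integral_ge0 => r rp.
by rewrite lee_fin; exact: phi_pos.
Qed.

Lemma kernel_tail (eps : R) : (0 < eps)%R ->
  exists n : nat, \int[leb]_(r in `]n%:R, +oo[) (phi r)%:E <= eps%:E.
Proof.
move=> e0; pose E (n : nat) : set R := `]0%R, n%:R]%classic.
have EU : \bigcup_n E n = pos.
  apply/seteqP; split => r; first by move=> [n _]; exact: itv_sub.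
  rewrite /pos /= in_itv /= andbT => r0; exists (Num.truncn r).+1 => //.
  by rewrite /E /= in_itv /= r0 ltW// truncnS_gt.
have ndE : nondecreasing_seq E.
  move=> m n mn; apply/subsetPset => r; rewrite /E /= !in_itv /= => /andP[-> /le_trans].
  by apply; rewrite ler_nat.
have mE n : measurable (E n) by exact: measurable_itv.
have Ep n : E n `<=` pos by exact: itv_sub.
have mEphi n : measurable_fun (E n) (EFin \o phi).
  by apply/measurable_EFinP; apply: mphi; exact: subset_trans (Ep n) pos_sub.
have := ge0_nondecreasing_set_cvg_integral (mu := leb) ndE mE mEphi
  (fun n r rE => phi_pos (Ep n r rE)).
rewrite EU kernel_integral_pos => cvgE.
have [n Hn] : exists n, (Lam - eps)%:E < \int[leb]_(r in E n) (phi r)%:E.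
  apply: contrapT => /forallNP h.
  have : Lam%:E <= (Lam - eps)%:E.
    rewrite -(cvg_lim _ cvgE)//; apply: lime_le; first by apply/cvg_ex; eexists; exact: cvgE.
    by apply: nearW => n; rewrite leNgt; apply/negP; exact: h.
  by rewrite lee_fin; lra.
exists n.
have posE : pos = E n `|` `]n%:R, +oo[.
  apply/seteqP; split => r; rewrite /pos /E /= !in_itv /= !andbT.
    by move=> r0; have [rn|rn] := leP r n%:R; [left; rewrite r0|right].
  by move=> [/andP[]//|]; apply: le_lt_trans.
have tail_fin : \int[leb]_(r in E n) (phi r)%:E + \int[leb]_(r in `]n%:R, +oo[) (phi r)%:E = Lam%:E.
  rewrite -kernel_integral_pos -/pos [in RHS]posE ge0_integral_setU//.
  - exact: measurable_itv.
  - by rewrite -posE; apply/measurable_EFinP; exact: mphi.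
  - by rewrite -posE => r rp; rewrite lee_fin phi_pos.
  - apply/disj_setPS => r [/=]; rewrite !in_itv /= andbT => /andP[_ rn] nr.
    by move: rn; rewrite ?bnd_simp => /le_lt_trans /(_ nr); rewrite ltxx.
have A0 : 0 <= \int[leb]_(r in E n) (phi r)%:E.
  by apply: integral_ge0 => r /Ep rp; rewrite lee_fin phi_pos.
have B0 : 0 <= \int[leb]_(r in `]n%:R, +oo[) (phi r)%:E.
  apply: integral_ge0 => r rn; rewrite lee_fin; apply: phi_pos.
  by rewrite posE; right.
move: tail_fin Hn A0 B0.
case: (\int[leb]_(r in E n) _) => [x| |]; case: (\int[leb]_(r in _) _) => [y| |] //=.
by move=> [xy]; rewrite lte_fin !lee_fin; lra.
Qed.

(** Dominated convergence along [a = n], with [phi] as the dominating function; the exponential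
    tends to 0 at each positive [r]. *)
Lemma kernel_laplace (eps : R) : (0 < eps)%R ->
  exists2 a : R, (0 <= a)%R &
    \int[leb]_(r in `]0%R, +oo[) (phi r * expR (- (a * r)))%:E <= eps%:E.
Proof.
move=> e0.
pose g (n : nat) (r : R) := (phi r * expR (- (n%:R * r)))%:E.
have mg n : measurable_fun pos (g n).
  apply/measurable_EFinP; apply: measurable_funM; first exact: mphi.
  exact: measurable_funTS (mexpN _).
have ig : leb.-integrable pos (EFin \o phi).
  apply/integrableP; split; first by apply/measurable_EFinP; exact: mphi.
  rewrite (_ : \int[_]_(x in _) _ = Lam%:E) ?ltry// -kernel_integral_pos.
  by apply: eq_integral => r /[!inE] rp /=; rewrite ger0_norm// phi_pos.
have g0 : {ae leb, forall r, pos r -> g ^~ r @ \oo --> (cst 0 : R -> \bar R) r}.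
  apply: aeW => r rp.
  have r1 : (`|expR (- r)| < 1)%R.
    rewrite ger0_norm ?expR_ge0// expR_lt1.
    by move: rp; rewrite /pos /= in_itv /= andbT oppr_lt0.
  have c0 : (phi r * expR (- r) ^+ n)%R @[n --> \oo] --> (0 : R)%R.
    by rewrite -(mulr0 (phi r)); apply: cvgM; [exact: cvg_cst|exact: cvg_expr].
  rewrite (_ : g ^~ r = (fun n => (phi r * expR (- r) ^+ n)%:E)).
    by apply: cvg_EFin => //; exact: nearW.
  by apply/funext => n; rewrite /g -mulrN expRM_natl.
have gphi : {ae leb, forall r n, pos r -> `|g n r| <= (EFin \o phi) r}.
  apply: aeW => r n rp; rewrite /g /= lee_fin normrM ger0_norm ?phi_pos//.
  rewrite ger0_norm ?expR_ge0// ler_piMr ?phi_pos// expR_le1 oppr_le0 mulr_ge0//.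
  by move/pos_sub : rp; rewrite /= in_itv /= andbT.
have mc : measurable_fun pos (cst 0 : R -> \bar R) by exact: measurable_cst.
have [_ _] := @dominated_convergence _ _ _ leb pos mpos g _ _ mg mc g0 ig gphi.
rewrite integral0 => cvg0.
have [n Hn] : exists n, \int[leb]_(r in pos) g n r < eps%:E.
  apply: contrapT => /forallNP h.
  have : eps%:E <= 0.
    rewrite -(cvg_lim _ cvg0)//; apply: lime_ge; first by apply/cvg_ex; eexists; exact: cvg0.
    by apply: nearW => n; rewrite leNgt; apply/negP; exact: h.
  by rewrite lee_fin leNgt e0.
by exists n%:R => //; exact: ltW.
Qed.

Let ge0M (b : R -> R) D : D `<=` pos -> (forall r, D r -> (0 <= b r)%R) ->
  forall r, D r -> 0 <= (phi r * b r)%:E.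
Proof. by move=> Dp b0 r Dr; rewrite lee_fin mulr_ge0 ?b0//; apply: phi_pos; exact: Dp. Qed.

Let meas_phiM (b : R -> R) (D : set R) : D `<=` pos -> measurable_fun setT b ->
  measurable_fun D (fun r => (phi r * b r)%:E).
Proof.
move=> Dp mb; apply/measurable_EFinP; apply: measurable_funM.
  by apply: mphi; exact: subset_trans Dp pos_sub.
exact: measurable_funTS.
Qed.

Lemma kernel_convolution_affine (k D t : R) : (0 <= t)%R -> (0 <= k)%R -> (0 <= D)%R ->
  \int[leb]_(r in `]0%R, t]) (phi r * (k * (t - r) + D))%:E <= (Lam * (k * t + D))%:E.
Proof.
move=> t0 k0 D0.
apply: (@le_trans _ _ (\int[leb]_(r in pos) ((k * t + D)%:E * (phi r)%:E))); last first.
  rewrite ge0_integralZl//.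
  - by rewrite kernel_integral_pos -EFinM mulrC.
  - by apply/measurable_EFinP; exact: mphi.
  - by rewrite lee_fin addr_ge0 ?mulr_ge0.
have mk : measurable_fun setT (fun r : R => k * t + D)%R by exact: measurable_cst.
apply: (@le_trans _ _ (\int[leb]_(r in `]0%R, t]) ((k * t + D)%:E * (phi r)%:E))).
  apply: ge0_le_integral => //.
  - apply: ge0M => [|r]; first exact: itv_sub.
    rewrite /= in_itv /= => /andP[_ rt].
    by rewrite addr_ge0// mulr_ge0// subr_ge0.
  - apply: meas_phiM; first exact: itv_sub.
    by apply: measurable_funD => //; apply: measurable_funM => //; exact: measurable_funB.
  - apply: measurable_funeM; apply/measurable_EFinP; apply: mphi.
    exact: subset_trans (@itv_sub t) pos_sub.
  - move=> r /[dup] /itv_sub rp; rewrite /= in_itv /= => /andP[r0 rt].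
    rewrite -EFinM lee_fin mulrC ler_wpM2r ?phi_pos// lerD2r ler_wpM2l//.
    by rewrite gerBl ltW.
apply: ge0_subset_integral => //; try exact: (@itv_sub t).
  by apply: measurable_funeM; apply/measurable_EFinP; exact: mphi.
by move=> r rp; rewrite -EFinM lee_fin mulr_ge0 ?phi_pos// addr_ge0// mulr_ge0.
Qed.

(** The exponential [expR (a * (t - r))] factors into [expR (a * t)] and a Laplace weight, whose
    integral against [phi] is at most 1/4. In the linear term, [t - r] is merely bounded by [t]. *)
Lemma kernel_convolution_exp (C G a t : R) : (0 <= t)%R -> (0 <= C)%R -> (0 <= G)%R ->
  (0 <= a)%R ->
  \int[leb]_(r in `]0%R, +oo[) (phi r * expR (- (a * r)))%:E <= (4^-1)%:E ->
  \int[leb]_(r in `]0%R, t]) (phi r * (C * (t - r) + G * expR (a * (t - r))))%:E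
    <= (Lam * C * t + G * expR (a * t) / 4)%:E.
Proof.
move=> t0 C0 G0 a0 lap.
pose b1 (r : R) := expR (- (a * r)).
have mb1 : measurable_fun setT b1 by exact: mexpN.
pose u r := (C * t)%:E * (phi r)%:E + (G * expR (a * t))%:E * (phi r * b1 r)%:E.
have mp : measurable_fun pos (EFin \o phi) by apply/measurable_EFinP; exact: mphi.
have mpb : measurable_fun pos (fun r => (phi r * b1 r)%:E) by exact: meas_phiM.
have Ct0 : 0 <= (C * t)%:E by rewrite lee_fin mulr_ge0.
have Ge0 : 0 <= (G * expR (a * t))%:E by rewrite lee_fin mulr_ge0// expR_ge0.
have p0 r : pos r -> 0 <= (phi r)%:E by move=> rp; rewrite lee_fin phi_pos.
have pb0 r : pos r -> 0 <= (phi r * b1 r)%:E.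
  by move=> rp; rewrite lee_fin mulr_ge0 ?phi_pos// expR_ge0.
have mu_ : measurable_fun pos u.
  by apply: emeasurable_funD; exact: measurable_funeM.
have u0 r : pos r -> 0 <= u r.
  by move=> rp; rewrite adde_ge0// mule_ge0// ?p0 ?pb0.
apply: (@le_trans _ _ (\int[leb]_(r in pos) u r)).
  apply: (@le_trans _ _ (\int[leb]_(r in `]0%R, t]) u r)); last first.
    by apply: ge0_subset_integral => //; exact: itv_sub.
  apply: ge0_le_integral => //.
  - apply: ge0M => [|r]; first exact: itv_sub.
    rewrite /= in_itv /= => /andP[_ rt].
    by rewrite addr_ge0// mulr_ge0// ?subr_ge0// expR_ge0.
  - apply: meas_phiM; first exact: itv_sub.
    apply: measurable_funD; apply: measurable_funM => //; first exact: measurable_funB.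
    rewrite (_ : (fun r => _) = (fun r : R => expR (- a * r + a * t)%R)) //.
    by apply/funext => r; congr expR; ring.
  - by apply: measurable_funS mu_ => //; exact: itv_sub.
  - move=> r /[dup] /itv_sub rp; rewrite /= in_itv /= => /andP[r0 rt].
    rewrite /u -!EFinM -EFinD lee_fin /b1 mulrDr lerD//.
      rewrite mulrC ler_wpM2r ?phi_pos// ler_wpM2l// gerBl ltW//.
    by rewrite mulrBr expRD; lra.
rewrite ge0_integralD//; last 4 first.
- by move=> r rp; rewrite mule_ge0// p0.
- exact: measurable_funeM.
- by move=> r rp; rewrite mule_ge0// pb0.
- exact: measurable_funeM.
rewrite !ge0_integralZl// kernel_integral_pos EFinD; apply: leeD.
  by rewrite -EFinM lee_fin; lra.
by rewrite [leRHS]EFinM; apply: lee_wpmul2l.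
Qed.

(** The defect is the integral of [phi r] times the minimum of [r] and [t]. Up to a level [n] it is
    at most [n * Lam], which is the constant [D]; beyond [n] it is at most [t] times a tail of [phi]
    below [eps]. *)
Lemma kernel_convolution_defect (eps : R) : (0 < eps)%R ->
  exists2 D : R, (0 <= D)%R & forall t : R, (0 <= t)%R ->
    (Lam * t)%:E <= \int[leb]_(r in `]0%R, t]) (phi r * (t - r))%:E + (eps * t + D)%:E.
Proof.
move=> /kernel_tail[n tail]; have L0 := kernel_integral_ge0.
exists (n%:R * Lam)%R => [|t t0]; first by rewrite mulr_ge0.
pose tl : set R := `]n%:R, +oo[%classic.
have tlp : tl `<=` pos.
  by move=> r; rewrite /tl /pos /= !in_itv /= !andbT; apply: le_lt_trans.
pose g1 := (fun r => (phi r * (t - r))%:E) \_ `]0%R, t].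
pose g2 r := n%:R%:E * (phi r)%:E.
pose g3 := (fun r => t%:E * (phi r)%:E) \_ tl.
have mp : measurable_fun pos (EFin \o phi) by apply/measurable_EFinP; exact: mphi.
have p0 r : pos r -> 0 <= (phi r)%:E by move=> rp; rewrite lee_fin phi_pos.
have te0 : 0 <= t%:E by rewrite lee_fin.
have mt : measurable (`]0%R, t]%classic : set R) by exact: measurable_itv.
have mtl : measurable tl by exact: measurable_itv.
have mg1 : measurable_fun pos g1.
  apply/measurable_restrict => //; rewrite (setIidr (@itv_sub t)).
  apply: meas_phiM; first exact: itv_sub.
  exact: measurable_funB.
have mg3 : measurable_fun pos g3.
  apply/measurable_restrict => //; rewrite (setIidr tlp).
  by apply: measurable_funeM; exact: measurable_funS mp.
have g10 r : pos r -> 0 <= g1 r.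
  move=> rp; rewrite /g1 patchE; case: ifPn => //.
  rewrite inE /= in_itv /= => /andP[_ rt].
  by rewrite lee_fin mulr_ge0 ?phi_pos// subr_ge0.
have g30 r : pos r -> 0 <= g3 r.
  by move=> rp; rewrite /g3 patchE; case: ifPn => // _; rewrite mule_ge0// p0.
have g20 r : pos r -> 0 <= g2 r by move=> rp; rewrite mule_ge0// p0.
have mg2 : measurable_fun pos g2 by exact: measurable_funeM.
have : \int[leb]_(r in pos) (t%:E * (phi r)%:E) <=
    \int[leb]_(r in pos) (g1 r + g2 r + g3 r).
  apply: ge0_le_integral => //.
  - by move=> r rp; rewrite mule_ge0// p0.
  - exact: measurable_funeM.
  - by apply: emeasurable_funD => //; exact: emeasurable_funD.
  - move=> r rp; rewrite /g1 /g2 /g3 !patchE -!EFinM.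
    have pr := phi_pos rp; have r0 : (0 < r)%R by move: rp; rewrite /pos /= in_itv /= andbT.
    have -> : (r \in `]0%R, t]%classic) = (r <= t)%R.
      by apply/idP/idP; rewrite inE /= in_itv /= r0.
    have -> : (r \in tl) = (n%:R < r)%R.
      by apply/idP/idP; rewrite inE /tl /= in_itv /= andbT.
    have n0 := ler0n R n.
    (* Off their sets, [g1] and [g3] take the default value [point]. *)
    have -> : point = 0 :> \bar R by [].
    case: (leP r t) => rt; case: (ltP n%:R%R r) => rn;
      rewrite ?adde0 ?add0e -?EFinM -?EFinD lee_fin; nra.
rewrite ge0_integralZl// kernel_integral_pos.
rewrite ge0_integralD//; last 2 first.
- by move=> r rp; rewrite adde_ge0// ?g10 ?g20.
- exact: emeasurable_funD.
rewrite ge0_integralD// ge0_integralZl// kernel_integral_pos.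
rewrite /g1 /g3 -!integral_mkcondr.
rewrite (setIidr (@itv_sub t)) (setIidr tlp).
rewrite ge0_integralZl//; last 2 first.
- by apply: measurable_funS mp.
- by move=> r /tlp; exact: p0.
rewrite -EFinM mulrC => /le_trans; apply.
rewrite -addeA; apply: leeD2l.
rewrite EFinD addeC; apply: leeD => //.
by rewrite mulrC EFinM; apply: lee_wpmul2l.
Qed.

(** Compares the convolutions of [g] and of [q * s]. Two inequalities replace a bound on the
    difference because the convolution of [g] may be infinite; the defect of the linear function
    enters only the second one. *)
Lemma kernel_convolution_error (g : R -> R) (q eps D t : R) :
  measurable_fun setT g -> (forall s, (0 <= g s)%R) -> (0 <= t)%R -> (0 <= q)%R ->
  (Lam * t)%:E <= \int[lebesgue_measure]_(r in `]0%R, t]) (phi r * (t - r))%:E +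
    (eps * t + D)%:E ->
  let cv h := \int[lebesgue_measure]_(r in `]0%R, t]) (phi r * h (t - r)%R)%:E in
  let error := cv (fun s => `|g s - q * s|%R) in
  cv g <= (Lam * (q * t))%:E + error /\
  (Lam * (q * t))%:E <= cv g + (error + (q * (eps * t + D))%:E).
Proof.
move=> mg g0 t0 q0 defect cv error.
(* Truncated at negative times, so as to be nonnegative on the whole line; the convolutions only see
   [t - r >= 0]. *)
pose lin s : R := (q * Num.max s 0)%R.
have lin0 s : (0 <= lin s)%R by rewrite mulr_ge0// le_max lexx orbT.
have mlin : measurable_fun setT lin by apply: measurable_funM => //; exact: measurable_maxr.
have cvE (h h' : R -> R) : (forall s, (0 <= s)%R -> h s = h' s) -> cv h = cv h'.
  move=> hh'; apply: eq_integral => r; rewrite inE /= in_itv /= => /andP[_ rt].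
  by rewrite hh'// subr_ge0.
pose dist s : R := `|g s - lin s|%R.
have errorE : error = cv dist.
  by apply: cvE => s s0; rewrite /dist /lin max_l.
have mphi_t : measurable_fun (`]0%R, t]%classic : set R) phi.
  apply: measurable_funS phi_meas => //.
  by move=> r; rewrite /= !in_itv /= andbT => /andP[/ltW].
have mcv (h : R -> R) : measurable_fun setT h -> measurable_fun (`]0%R, t]%classic : set R)
    (fun r => (phi r * h (t - r)%R)%:E).
  move=> mh; apply/measurable_EFinP; apply: measurable_funM => //.
  apply: measurable_funTS; apply: (measurableT_comp mh); exact: measurable_funB.
have phi0 r : (`]0%R, t]%classic : set R) r -> (0 <= phi r)%R.
  by rewrite /= in_itv /= => /andP[r0 _]; rewrite phi_ge0// ltW.
have cv_le (h h1 h2 : R -> R) : measurable_fun setT h -> measurable_fun setT h1 ->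
    measurable_fun setT h2 -> (forall s, (0 <= h s)%R) -> (forall s, (0 <= h1 s)%R) ->
    (forall s, (0 <= h2 s)%R) -> (forall s, (h s <= h1 s + h2 s)%R) ->
    cv h <= cv h1 + cv h2.
  move=> mh mh1 mh2 h0 h10 h20 hh.
  rewrite /cv -ge0_integralD//.
  - apply: ge0_le_integral => //.
    + by move=> r r0; rewrite lee_fin mulr_ge0// phi0.
    + exact: mcv.
    + by apply: emeasurable_funD; exact: mcv.
    by move=> r r0; rewrite -EFinD lee_fin -mulrDr ler_wpM2l// phi0.
  - by move=> r r0; rewrite lee_fin mulr_ge0// phi0.
  - exact: mcv.
  - by move=> r r0; rewrite lee_fin mulr_ge0// phi0.
  - exact: mcv.
have mdist : measurable_fun setT dist.
  by apply: measurableT_comp => //; exact: measurable_funB.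
have cv_lin : cv lin = q%:E * \int[lebesgue_measure]_(r in `]0%R, t]) (phi r * (t - r))%:E.
  rewrite -ge0_integralZl//.
  - apply: eq_integral => r; rewrite inE /= in_itv /= => /andP[_ rt].
    by rewrite /lin max_l ?subr_ge0// -EFinM; congr EFin; ring.
  - exact: (mcv id).
  - move=> r r0; rewrite lee_fin mulr_ge0 ?phi0//.
    by move: r0; rewrite /= in_itv /= subr_ge0 => /andP[].
have dist0 s : (0 <= dist s)%R by exact: normr_ge0.
rewrite errorE; split.
  apply: (@le_trans _ _ (cv lin + cv dist)).
    apply: cv_le => // s; rewrite -lerBlDl; exact: ler_norm.
  apply: leeD => //.
  rewrite (cvE lin (fun s => q * s + 0)%R); last by move=> s s0; rewrite /lin max_l// addr0.
  apply: le_trans (kernel_convolution_affine t0 q0 (lexx _)) _.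
  by rewrite addr0.
apply: (@le_trans _ _ (cv lin + (q * (eps * t + D))%:E)).
  rewrite cv_lin mulrCA [leLHS]EFinM [X in _ + X]EFinM.
  apply: le_trans (lee_wpmul2l _ defect) _; first by rewrite lee_fin.
  by rewrite muleDr// fin_num_adde_defl.
rewrite addeA; apply: leeD => //.
apply: cv_le => // s; rewrite -lerBlDl; apply: le_trans (ler_norm _) _.
by rewrite distrC.
Qed.

End kernel_integrals.

Section expectation_convolution.
Context (R : realType) (disp : measure_display) (Omega : measurableType disp)
  (P : probability Omega R) (phi : R -> R).
Hypothesis phi_meas : measurable_fun (`[0%R, +oo[%classic : set R) phi.
Hypothesis phi_ge0 : forall t : R, (0 <= t)%R -> (0 <= phi t)%R.
Variables (H : Omega * measurableTypeR R -> R) (b : R -> R) (t : R).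
Hypotheses (mH : measurable_fun setT H) (H0 : forall x, (0 <= H x)%R).

Let phi' := phi \_ `[0%R, +oo[.
Let phi'0 r : (0 <= phi' r)%R. Proof. exact: patch_phi_ge0. Qed.
Let phi'E r : (0 <= r)%R -> phi' r = phi r. Proof. exact: patch_phiE. Qed.
Let mphi' : measurable_fun setT phi'. Proof. exact: measurable_patch_phi. Qed.

Let g (x : Omega * measurableTypeR R) : \bar R :=
  (phi' x.2 * H (x.1, (t - x.2)%R) * \1_(`]0%R, t]%classic : set R) x.2)%:E.

Let g0 x : 0 <= g x. Proof. by rewrite lee_fin !mulr_ge0. Qed.

Let mg : measurable_fun setT g.
Proof.
apply/measurable_EFinP; apply: measurable_funM.
  apply: measurable_funM; first exact: (measurableT_comp mphi' measurable_snd).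
  apply: (measurableT_comp mH); apply: measurable_fun_pair; first exact: measurable_fst.
  by apply: measurable_funB => //; exact: measurable_snd.
apply: (measurableT_comp _ measurable_snd) => //.
Qed.

Let patch_integral (u : R -> R) :
  \int[lebesgue_measure]_(r in `]0%R, t]) (phi r * u r)%:E =
  \int[lebesgue_measure]_r (phi' r * u r * \1_(`]0%R, t]%classic : set R) r)%:E.
Proof.
rewrite integral_mkcond; apply: eq_integral => r _; rewrite patchE indicE.
case: ifPn => [|_]; last by rewrite mulr0.
by rewrite inE /= in_itv /= => /andP[r0 _]; rewrite mulr1 phi'E// ltW.
Qed.

Let convolution_fubini w : \int[lebesgue_measure]_(r in `]0%R, t]) (phi r * H (w, (t - r)%R))%:E =
  \int[lebesgue_measure]_r g (w, r).
Proof. exact: (patch_integral (fun r => H (w, (t - r)%R))). Qed.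

Lemma measurable_expectation_convolution : measurable_fun setT (fun w =>
  \int[lebesgue_measure]_(r in `]0%R, t]) (phi r * H (w, (t - r)%R))%:E).
Proof.
under eq_fun do rewrite convolution_fubini.
exact: (measurable_fun_fubini_tonelli_F (m2 := @lebesgue_measure R) g mg g0).
Qed.

(** Joint measurability of [H] allows Tonelli's theorem between outcomes and time; the hypothesis on
    the means is then applied at each fixed time. *)
Lemma expectation_convolution_le : measurable_fun setT b ->
  (forall s, (0 <= s)%R -> (s <= t)%R -> \int[P]_w (H (w, s))%:E <= (b s)%:E) ->
  \int[P]_w \int[lebesgue_measure]_(r in `]0%R, t]) (phi r * H (w, (t - r)%R))%:E <=
  \int[lebesgue_measure]_(r in `]0%R, t]) (phi r * b (t - r))%:E.
Proof.
move=> mb Hb.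
under eq_integral do rewrite convolution_fubini.
rewrite (fubini_tonelli (m1 := P) (m2 := @lebesgue_measure R) g mg g0).
rewrite patch_integral.
apply: ge0_le_integral => //.
- by move=> r _; exact: integral_ge0.
- exact: (measurable_fun_fubini_tonelli_G (m1 := P) g mg g0).
- apply/measurable_EFinP; apply: measurable_funM; last exact: measurable_indic.
  apply: measurable_funM => //; apply: (measurableT_comp mb).
  exact: measurable_funB.
move=> r _; rewrite /g /=.
rewrite indicE; have [|_] := boolP (r \in _); last first.
  by rewrite mulr0; under eq_integral do rewrite mulr0; rewrite integral0.
rewrite inE /= in_itv /= => /andP[r0 rt]; rewrite mulr1.
under eq_integral do rewrite mulr1 EFinM.
rewrite ge0_integralZl//.
- rewrite EFinM; apply: lee_wpmul2l; first by rewrite lee_fin.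
  by apply: Hb; rewrite ?subr_ge0// gerBl ltW.
- apply/measurable_EFinP.
  exact: (measurableT_comp mH (pair2_measurable ((t - r)%R : measurableTypeR R))).
- by move=> w _; rewrite lee_fin.
- by rewrite lee_fin.
Qed.

End expectation_convolution.

(** Both [x] and [e] may be infinite: if [x] is [+oo], the first inequality forces [e] to be [+oo]
    as well. *)
Lemma abse_sub_le (R : realDomainType) (x e : \bar R) (y : R) :
  x <= y%:E + e -> y%:E <= x + e -> `|x - y%:E| <= e.
Proof.
case: x => [x| |]; case: e => [e| |] //=; rewrite ?leey// -?EFinD !lee_fin.
by move=> xy yx; rewrite ler_norml; apply/andP; split; lra.
Qed.

Lemma abse_triangle_fin (R : realDomainType) (x y : R) (c : \bar R) :
  `|(x - y)%:E| <= `|x%:E - c| + `|c - y%:E|.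
Proof.
case: c => [c| |] //=; rewrite ?leey// -EFinD lee_fin.
exact: ler_distD.
Qed.

Lemma exists_geometric_le (R : realType) (K eps : R) : (0 < eps)%R -> exists n : nat, (K / 2 ^+ n <= eps)%R.
Proof.
move=> e0; exists (Num.truncn (K / eps)).+1; set n := _.+1.
rewrite ler_pdivrMr ?exprn_gt0// mulrC -ler_pdivrMr//.
apply: le_trans (ltW (truncnS_gt _)) _.
by rewrite -natrX ler_nat ltnW// ltn_expl.
Qed.

(** * The law of large numbers *)

Section completed_filtration.
Context (disp : measure_display) (Omega : measurableType disp) (R : realType).
Variable P : probability Omega R.

(* The solution of the Hawkes equation is only controlled outside of a null set,
   which has no reason to belong to the filtration. *)
Definition completed_filtration (F : R -> set_system Omega) (t : R) : set_system Omega :=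
  [set A | measurable A /\
    exists2 A', F t A' & {ae P, forall w, A w <-> A' w} ].

Variable F : R -> set_system Omega.
Hypothesis F_filtration : filtration F.

Lemma completed_filtrationP : filtration (completed_filtration F).
Proof.
split => [t t0|t t0|s t s0 st].
- have [F0 FC FU] := filtration_sigma F_filtration t0; split.
  + by split => //; exists set0 => //; exact: aeW.
  + move=> A [mA [A' FA' AA']]; split; first exact: measurableD.
    exists (setT `\` A'); first exact: FC.
    by apply: filterS AA' => w h; split => -[_ nA]; split => // /h.
  + move=> A hA; have mA n : measurable (A n) by have [] := hA n.
    split; first exact: bigcupT_measurable.
    have /choice[A' A'P] : forall n, exists A', F t A' /\ {ae P, forall w, A n w <-> A' w}.
      by move=> n; have [_ [A' ? ?]] := hA n; exists A'.
    exists (\bigcup_n A' n); first by apply: FU => n; exact: (A'P n).1.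
    have : {ae P, forall w, forall n, A n w <-> A' n w}.
      by apply/ae_foralln => n; exact: (A'P n).2.
    by apply: filterS => w h; split => -[n _ /h ?]; exists n.
- by move=> A [].
- move=> A [mA [A' FA' AA']]; split => //; exists A' => //.
  exact: (filtration_mono F_filtration s0 st).
Qed.

Lemma sub_completed_filtration t : (0 <= t)%R -> F t `<=` completed_filtration F t.
Proof.
move=> t0 A FA; split; first exact: (filtration_sub F_filtration t0).
by exists A => //; exact: aeW.
Qed.

Lemma ae_eq_probability A A' : measurable A -> measurable A' ->
  {ae P, forall w, A w <-> A' w} -> P A = P A'.
Proof.
move=> mA mA' AA'; rewrite -[A]setIT -[A']setIT -!(integral_indic _ measurableT)//.
apply: ge0_ae_eq_integral => //.
- by apply/measurable_EFinP; exact: measurable_indic.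
- by apply/measurable_EFinP; exact: measurable_indic.
- apply: filterS AA' => w h _; rewrite !indicE; congr ((nat_of_bool _)%:R%:E).
  by apply/idP/idP; rewrite !inE => /h.
Qed.

(** Replacing an event by an almost surely equal one changes none of the probabilities involved. *)
Lemma completed_filtration_independent t (H : set_system Omega) : (0 <= t)%R ->
  H `<=` measurable -> independent2 P (F t) H ->
  independent2 P (completed_filtration F t) H.
Proof.
move=> t0 mH indep A B [mA [A' FA' AA']] HB.
have mA' := filtration_sub F_filtration t0 FA'.
have mB := mH _ HB.
rewrite (ae_eq_probability mA mA' AA') -(indep _ _ FA' HB).
apply: ae_eq_probability; [exact: measurableI|exact: measurableI|].
by apply: filterS AA' => w h; split => -[/h ? ?].
Qed.

End completed_filtration.

Section iid_single.
Context (disp : measure_display) (Omega : measurableType disp) (R : realType).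
Variables (P : probability Omega R) (V : eqType) (F : R -> set_system Omega).
Hypothesis F_filtration : filtration F.
Variable pi : V -> R.-ker Omega ~> plane R.
Hypothesis pi_iid : iid_poisson_measures P F pi.
Variable i : V.

Let sub_sigma D : sigma_random_measures (fun _ : unit => pi i) D `<=`
  sigma_random_measures pi D.
Proof.
apply: smallest_sub; first exact: smallest_sigma_algebra.
move=> _ [_ [B [C [mB BD mC ->]]]]; apply: sub_sigma_algebra.
by exists i, B, C.
Qed.

Lemma sigma_random_measures_measurable D :
  sigma_random_measures (fun _ : unit => pi i) D `<=` measurable.
Proof.
apply: smallest_sub; first exact: sigma_algebra_measurable.
move=> _ [_ [B [C [mB _ mC ->]]]].
by have := measurable_kernel (pi i) B mB measurableT C mC; rewrite setTI.
Qed.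

Lemma single_adapted t : (0 <= t)%R ->
  sigma_random_measures (fun _ : unit => pi i) (`[0%R, t] `*` `[0%R, +oo[) `<=`
  completed_filtration P F t.
Proof.
move=> t0; apply: subset_trans (sub_completed_filtration P F_filtration t0).
exact: subset_trans (@sub_sigma _) (iid_adapted pi_iid t0).
Qed.

Lemma single_future t : (0 <= t)%R ->
  independent2 P (completed_filtration P F t)
    (sigma_random_measures (fun _ : unit => pi i) (`]t, +oo[ `*` `[0%R, +oo[)).
Proof.
move=> t0; apply: completed_filtration_independent => //.
  exact: sigma_random_measures_measurable.
by move=> A B FA /sub_sigma HB; exact: (iid_future pi_iid t0).
Qed.

End iid_single.

Lemma exists_cst_cumulative (R : realType) (c : R) :
  exists f : cumulative R R, forall t, f t = c.
Proof.
have nd : nondecreasing (cst c : R -> R) by move=> x y _ /=.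
have rc : right_continuous (cst c : R -> R) by move=> x; exact: cvg_cst.
by exists (HB.pack_for (cumulative R R) (cst c : R -> R) (isCumulative.Build _ _ _ _ nd rc)).
Qed.

Section hawkes_paths.
Context (R : realType) (disp : measure_display) (Omega : measurableType disp)
  (P : probability Omega R) (d : nat) (phi : R -> R) (mu : Zlattice d -> R)
  (F : R -> set_system Omega) (pi : Zlattice d -> R.-ker Omega ~> plane R)
  (Z : Zlattice d -> R -> Omega -> R).
Hypothesis F_filtration : filtration F.
Hypothesis Z_hawkes : nn_linear_hawkes P F pi phi mu Z.

Lemma measurable_hawkes i t : (0 <= t)%R -> measurable_fun setT (Z i t).
Proof.
move=> t0 _ C mC; rewrite setTI; apply: (filtration_sub F_filtration t0).
exact: (hawkes_adapted Z_hawkes).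
Qed.

(** The equation provides a family of paths for each outcome outside of a null set. Choosing them
    simultaneously, and the zero path on the null set [N], gives functions defined at every outcome
    whose measurability at nonnegative times follows from that of [Z]. *)
Lemma exists_hawkes_paths :
  exists (f : Zlattice d -> Omega -> cumulative R R) (N : set Omega),
  [/\ [/\ measurable N, P N = 0 & forall w, N w -> forall j t, f j w t = 0%R],
      forall w, ~ N w -> forall j t, (0 <= t)%R -> f j w t = Z j t w &
      forall w, ~ N w -> forall i t, (0 <= t)%R ->
        (Z i t w)%:E = \int[pi i w]_(p in `[0%R, t] `*` `[0%R, +oo[)
          (\1_[set q : R * R | (q.2%:E <=
            hawkes_intensity phi mu (fun j => f j w) i q.1)%E] p)%:E ].
Proof.
have [N [mN PN subN]] := hawkes_eq Z_hawkes.
have [f0 f0E] := exists_cst_cumulative (0 : R)%R.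
have /choice[g gP] : forall w, exists g : Zlattice d -> cumulative R R,
    (N w -> g = fun=> f0) /\ (~ N w ->
    (forall j (t : R), (0 <= t)%R -> g j t = Z j t w) /\
    (forall i (t : R), (0 <= t)%R ->
      (Z i t w)%:E = \int[pi i w]_(p in `[0%R, t] `*` `[0%R, +oo[)
        (\1_[set q : R * R | (q.2%:E <= hawkes_intensity phi mu g i q.1)%E] p)%:E)).
  move=> w; have [Nw|Nw] := pselect (N w); first by exists (fun=> f0).
  have [f [fZ fE]] : hawkes_equation phi mu (fun i => pi i w) (fun i t => Z i t w).
    by apply: contrapT => h; apply: Nw; exact: subN.
  by exists f.
exists (fun j w => g w j), N; split.
- by split => // w Nw j t; rewrite ((gP w).1 Nw) f0E.
- by move=> w /((gP w).2)[].
- by move=> w /((gP w).2)[].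
Qed.

Section intensity.
Variables (f : Zlattice d -> Omega -> cumulative R R) (N : set Omega).
Hypotheses (mN : measurable N) (PN : P N = 0).
Hypothesis fN : forall w, N w -> forall j t, f j w t = 0%R.
Hypothesis fZ : forall w, ~ N w -> forall j t, (0 <= t)%R -> f j w t = Z j t w.
Hypothesis phi_meas : measurable_fun (`[0%R, +oo[%classic : set R) phi.
Hypothesis phi_ge0 : forall t : R, (0 <= t)%R -> (0 <= phi t)%R.
Hypothesis mu_ge0 : forall i, (0 <= mu i)%R.

Lemma hawkes_path_adapted j :
  adapted (completed_filtration P F) (fun t w => f j w t).
Proof.
move=> t t0 C mC; split; last first.
  exists (Z j t @^-1` C); first exact: (hawkes_adapted Z_hawkes).
  exists N; split => // w /= h; apply: contrapT => /fZ fZw; apply: h.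
  by rewrite /preimage /= fZw.
rewrite (_ : _ @^-1` C = (~` N `&` Z j t @^-1` C) `|` (N `&` [set _ | C 0%R])).
  apply: measurableU; apply: measurableI => //.
  - exact: measurableC.
  - by rewrite -[X in measurable X]setTI; exact: measurable_hawkes.
  - by have [C0|C0] := pselect (C 0%R); [rewrite (_ : [set _ | _] = setT)|
      rewrite (_ : [set _ | _] = set0)]; rewrite ?set0P //;
      apply/seteqP; split.
apply/seteqP; split => w /=; have [Nw|Nw] := pselect (N w).
- by rewrite fN// => ?; right.
- by rewrite fZ// => ?; left.
- by rewrite fN// => -[[]|[]].
- by rewrite fZ// => -[[]|[]].
Qed.

Lemma measurable_hawkes_path j t : (0 <= t)%R -> measurable_fun setT (fun w => f j w t).
Proof.
by move=> t0 _ C mC; rewrite setTI; exact: (hawkes_path_adapted j t0 mC).1.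
Qed.

Definition path_intensity i (z : Omega * R) : \bar R :=
  hawkes_intensity phi mu (fun j => f j z.1) i z.2.

Let conv j (z : Omega * R) : \bar R :=
  \int[lebesgue_stieltjes_measure (f j z.1)]_(u in `]0%R, z.2[) (phi (z.2 - u)%R)%:E.

Let conv_ge0 j z : 0 <= conv j z.
Proof.
apply: integral_ge0 => u /=; rewrite in_itv /= => /andP[_ us].
by rewrite lee_fin phi_ge0// subr_ge0 ltW.
Qed.

Lemma path_intensityE i z : path_intensity i z =
  (mu i)%:E + ((2 * d + 1)%:R^-1)%:E * \sum_(j <- neighbours R i) conv j z.
Proof.
rewrite /path_intensity /hawkes_intensity esum_neighbours// => j.
exact: (conv_ge0 j z).
Qed.

Lemma path_intensity_ge0 i z : 0 <= path_intensity i z.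
Proof.
rewrite path_intensityE adde_ge0 ?lee_fin// mule_ge0 ?lee_fin ?invr_ge0//.
by apply: sume_ge0.
Qed.

Lemma measurable_path_intensity i : measurable_fun
  [set: g_sigma_algebraType (predictable_gen (completed_filtration P F))] (path_intensity i).
Proof.
rewrite (_ : path_intensity i = (fun z => (mu i)%:E +
  ((2 * d + 1)%:R^-1)%:E * \sum_(j <- neighbours R i) conv j z)); last first.
  by apply/funext => z; exact: path_intensityE.
apply: emeasurable_funD => //; apply: measurable_funeM; apply: emeasurable_sum => j _.
apply: measurable_convolution_past => //.
  exact: completed_filtrationP.
exact: hawkes_path_adapted.
Qed.

Let predictable_gen_measurable (G : R -> set_system Omega) : filtration G ->
  predictable_gen G `<=` (measurable : set_system (Omega * measurableTypeR R)).
Proof.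
move=> hG _ [A [s [s0 GA ->]]]; apply: measurableX.
  exact: (filtration_sub hG s0).
exact: measurable_itv.
Qed.

Lemma measurable_path_intensity_prod i :
  measurable_fun [set: Omega * measurableTypeR R] (path_intensity i).
Proof.
move=> _ C mC; have := measurable_path_intensity i measurableT mC.
rewrite !setTI => h; move: h; apply: smallest_sub.
  exact: sigma_algebra_measurable.
exact: (predictable_gen_measurable (completed_filtrationP P F_filtration)).
Qed.

(** Times up to 0 are discarded because predictable rectangles cannot see them. Negative marks are
    removed later, by the intersection with the strip. *)
Definition intensity_graph i : set (Omega * plane R) :=
  [set x | (0 < x.2.1)%R /\ x.2.2%:E <= path_intensity i (x.1, x.2.1)].

Lemma predictable_intensity_graph i :
  <<s predictable_rect (completed_filtration P F) >> (intensity_graph i).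
Proof.
apply: predictable_undergraph.
- exact: completed_filtrationP.
- exact: measurable_path_intensity.
- by move=> z; exact: path_intensity_ge0.
Qed.

(** The area of the random region in which [Z i t] counts points. This form fits the results on
    predictable sets directly; the usual integral of the intensity is derived from it. *)
Definition compensator i t w : \bar R :=
  (lebesgue_measure \x lebesgue_measure)%E (xsection (intensity_graph i) w `&` strip t).

Lemma compensator_integral i t w : compensator i t w =
  \int[lebesgue_measure]_(s in `]0%R, t]) path_intensity i (w, s).
Proof.
rewrite /compensator /product_measure1 [RHS]integral_mkcond.
apply: eq_integral => s _; rewrite patchE /=.
case: ifPn => [|sN]; last first.
  have -> : xsection (xsection (intensity_graph i) w `&` strip t) s = set0.
    apply/seteqP; split => // z; rewrite /xsection /= inE => -[_ [/= st _]].
    by move/negP: sN; apply; rewrite inE.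
  by rewrite measure0.
rewrite inE => st; have := st; rewrite /= in_itv /= => /andP[s0 _].
have l0 := path_intensity_ge0 i (w, s).
have -> : xsection (xsection (intensity_graph i) w `&` strip t) s =
    [set z | (0 <= z)%R /\ z%:E <= path_intensity i (w, s)].
  apply/seteqP; split => z; rewrite /xsection /intensity_graph /= !inE /=.
    rewrite inE /= => -[[_ zl] [/= _ z0]]; split => //.
    by move: z0; rewrite in_itv /= andbT.
    move=> [z0 zl]; split; first by rewrite inE.
  by split => //=; rewrite in_itv /= z0.
case: (path_intensity i (w, s)) l0 => [l| |]//; rewrite ?lee_fin => l0.
  rewrite (_ : [set z | _] = `[0%R, l]%classic).
    transitivity (@lebesgue_measure R `[0%R, l]) => //.
    rewrite lebesgue_measure_itv /= lte_fin; case: ltP => l1.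
      by rewrite -EFinB subr0.
    by congr EFin; apply/eqP; rewrite eq_le l0 l1.
  apply/seteqP; split => z /=; rewrite in_itv /= lee_fin; first by move=> [-> ->].
  by move=> /andP[].
rewrite (_ : [set z | _] = `[0%R, +oo[%classic).
  transitivity (@lebesgue_measure R `[0%R, +oo[) => //.
  by rewrite lebesgue_measure_itv /= ltry.
by apply/seteqP; split => z /=; rewrite in_itv /= andbT; [move=> []|rewrite leey].
Qed.

Lemma compensatorE i t w : (0 <= t)%R -> compensator i t w = (mu i * t)%:E +
  ((2 * d + 1)%:R^-1)%:E * \sum_(j <- neighbours R i)
    \int[lebesgue_measure]_(r in `]0%R, t]) (phi r * (f j w (t - r) - f j w 0))%:E.
Proof.
move=> t0; rewrite compensator_integral.
under eq_integral do rewrite path_intensityE.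
have mconv j : measurable_fun setT (fun s : R => conv j (w, s)).
  have mc : measurable_fun [set: Omega * measurableTypeR R] (conv j).
    move=> _ C mC.
    have := measurable_convolution_past (completed_filtrationP P F_filtration)
      (hawkes_path_adapted j) phi_meas phi_ge0 measurableT mC.
    rewrite !setTI => h; move: h; apply: smallest_sub.
      exact: sigma_algebra_measurable.
    exact: (predictable_gen_measurable (completed_filtrationP P F_filtration)).
  exact: (measurableT_comp mc (pair1_measurable w)).
have msum : measurable_fun setT (fun s : R => \sum_(j <- neighbours R i) conv j (w, s)).
  exact: emeasurable_sum.
have sum0 s : 0 <= \sum_(j <- neighbours R i) conv j (w, s) by exact: sume_ge0.
have c0 : 0 <= ((2 * d + 1)%:R^-1 : R)%:E by rewrite lee_fin invr_ge0.
have mu0 : 0 <= (mu i)%:E by rewrite lee_fin.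
rewrite ge0_integralD//; [|by move=> s _; exact: mule_ge0|
  by apply: measurable_funTS; exact: measurable_funeM].
congr (_ + _).
  rewrite integral_cst//.
  transitivity ((mu i)%:E * @lebesgue_measure R `]0%R, t]) => //.
  rewrite lebesgue_measure_itv /= lte_fin; case: ltP => t1.
    by rewrite -EFinB subr0.
  have -> : t = 0%R by apply/eqP; rewrite eq_le t0 t1.
  by rewrite mulr0 mule0.
rewrite ge0_integralZl//; last exact: measurable_funTS.
congr (_ * _); rewrite ge0_integral_sum//; last first.
  by move=> j; exact: measurable_funTS (mconv j).
apply: eq_bigr => j _; rewrite /conv /=.
exact: (integral_convolution_past (f j w) t phi_meas phi_ge0).
Qed.

Lemma measurable_compensator i t : (0 <= t)%R -> measurable_fun setT (compensator i t).
Proof.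
move=> t0; rewrite (_ : compensator i t = fun w =>
    \int[lebesgue_measure]_(s in `]0%R, t]) path_intensity i (w, s)); last first.
  by apply/funext => w; exact: compensator_integral.
under eq_fun do rewrite integral_mkcond.
pose g (x : Omega * measurableTypeR R) := (path_intensity i \_ (setT `*` `]0%R, t])) x.
have mg : measurable_fun setT g.
  apply/(measurable_restrictT _ _).1; first by apply: measurableX => //; exact: measurable_itv.
  exact: measurable_funTS (measurable_path_intensity_prod i).
have g0 x : 0 <= g x.
  by rewrite /g patchE; case: ifPn => // _; exact: path_intensity_ge0.
have := measurable_fun_fubini_tonelli_F (m2 := @lebesgue_measure R) g mg g0.
congr measurable_fun; apply/funext => w; apply: eq_integral => s _.
rewrite /g !patchE; congr (if _ then _ else _).
by apply/idP/idP; rewrite !inE /=; [move=> []|].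
Qed.

Hypothesis pi_iid : iid_poisson_measures P F pi.
Hypothesis f_eq : forall w, ~ N w -> forall i t, (0 <= t)%R ->
  (Z i t w)%:E = \int[pi i w]_(p in `[0%R, t] `*` `[0%R, +oo[)
    (\1_[set q : R * R | (q.2%:E <=
      hawkes_intensity phi mu (fun j => f j w) i q.1)%E] p)%:E.

Let N_ae : {ae P, forall w, ~ N w}.
Proof. by exists N; split => // w /= /contrapT. Qed.

(** The region of integration in the equation exceeds the left-open one by a segment at time 0,
    which carries no point almost surely. *)
Lemma hawkes_strip i t : (0 <= t)%R ->
  {ae P, forall w, (Z i t w)%:E = pi i w (xsection (intensity_graph i) w `&` strip t)}.
Proof.
move=> t0; apply: filterS2 N_ae (pi_time0_ae (iid_poisson pi_iid i)) => w Nw pi0.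
rewrite (f_eq Nw i t0).
pose D : set (plane R) := `[0%R, t] `*` `[0%R, +oo[.
pose S : set (plane R) := [set q | q.2%:E <= path_intensity i (w, q.1)].
pose A0 : set (plane R) := [set 0%R] `*` `[0%R, mu i].
pose A1 : set (plane R) := xsection (intensity_graph i) w `&` strip t.
have mA0 : measurable A0 by apply: measurableX => //; exact: measurable_set1.
have mA1 : measurable A1.
  apply: measurableI; last exact: measurable_strip.
  apply: measurable_xsection.
  apply: (predictable_measurable (completed_filtrationP P F_filtration)).
  exact: predictable_intensity_graph.
have mD : measurable D by exact: measurableX.
have lam0 : path_intensity i (w, 0%R) = (mu i)%:E.
  rewrite path_intensityE big1 ?mule0 ?adde0// => j _.
  by rewrite /conv /= set_itv_ge ?integral_set0// bnd_simp -leNgt.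
(* At time 0 the intensity reduces to [mu i], since no jump precedes. This decomposition also yields
   the measurability of the region. *)
have SD : S `&` D = A1 `|` A0.
  apply/seteqP; split => -[u z].
    move=> [/= Sz [/=]]; rewrite !in_itv /= andbT => /andP[u0 ut] z0.
    have [u_gt0|u_le0] := ltP 0%R u.
      left; split; first by rewrite /xsection /= inE.
      by split; rewrite /= in_itv /= ?u_gt0 ?z0.
    have u0E : u = 0%R by apply/eqP; rewrite eq_le u0 u_le0.
    right; split => //=; rewrite in_itv /= z0 /=.
    by rewrite -lee_fin -lam0 -u0E.
  move=> [[]|[/= -> ]].
    rewrite /xsection /= inE => -[_ Sz] [/=]; rewrite !in_itv /= => /andP[u0 ut] z0.
    by split => //; split; rewrite /= in_itv /= ?(ltW u0) ?ut.
  rewrite in_itv /= => /andP[z0 zm]; split; first by rewrite /S /= lam0 lee_fin.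
  by split; rewrite /= in_itv /= ?lexx ?z0.
have mSD : measurable (S `&` D) by rewrite SD; exact: measurableU.
transitivity (\int[pi i w]_(p in D) (\1_(S `&` D) p)%:E).
  apply: eq_integral => p pD; congr EFin; rewrite !indicE; congr (nat_of_bool _)%:R.
  by rewrite in_setI pD andbT.
rewrite integral_indic// setIAC -setIA setIid SD.
rewrite measureU0//; apply/eqP; rewrite eq_le measure_ge0 andbT -pi0.
apply: le_measure; rewrite ?inE//.
  by apply: measurableX => //; exact: measurable_set1.
move=> [u z] [/= -> ]; rewrite in_itv /= => /andP[z0 _].
by split => //=; rewrite in_itv /= z0.
Qed.

Lemma hawkes_ge0_ae i t : (0 <= t)%R -> {ae P, forall w, (0 <= Z i t w)%R}.
Proof.
by move=> t0; apply: filterS (hawkes_strip i t0) => w Zw; rewrite -lee_fin Zw.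
Qed.

(** The process is nonnegative almost surely only; the absolute value makes the integrand
    nonnegative at every outcome. *)
Definition hawkes_mean i t : \bar R := \int[P]_w `|Z i t w|%:E.

Let completed := completed_filtrationP P F_filtration.

Lemma hawkes_mean_compensator i t : (0 <= t)%R ->
  hawkes_mean i t = \int[P]_w compensator i t w.
Proof.
move=> t0.
exact: (strip_mean completed (iid_poisson pi_iid i)
  (@single_future _ _ _ _ _ _ F_filtration _ pi_iid i) (predictable_intensity_graph i)
  (measurable_hawkes i t0) (measurable_compensator i t0) (fun=> erefl) (hawkes_strip i t0)).
Qed.

Lemma hawkes_L1_bound i t (eps : R) : (0 <= t)%R -> (0 < eps)%R ->
  hawkes_mean i t < +oo ->
  \int[P]_w `|(Z i t w)%:E - compensator i t w| <=
  eps%:E * hawkes_mean i t + ((4 * eps)^-1)%:E.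
Proof.
move=> t0 e0; rewrite hawkes_mean_compensator//.
exact: (strip_L1_bound completed (iid_poisson pi_iid i)
  (@single_adapted _ _ _ _ _ _ F_filtration _ pi_iid i)
  (@single_future _ _ _ _ _ _ F_filtration _ pi_iid i) (predictable_intensity_graph i)
  (measurable_hawkes i t0) (measurable_compensator i t0) (fun=> erefl) (hawkes_strip i t0)).
Qed.

(** At time 0 the compensator integrates over an empty interval, so that the mean of the absolute
    value of [Z i 0] vanishes. *)
Lemma hawkes_start_ae i : {ae P, forall w, f i w 0%R = 0%R}.
Proof.
have : hawkes_mean i 0 = 0.
  rewrite hawkes_mean_compensator// integral0_eq// => w _.
  rewrite compensator_integral set_itv_ge ?integral_set0//.
  by rewrite bnd_simp ltxx.
rewrite /hawkes_mean => Z0.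
have mZ : measurable_fun setT (EFin \o Z i 0) by apply/measurable_EFinP; exact: measurable_hawkes.
have /(ae_eq_integral_abs P measurableT mZ) : \int[P]_w `|(EFin \o Z i 0) w| = 0 by [].
by apply: filterS2 N_ae => w Nw /(_ I) /= [Zw]; rewrite fZ.
Qed.

Lemma hawkes_mean_mono i s t : (0 <= s)%R -> (s <= t)%R ->
  hawkes_mean i s <= hawkes_mean i t.
Proof.
move=> s0 st; have t0 := le_trans s0 st.
have mZ u : (0 <= u)%R -> measurable_fun setT (fun w => `|Z i u w|%:E).
  by move=> u0; apply/measurable_EFinP; apply: measurableT_comp => //; exact: measurable_hawkes.
apply: ae_ge0_le_integral => //; [exact: mZ|exact: mZ|].
apply: filterS3 N_ae (hawkes_ge0_ae i s0) (hawkes_ge0_ae i t0) => w Nw Zs Zt _.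
rewrite lee_fin !ger0_norm// -!fZ//; exact: cumulative_is_nondecreasing.
Qed.

(** A single term of the moment series is at most its sum, which serves as [G]. This is the a priori
    finiteness from which the estimates start. *)
Lemma hawkes_mean_weighted t : (0 <= t)%R ->
  exists2 G : R, (0 <= G)%R & forall i, hawkes_mean i t <= (G * 2 `^ enorm R i)%:E.
Proof.
move=> t0; have := hawkes_moment Z_hawkes t0.
set S := \esum_(i in setT) _ => Soo.
have EZ i : 'E_P[Z i t] = hawkes_mean i t.
  rewrite unlock /hawkes_mean; apply: ae_eq_integral => //.
  - by apply/measurable_EFinP; exact: measurable_hawkes.
  - by apply/measurable_EFinP; apply: measurableT_comp => //; exact: measurable_hawkes.
  - by apply: filterS (hawkes_ge0_ae i t0) => w Zw _; rewrite ger0_norm.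
have m0 i : 0 <= hawkes_mean i t by exact: integral_ge0.
have termS i : (2 `^ (- enorm R i))%:E * hawkes_mean i t <= S.
  apply: esum_ge; exists [set i]; first by split.
  by rewrite fsbig_set1 EZ.
have S0 : 0 <= S by apply: esum_ge0 => i _; rewrite EZ mule_ge0// lee_fin powR_ge0.
have Sfin : S = (fine S)%:E by rewrite fineK// ge0_fin_numE.
exists (fine S) => [|i]; first exact: fine_ge0.
have p0 : (0 < 2 `^ enorm R i :> R)%R by rewrite powR_gt0.
rewrite EFinM -Sfin muleC.
have -> : hawkes_mean i t =
    (2 `^ enorm R i)%:E * ((2 `^ (- enorm R i))%:E * hawkes_mean i t).
  by rewrite muleA -EFinM powRN mulfV ?gt_eqF// mul1e.
by apply: lee_wpmul2l; [rewrite lee_fin ltW|exact: termS].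
Qed.

(* The maximum keeps the path nonnegative and jointly measurable at negative times,
   where [f] is arbitrary. *)
Definition centered_path j (x : Omega * measurableTypeR R) : R :=
  (f j x.1 (Num.max x.2 0) - f j x.1 0)%R.

Lemma centered_path_ge0 j x : (0 <= centered_path j x)%R.
Proof.
by rewrite subr_ge0; apply: cumulative_is_nondecreasing; rewrite le_max lexx orbT.
Qed.

Lemma measurable_centered_path j : measurable_fun setT (centered_path j).
Proof.
apply: measurable_funB.
  by apply: measurable_cumulative_pos => t; exact: measurable_hawkes_path.
exact: (measurableT_comp (measurable_hawkes_path j (lexx 0%R)) measurable_fst).
Qed.

Lemma compensator_centered i t w : (0 <= t)%R -> compensator i t w = (mu i * t)%:E +
  ((2 * d + 1)%:R^-1)%:E * \sum_(j <- neighbours R i)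
    \int[lebesgue_measure]_(r in `]0%R, t]) (phi r * centered_path j (w, (t - r)%R))%:E.
Proof.
move=> t0; rewrite compensatorE//; f_equal; f_equal; apply: eq_bigr => j _.
apply: eq_integral => r; rewrite inE /= in_itv /= => /andP[_ rt].
by rewrite /centered_path /= max_l// subr_ge0.
Qed.

Lemma centered_path_ae j s : (0 <= s)%R ->
  {ae P, forall w, centered_path j (w, s) = Z j s w /\ (0 <= Z j s w)%R}.
Proof.
move=> s0; apply: filterS3 N_ae (hawkes_start_ae j) (hawkes_ge0_ae j s0) => w Nw fw Zw.
by split=> //; rewrite /centered_path /= max_l// fw subr0 fZ.
Qed.

Let c0 : 0 <= ((2 * d + 1)%:R^-1 : R)%:E. Proof. by rewrite lee_fin invr_ge0. Qed.

Let convolution_ge0 (g : R -> R) t : (forall s, (0 <= g s)%R) ->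
  0 <= \int[lebesgue_measure]_(r in `]0%R, t]) (phi r * g (t - r))%:E.
Proof.
move=> g0; apply: integral_ge0 => r; rewrite /= in_itv /= => /andP[r0 _].
by rewrite lee_fin mulr_ge0// phi_ge0// ltW.
Qed.

Let measurable_section (H : Omega * measurableTypeR R -> R) s :
  measurable_fun setT H -> measurable_fun setT (fun w => H (w, s)).
Proof. by move=> mH; exact: (measurableT_comp mH (pair2_measurable (s : measurableTypeR R))). Qed.

Lemma centered_path_mean j s : (0 <= s)%R ->
  \int[P]_w (centered_path j (w, s))%:E = hawkes_mean j s.
Proof.
move=> s0; apply: ae_eq_integral => //.
- apply/measurable_EFinP.
  exact: (measurable_section _ (measurable_centered_path j)).
- by apply/measurable_EFinP; apply: measurableT_comp => //; exact: measurable_hawkes.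
- by apply: filterS (centered_path_ae j s0) => w [-> Zw] _; rewrite ger0_norm.
Qed.

Lemma integral_neighbours_average (a : Zlattice d -> Omega -> \bar R)
    (b : Zlattice d -> \bar R) i :
  (forall j, measurable_fun setT (a j)) -> (forall j w, 0 <= a j w) ->
  (forall j, edges R d (j, i) -> \int[P]_w a j w <= b j) ->
  \int[P]_w (((2 * d + 1)%:R^-1)%:E * \sum_(j <- neighbours R i) a j w) <=
  ((2 * d + 1)%:R^-1)%:E * \sum_(j <- neighbours R i) b j.
Proof.
move=> ma a0 ab; rewrite ge0_integralZl//; last 2 first.
- exact: emeasurable_sum.
- by move=> w _; exact: sume_ge0.
apply: lee_wpmul2l => //; rewrite ge0_integral_sum//.
rewrite big_seq [leRHS]big_seq; apply: lee_sum => j.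
by rewrite mem_neighbours => /asboolP; exact: ab.
Qed.

(** The renewal inequality, stated for upper bounds [b] of the means: [b] is real-valued and
    measurable in time, whereas the means may still be infinite. Bounds are requested only at
    neighbours and up to time [t]. *)
Lemma hawkes_mean_convolution (b : Zlattice d -> R -> R) i t : (0 <= t)%R ->
  (forall j, measurable_fun setT (b j)) ->
  (forall j s, edges R d (j, i) -> (0 <= s)%R -> (s <= t)%R ->
    hawkes_mean j s <= (b j s)%:E) ->
  hawkes_mean i t <= (mu i * t)%:E + ((2 * d + 1)%:R^-1)%:E *
    \sum_(j <- neighbours R i)
      \int[lebesgue_measure]_(r in `]0%R, t]) (phi r * b j (t - r))%:E.
Proof.
move=> t0 mb Hb; rewrite hawkes_mean_compensator//.
under eq_integral do rewrite compensator_centered//.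
pose a j w := \int[lebesgue_measure]_(r in `]0%R, t])
  (phi r * centered_path j (w, (t - r)%R))%:E.
have ma j : measurable_fun setT (a j).
  apply: measurable_expectation_convolution => //.
    exact: measurable_centered_path.
  exact: centered_path_ge0.
have a0 j w : 0 <= a j w.
  exact: (@convolution_ge0 (fun s => centered_path j (w, s)) t
    (fun s => centered_path_ge0 j (w, s))).
rewrite ge0_integralD//; last 2 first.
- by move=> w _; apply: mule_ge0 => //; apply: sume_ge0 => j _; exact: a0.
- by apply: measurable_funeM; exact: emeasurable_sum.
rewrite (integral_cst_probability P); apply: leeD => //.
apply: (@integral_neighbours_average a) => // j ij.
apply: expectation_convolution_le => //.
- exact: measurable_centered_path.
- exact: centered_path_ge0.
- by move=> s s0 st; rewrite centered_path_mean// Hb.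
by move=> w _; rewrite lee_fin mulr_ge0.
Qed.

Variables Lam M : R.
Hypothesis LamE : \int[lebesgue_measure]_(t in `[0%R, +oo[) (phi t)%:E = Lam%:E.
Hypotheses (Lam_lt1 : (Lam < 1)%R) (mu_le : forall i, (mu i <= M)%R).

Let Lam0 : (0 <= Lam)%R := kernel_integral_ge0 phi_meas phi_ge0 LamE.
Let M0 : (0 <= M)%R := le_trans (mu_ge0 0%R) (mu_le 0%R).
(** The fixed point of [x = M + Lam * x]: linear growth at rate [C] reproduces itself in the renewal
    inequality. *)
Let C : R := (M / (1 - Lam))%R.
Let C0 : (0 <= C)%R. Proof. by rewrite divr_ge0// subr_ge0 ltW. Qed.
Let CE : (M + Lam * C = C)%R.
Proof.
have L1 : (1 - Lam != 0)%R by rewrite subr_eq0 gt_eqF.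
by rewrite /C; field.
Qed.

Lemma lee_neighbours_average (x : Zlattice d -> \bar R) (y : R) i : (0 <= y)%R ->
  (forall j, edges R d (j, i) -> x j <= y%:E) ->
  ((2 * d + 1)%:R^-1)%:E * \sum_(j <- neighbours R i) x j <= y%:E.
Proof.
move=> y0 xy; apply: (@le_trans _ _ (((2 * d + 1)%:R^-1)%:E *
    \sum_(j <- neighbours R i) y%:E)).
  apply: lee_wpmul2l => //; rewrite big_seq [leRHS]big_seq; apply: lee_sum => j.
  by rewrite mem_neighbours => /asboolP; exact: xy.
by rewrite sumEFin -EFinM lee_fin; apply: neighbours_average_le.
Qed.

(* Starting from the a priori bound [G * 2 `^ |i|] given by the moment condition,
   each use of the renewal inequality halves the term [G * 2 `^ |i| * expR (a * s)]:
   the neighbours cost a factor 2, and [a] is such that the Laplace transform of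
   [phi] at [a] gains a factor 4. *)
Lemma hawkes_mean_linear i t : (0 <= t)%R -> hawkes_mean i t <= (C * t)%:E.
Proof.
move=> T0; have [G G0 mG] := hawkes_mean_weighted T0.
have [a a0 lap] : exists2 a : R, (0 <= a)%R & \int[lebesgue_measure]_(r in `]0%R, +oo[)
    (phi r * expR (- (a * r)))%:E <= (4^-1)%:E.
  by apply: (kernel_laplace phi_meas phi_ge0 LamE); rewrite invr_gt0.
(* The horizon [t] stays fixed during the induction, because the constant [G] depends on it.
   Monotonicity of the means in time gives the initial bound for all earlier [s]. *)
have bound n : forall j s, (0 <= s)%R -> (s <= t)%R ->
    hawkes_mean j s <= (C * s + G / 2 ^+ n * 2 `^ enorm R j * expR (a * s))%:E.
  elim: n => [|n IH] j s s0 st.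
    apply: le_trans (hawkes_mean_mono j s0 st) _; apply: le_trans (mG j) _.
    rewrite lee_fin expr0 divr1 -[leLHS]add0r; apply: lerD; first exact: mulr_ge0.
    rewrite ler_peMr ?mulr_ge0 ?powR_ge0//.
    by rewrite -expR0 ler_expR mulr_ge0.
  pose G' (k : Zlattice d) := (G / 2 ^+ n * 2 `^ enorm R k)%R.
  have G'0 k : (0 <= G' k)%R by rewrite !mulr_ge0 ?powR_ge0 ?invr_ge0 ?exprn_ge0.
  apply: (@le_trans _ _ _ _ _ (@hawkes_mean_convolution
      (fun k u => C * u + G' k * expR (a * u))%R j s s0 _ _)).
  - move=> k; apply: measurable_funD; first exact: measurable_funM.
    apply: measurable_funM => //; apply: (measurableT_comp (@measurable_expR R)).
    by apply: measurable_funM.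
  - by move=> k u _ u0 us; apply: IH => //; exact: le_trans us st.
  apply: (@le_trans _ _ ((M * s)%:E +
      (Lam * C * s + (G / 2 ^+ n * (2 * 2 `^ enorm R j)) * expR (a * s) / 4)%:E)).
    apply: leeD; first by rewrite lee_fin ler_wpM2r.
    apply: lee_neighbours_average.
      apply: addr_ge0; first exact: (mulr_ge0 (mulr_ge0 Lam0 C0) s0).
      rewrite divr_ge0// mulr_ge0 ?expR_ge0// mulrCA mulr_ge0//.
      exact: G'0.
    move=> k kj; apply: le_trans
      (kernel_convolution_exp phi_meas phi_ge0 LamE s0 C0 (G'0 k) a0 lap) _.
    rewrite lee_fin lerD2l ler_wpM2r ?invr_ge0// ler_wpM2r ?expR_ge0//.
    rewrite /G' ler_wpM2l ?divr_ge0 ?exprn_ge0//.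
    rewrite -[X in (X * 2 `^ _)%R]powRr1// -powRD ?pnatr_eq0 ?implybT//.
    rewrite addrC; apply: ler_powR; first by rewrite ler1n.
    exact: enorm_neighbour.
  rewrite -EFinD lee_fin -[X in (_ <= X * s + _)%R]CE exprS.
  have n0 : (2 ^+ n != 0 :> R)%R by rewrite expf_neq0.
  rewrite le_eqVlt; apply/orP; left; apply/eqP; field.
  by rewrite n0.
apply/lee_addgt0Pr => e e0.
have [n ne] := exists_geometric_le (G * 2 `^ enorm R i * expR (a * t)) e0.
apply: le_trans (bound n i t T0 (lexx _)) _.
rewrite -EFinD lee_fin lerD2l; apply: le_trans ne.
by rewrite -!mulrA (mulrC (2 ^+ n)^-1)%R !mulrA.
Qed.

(** * Sublinearity of the error and convergence in probability *)

Variable q : Zlattice d -> R.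
Hypotheses (q_ge0 : forall i, (0 <= q i)%R) (q_le : forall i, (q i <= C)%R).
Hypothesis qE : forall i,
  (q i = mu i + Lam * ((2 * d + 1)%:R^-1 * \sum_(j <- neighbours R i) q j))%R.

Definition hawkes_error i t : \bar R := \int[P]_w `|Z i t w - q i * t|%:E.

Lemma measurable_path_error j : measurable_fun setT
  (fun x : Omega * measurableTypeR R => `|centered_path j x - q j * x.2|%R).
Proof.
apply: measurableT_comp => //; apply: measurable_funB.
  exact: measurable_centered_path.
by apply: measurable_funM => //; exact: measurable_snd.
Qed.

Lemma hawkes_error_path i s : (0 <= s)%R ->
  \int[P]_w `|centered_path i (w, s) - q i * s|%:E = hawkes_error i s.
Proof.
move=> s0; apply: ae_eq_integral => //.
- by apply/measurable_EFinP; exact: (measurable_section _ (measurable_path_error i)).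
- apply/measurable_EFinP; apply: measurableT_comp => //; apply: measurable_funB => //.
  exact: measurable_hawkes.
- by apply: filterS (centered_path_ae i s0) => w [-> _].
Qed.

(** The initial step of the iteration: the mean of the process and [q i * t] are both at most
    [C * t]. *)
Lemma hawkes_error_linear i t : (0 <= t)%R -> hawkes_error i t <= (2 * C * t)%:E.
Proof.
move=> t0; have mZ := measurable_hawkes i t0.
apply: (@le_trans _ _ (\int[P]_w (`|Z i t w|%:E + (C * t)%:E))).
  apply: ge0_le_integral => //.
  - apply/measurable_EFinP; apply: measurableT_comp => //; exact: measurable_funB.
  - by apply: emeasurable_funD => //; apply/measurable_EFinP; exact: measurableT_comp.
  move=> w _; rewrite -EFinD lee_fin; apply: le_trans (ler_normB _ _) _.
  by rewrite lerD2l ger0_norm ?mulr_ge0// ler_wpM2r.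
rewrite ge0_integralD//; last 2 first.
- by apply/measurable_EFinP; exact: measurableT_comp.
- by move=> w _; rewrite lee_fin mulr_ge0.
rewrite (integral_cst_probability P) -mulrA mulr_natl mulr2n EFinD.
by apply: leeD => //; exact: hawkes_mean_linear.
Qed.

(** By the fixed point equation for [q], both quantities are [mu i * t] plus an average over
    neighbours, and are compared term by term. The bound holds at every outcome; expectations are
    taken afterwards. *)
Lemma compensator_error i t (eps D : R) : (0 <= t)%R -> (0 <= eps)%R -> (0 <= D)%R ->
  (Lam * t)%:E <= \int[lebesgue_measure]_(r in `]0%R, t]) (phi r * (t - r))%:E +
    (eps * t + D)%:E ->
  forall w, `|compensator i t w - (q i * t)%:E| <=
    ((2 * d + 1)%:R^-1)%:E * \sum_(j <- neighbours R i)
      (\int[lebesgue_measure]_(r in `]0%R, t])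
        (phi r * `|centered_path j (w, (t - r)%R) - q j * (t - r)|)%:E +
       (q j * (eps * t + D))%:E).
Proof.
move=> t0 e0 D0 defect w; rewrite compensator_centered//.
pose cv j := \int[lebesgue_measure]_(r in `]0%R, t])
  (phi r * centered_path j (w, (t - r)%R))%:E.
pose err j := \int[lebesgue_measure]_(r in `]0%R, t])
  (phi r * `|centered_path j (w, (t - r)%R) - q j * (t - r)|)%:E.
have key j : cv j <= (Lam * (q j * t))%:E + err j /\
    (Lam * (q j * t))%:E <= cv j + (err j + (q j * (eps * t + D))%:E).
  apply: (kernel_convolution_error phi_meas phi_ge0 LamE (g := fun s => centered_path j (w, s))) => //.
  - exact: (measurableT_comp (measurable_centered_path j) (pair1_measurable w)).
  - by move=> s; exact: centered_path_ge0.
have cv0 j : 0 <= cv j.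
  exact: (@convolution_ge0 (fun s => centered_path j (w, s)) t
    (fun s => centered_path_ge0 j (w, s))).
have err0 j : 0 <= err j.
  exact: (@convolution_ge0 (fun s => `|centered_path j (w, s) - q j * s|)%R t
    (fun s => normr_ge0 _)).
have l0 j : 0 <= (Lam * (q j * t))%:E by rewrite lee_fin !mulr_ge0.
have d0 j : 0 <= (q j * (eps * t + D))%:E.
  by rewrite lee_fin mulr_ge0// addr_ge0// mulr_ge0.
have qtE : (q i * t)%:E = (mu i * t)%:E + ((2 * d + 1)%:R^-1)%:E *
    \sum_(j <- neighbours R i) (Lam * (q j * t))%:E.
  rewrite sumEFin -EFinM -EFinD qE mulrDl; congr (_ + _)%:E%R.
  by rewrite -mulr_sumr -mulr_suml mulrCA !mulrA.
have average_le (x y e : Zlattice d -> \bar R) : (forall j, 0 <= y j) ->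
    (forall j, 0 <= e j) -> (forall j, x j <= y j + e j) ->
    (mu i * t)%:E + ((2 * d + 1)%:R^-1)%:E * \sum_(j <- neighbours R i) x j <=
    (mu i * t)%:E + ((2 * d + 1)%:R^-1)%:E * \sum_(j <- neighbours R i) y j +
    ((2 * d + 1)%:R^-1)%:E * \sum_(j <- neighbours R i) e j.
  move=> y0 e0' xye; rewrite -addeA; apply: leeD => //.
  have ys : 0 <= \sum_(j <- neighbours R i) y j by exact: sume_ge0.
  have es : 0 <= \sum_(j <- neighbours R i) e j by exact: sume_ge0.
  rewrite -(@ge0_muleDr _ _ _ _ ys es) -big_split/=; apply: lee_wpmul2l => //.
  by apply: lee_sum => j _; exact: xye.
have ed0 j : 0 <= err j + (q j * (eps * t + D))%:E by exact: adde_ge0.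
have qt : (mu i * t)%:E + ((2 * d + 1)%:R^-1)%:E * \sum_(j <- neighbours R i) cv j <=
    (q i * t)%:E + ((2 * d + 1)%:R^-1)%:E * \sum_(j <- neighbours R i)
      (err j + (q j * (eps * t + D))%:E).
  rewrite qtE; apply: average_le => // j.
  by apply: le_trans (key j).1 _; apply: leeD => //; rewrite leeDl.
apply: (abse_sub_le qt); rewrite qtE; apply: average_le => // j.
exact: (key j).2.
Qed.

(** The error splits into the distance from the process to its compensator and that from the
    compensator to [q i * t]. The former and the defect of the kernel cost a small slope; only the
    latter involves the errors at the neighbours, with a factor [Lam]. All bounds are uniform in the
    site, hence so is [D], as the next iteration requires. *)
Lemma hawkes_error_contraction (k D0 eps : R) : (0 <= k)%R -> (0 <= D0)%R -> (0 < eps)%R ->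
  (forall j s, (0 <= s)%R -> hawkes_error j s <= (k * s + D0)%:E) ->
  exists2 D : R, (0 <= D)%R &
    forall i t, (0 <= t)%R -> hawkes_error i t <= ((Lam * k + eps) * t + D)%:E.
Proof.
(* The stochastic error and the kernel defect each contribute a slope [e * C], to be kept below
   [eps / 2]. The denominator has [C + 1] because [C] may vanish. *)
move=> k0 D00 e0 IH; pose e := (eps / (2 * (C + 1)))%R.
have C1 : (0 < C + 1)%R by rewrite ltr_wpDl.
have e_gt0 : (0 < e)%R by rewrite divr_gt0// mulr_gt0.
have eC : (e * C <= eps / 2)%R.
  have -> : (e * C = eps / 2 * (C / (C + 1)))%R.
    by rewrite /e; field; rewrite gt_eqF.
  rewrite ler_piMr//; first by rewrite divr_ge0// ltW.
  by rewrite ler_pdivrMr// mul1r lerDl.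
have [D D_ge0 defect] := kernel_convolution_defect phi_meas phi_ge0 LamE e_gt0.
exists ((4 * e)^-1 + (Lam * D0 + C * D))%R.
  apply: addr_ge0; first by rewrite invr_ge0 mulr_ge0// ltW.
  by apply: addr_ge0; exact: mulr_ge0.
move=> i t t0.
pose err j w := \int[lebesgue_measure]_(r in `]0%R, t])
  (phi r * `|centered_path j (w, (t - r)%R) - q j * (t - r)|)%:E.
have err0 j w : 0 <= err j w.
  exact: (@convolution_ge0 (fun s => `|centered_path j (w, s) - q j * s|)%R t
    (fun s => normr_ge0 _)).
have merr j : measurable_fun setT (err j).
  exact: (measurable_expectation_convolution phi_meas phi_ge0 t
    (measurable_path_error j) (fun x => normr_ge0 _)).
have d0 j : 0 <= (q j * (e * t + D))%:E.
  by rewrite lee_fin mulr_ge0// addr_ge0// mulr_ge0// ltW.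
have mZ := measurable_hawkes i t0.
have mcomp := measurable_compensator i t0.
have mdist : measurable_fun setT (fun w => `|(Z i t w)%:E - compensator i t w|).
  apply: measurableT_comp => //; apply: emeasurable_funB => //.
  exact/measurable_EFinP.
have mdist' : measurable_fun setT (fun w => `|compensator i t w - (q i * t)%:E|).
  by apply: measurableT_comp => //; exact: emeasurable_funB.
have mavg : measurable_fun setT (fun w => ((2 * d + 1)%:R^-1)%:E *
    \sum_(j <- neighbours R i) (err j w + (q j * (e * t + D))%:E)).
  apply: measurable_funeM; apply: emeasurable_sum => j _.
  exact: emeasurable_funD.
have stoch : \int[P]_w `|(Z i t w)%:E - compensator i t w| <=
    (e * (C * t) + (4 * e)^-1)%:E.
  have mt := hawkes_mean_linear i t0.
  apply: le_trans (hawkes_L1_bound t0 e_gt0 (le_lt_trans mt (ltry _))) _.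
  rewrite EFinD; apply: leeD => //; rewrite [leRHS]EFinM; apply: lee_wpmul2l => //.
  by rewrite lee_fin ltW.
have drift : \int[P]_w `|compensator i t w - (q i * t)%:E| <=
    (Lam * (k * t + D0) + C * (e * t + D))%:E.
  apply: (@le_trans _ _ (\int[P]_w (((2 * d + 1)%:R^-1)%:E *
      \sum_(j <- neighbours R i) (err j w + (q j * (e * t + D))%:E)))).
    apply: ge0_le_integral => // w _.
    exact: (compensator_error i t0 (ltW e_gt0) D_ge0 (defect t t0) w).
  apply: (@le_trans _ _ (((2 * d + 1)%:R^-1)%:E * \sum_(j <- neighbours R i)
      ((Lam * (k * t + D0))%:E + (q j * (e * t + D))%:E))).
    apply: (@integral_neighbours_average (fun j w => err j w + (q j * (e * t + D))%:E)).
    - by move=> j; exact: emeasurable_funD.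
    - by move=> j w; exact: adde_ge0.
    move=> j _; rewrite ge0_integralD// (integral_cst_probability P); apply: leeD => //.
    apply: le_trans (kernel_convolution_affine phi_meas phi_ge0 LamE t0 k0 D00).
    apply: (expectation_convolution_le phi_meas phi_ge0 (b := fun s => (k * s + D0)%R)
      (measurable_path_error j) (fun x => normr_ge0 _)).
      by apply: measurable_funD => //; exact: measurable_funM.
    by move=> s s0 _; rewrite hawkes_error_path// IH.
  apply: lee_neighbours_average.
    rewrite addr_ge0//; first by rewrite mulr_ge0// addr_ge0// mulr_ge0.
    by rewrite mulr_ge0// addr_ge0// mulr_ge0// ltW.
  move=> j _; rewrite -EFinD lee_fin lerD2l ler_wpM2r//.
  by rewrite addr_ge0// mulr_ge0// ltW.
apply: (@le_trans _ _ (\int[P]_w (`|(Z i t w)%:E - compensator i t w| +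
    `|compensator i t w - (q i * t)%:E|))).
  apply: ge0_le_integral => //.
  - apply/measurable_EFinP; apply: measurableT_comp => //; exact: measurable_funB.
  - exact: emeasurable_funD.
  by move=> w _; exact: (abse_triangle_fin _ _ (compensator i t w)).
rewrite ge0_integralD//; apply: le_trans (leeD stoch drift) _.
rewrite -EFinD lee_fin.
have eCt := ler_wpM2r t0 eC.
set b := ((4 * e)^-1)%R.
have -> : ((Lam * k + eps) * t + (b + (Lam * D0 + C * D)) =
  (eps / 2 * t + b) + (Lam * (k * t + D0) + (eps / 2 * t + C * D)))%R by field.
rewrite (_ : C * (e * t + D) = e * C * t + C * D)%R; last by ring.
by rewrite (mulrA e) !lerD.
Qed.

Lemma hawkes_error_sublinear (eps : R) : (0 < eps)%R ->
  exists2 D : R, (0 <= D)%R &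
    forall i t, (0 <= t)%R -> hawkes_error i t <= (eps * t + D)%:E.
Proof.
(* With this choice [eps / 2] is the fixed point of [k = Lam * k + eps'], so that the excess of the
   slope over [eps / 2] is multiplied by exactly [Lam] at each iteration. *)
move=> e0; pose eps' := ((1 - Lam) * (eps / 2))%R.
have e'0 : (0 < eps')%R by rewrite mulr_gt0 ?subr_gt0// divr_gt0.
have iter n : exists2 D : R, (0 <= D)%R & forall i t, (0 <= t)%R ->
    hawkes_error i t <= ((Lam ^+ n * (2 * C) + eps / 2) * t + D)%:E.
  elim: n => [|n [D D0 IH]].
    exists 0%R => // i t t0; apply: le_trans (hawkes_error_linear i t0) _.
    by rewrite lee_fin addr0 expr0 mul1r ler_wpM2r// lerDl divr_ge0// ltW.
  have k0 : (0 <= Lam ^+ n * (2 * C) + eps / 2)%R.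
    apply: addr_ge0; last by rewrite divr_ge0// ltW.
    by apply: mulr_ge0; [exact: exprn_ge0|exact: mulr_ge0].
  have [D' D'0 IH'] := hawkes_error_contraction k0 D0 e'0 IH.
  exists D' => // i t t0; apply: le_trans (IH' i t t0) _.
  rewrite lee_fin lerD2r ler_wpM2r// /eps' exprS le_eqVlt; apply/orP; left.
  by apply/eqP; field.
have [n Ln] : exists n, (Lam ^+ n * (2 * C) <= eps / 2)%R.
  have : (Lam ^+ n * (2 * C))%R @[n --> \oo] --> (0 * (2 * C))%R.
    by apply: cvgMl; apply: cvg_expr; rewrite ger0_norm.
  rewrite mul0r => /cvgrPdist_le /(_ _ (divr_gt0 e0 (ltr0n _ 2))) [n _ /(_ n (leqnn n))].
  by rewrite sub0r normrN => /(le_trans (ler_norm _)) ?; exists n.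
have [D D0 HD] := iter n; exists D => // i t t0; apply: le_trans (HD i t t0) _.
by rewrite lee_fin lerD2r ler_wpM2r// [leRHS](splitr eps) lerD2r.
Qed.

Lemma hawkes_cvg_in_probability i :
  cvg_in_probability P (fun t w => (t^-1 * Z i t w)%R) (q i)%:E.
Proof.
move=> eps e0.
pose A t : set Omega := [set w | eps%:E < `|(t^-1 * Z i t w)%:E - (q i)%:E|].
have mdiff t : (0 <= t)%R -> measurable_fun setT (fun w => (Z i t w - q i * t)%R).
  by move=> t0; apply: measurable_funB => //; exact: measurable_hawkes.
have small (delta : R) : (0 < delta)%R -> \forall t \near +oo%R, P (A t) <= delta%:E.
  move=> delta0; have ed : (0 < eps * delta / 2)%R by rewrite divr_gt0 ?mulr_gt0.
  have [D D0 HD] := hawkes_error_sublinear ed.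
  near=> t.
  have t0 : (0 < t)%R by near: t; exact: nbhs_pinfty_gt.
  have tD : (D / (eps * delta / 2) <= t)%R.
    by near: t; apply: nbhs_pinfty_ge; exact: num_real.
  pose B : set Omega := [set w | (eps * t)%:E <= `|(Z i t w - q i * t)%:E|].
  have mB : measurable B.
    rewrite /B -[X in measurable X]setTI; apply: emeasurable_fun_c_infty => //.
    by apply: measurableT_comp => //; apply/measurable_EFinP; exact/mdiff/ltW.
  have AB : A t `<=` B.
    move=> w; rewrite /A /B /= lte_fin lee_fin => /ltW h.
    have -> : (Z i t w - q i * t = t * (t^-1 * Z i t w - q i))%R.
      by field; rewrite gt_eqF.
    by rewrite normrM gtr0_norm// mulrC ler_wpM2l// ltW.
  have mA : measurable (A t).
    rewrite /A -[X in measurable X]setTI; apply: emeasurable_fun_o_infty => //.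
    apply: measurableT_comp => //; apply: emeasurable_funB => //.
    apply/measurable_EFinP; apply: measurable_funM => //.
    exact/measurable_hawkes/ltW.
  apply: (@le_trans _ _ (P B)); first by apply: le_measure; rewrite ?inE.
  have et : (0 < eps * t)%R by rewrite mulr_gt0.
  have := @le_integral_comp_abse _ _ _ P setT measurableT
    (fun w => (Z i t w - q i * t)%:E) (eps * t)%R id (@measurable_id _ _ _)
    (fun _ h => h) (fun _ _ _ _ h => h) _ et.
  rewrite setTI => /(_ _)/le_trans.
  have mEdiff : measurable_fun setT (fun w => (Z i t w - q i * t)%:E).
    by apply/measurable_EFinP; exact/mdiff/ltW.
  move=> /(_ _ mEdiff (HD i t (ltW t0))) h.
  rewrite -(@lee_pmul2l _ (eps * t)%:E)//; apply: le_trans h _.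
  rewrite -EFinM lee_fin; move: tD; rewrite ler_pdivrMr// => tD.
  by rewrite (_ : eps * t * delta = eps * delta / 2 * t + t * (eps * delta / 2))%R ?lerD2l//; field.
apply/fine_cvgP; split.
  apply: filterS (small 1%R ltr01) => t Pt.
  by rewrite ge0_fin_numE//; apply: le_lt_trans Pt (ltry _).
apply/cvgrPdist_le => delta delta0; apply: filterS (small _ delta0) => t Pt /=.
rewrite sub0r normrN ger0_norm ?fine_ge0//.
by rewrite -lee_fin fineK// ge0_fin_numE//; apply: le_lt_trans Pt (ltry _).
Unshelve. all: by end_near.
Qed.

End intensity.

End hawkes_paths.

Unset Implicit Arguments.
Set Strict Implicit.
Set Printing Implicit Defensive.

Theorem theorem14 (R : realType) (disp : measure_display)
    (Omega : measurableType disp) (P : probability Omega R)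
    (d : nat) (d_gt0 : (1 <= d)%N)
    (phi : R -> R)
    (phi_meas : measurable_fun (`[0%R, +oo[%classic : set R) phi)
    (phi_ge0 : forall t : R, (0 <= t)%R -> (0 <= phi t)%R)
    (Lam : R)
    (LamE : \int[lebesgue_measure]_(t in `[0%R, +oo[) (phi t)%:E = Lam%:E)
    (Lam_lt1 : (Lam < 1)%R)
    (mu : Zlattice d -> R)
    (mu_ge0 : forall i, (0 <= mu i)%R)
    (mu_bounded : exists M : R, forall i, (mu i <= M)%R)
    (F : R -> set_system Omega) (F_filtration : filtration F)
    (pi : Zlattice d -> R.-ker Omega ~> plane R)
    (pi_poisson : iid_poisson_measures P F pi)
    (Z : Zlattice d -> R -> Omega -> R)
    (Z_hawkes : nn_linear_hawkes P F pi phi mu Z) :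
  forall i : Zlattice d,
    cvg_in_probability P (fun t w => (t^-1 * Z i t w)%R)
      (\esum_(j in setT) (Qmat Lam i j * (mu j)%:E)).
Proof.
move=> i; have [M mu_le] := mu_bounded.
have Lam0 := kernel_integral_ge0 phi_meas phi_ge0 LamE.
have [q [qS q_ge0 q_le qE]] := resolvent_fixpoint Lam0 Lam_lt1 mu_ge0 mu_le.
have [f [N [[mN PN fN] fZ f_eq]]] := exists_hawkes_paths Z_hawkes.
rewrite qS.
exact: (hawkes_cvg_in_probability F_filtration Z_hawkes mN PN fN fZ phi_meas phi_ge0
  mu_ge0 pi_poisson f_eq LamE Lam_lt1 mu_le q_ge0 q_le qE i).
Qed.
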